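(* Let $\beta\ge1$, let $\varphi_1,\ldots,\varphi_n$ be analytic self-maps of $D$, let $F=F(\varphi_1)\cup\cdots\cup F(\varphi_n)$, and let $\zeta\in F$. Assume that every $\varphi_j$ with $\zeta\in F(\varphi_j)$ has sufficient data at $\zeta$. Let $C_{\varphi_1},\ldots,C_{\varphi_n}$ act on $\mathcal{D}_\beta$. If $c_1,\ldots,c_n$ are complex numbers and $k\ge3$ is an integer, then $$\|c_1C_{\varphi_1}+\cdots+c_nC_{\varphi_n}\|_e^2\ \ge\ \sum_{\mathbf{d}\in\mathcal{D}_{k-1}(\zeta)}\ \Bigg|\sum_{\substack{j\in\mathbb{M}_k(\zeta)\\ D_{k-1}(\varphi_j,\zeta)=\mathbf{d}}}c_j\Bigg|^2\frac{1}{|d_1|^\beta},$$ where $\mathbf{d}=(d_0,d_1,\ldots,d_{k-1})$ (an empty inner sum is $0$).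
   Context: $D$ is the open unit disk. For $\beta\ge1$, $\mathcal{D}_\beta$ is the reproducing kernel Hilbert space of analytic functions on $D$ with kernel functions $k_w(z)=(1-\overline{w}z)^{-\beta}$ ($\mathcal{D}_1=H^2$; for $\beta>1$ a weighted Bergman space). $C_\varphi f=f\circ\varphi$. $\|T\|_e$ is the operator-norm distance from $T$ to the compact operators. An analytic self-map $\varphi$ of $D$ has a finite angular derivative at $\zeta\in\partial D$ if the non-tangential limit $\varphi(\zeta)$ exists with $|\varphi(\zeta)|=1$ and $\varphi'(\zeta)=\lim_{\angle z\to\zeta}\frac{\varphi(z)-\varphi(\zeta)}{z-\zeta}$ exists finitely; $F(\varphi)$ is the set of such $\zeta$. $\varphi$ has $k$-th order data at $\zeta\in\partial D$ if there are complex $b_0,\ldots,b_k$ with $|b_0|=1$ and $\varphi(z)=b_0+b_1(z-\zeta)+\cdots+b_k(z-\zeta)^k+o(|z-\zeta|^k)$ as $z\to\zeta$ unrestrictedly in $D$; then $\varphi^{(j)}(\zeta):=j!\,b_j$ and $D_k(\varphi,\zeta)=(\varphi(\zeta),\varphi'(\zeta),\ldots,\varphi^{(k)}(\zeta))$. $\varphi$ has order of contact $c>0$ at $\zeta$ if $|\varphi(\zeta)|=1$ and $\frac{1-|\varphi(e^{i\theta})|^2}{|\varphi(\zeta)-\varphi(e^{i\theta})|^c}$ is essentially bounded above and away from zero as $e^{i\theta}\to\zeta$. $\varphi$ has sufficient data at $\zeta$ if (i) $\varphi$ has finite angular derivative at $\zeta$; (ii) $\varphi$ has order of contact $2m$ at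 $\zeta$ for some natural number $m\ge 1$; (iii) $\varphi$ has $2m$-th order data at $\zeta$. For an integer $k\ge2$, $\mathbb{M}_k(\zeta)$ is the set of $j\in\{1,\ldots,n\}$ with $\zeta\in F(\varphi_j)$ and order of contact of $\varphi_j$ at $\zeta$ at least $k$; and $\mathcal{D}_k(\zeta)=\{D_k(\varphi_j,\zeta):j\in\mathbb{M}_k(\zeta)\}$ (a set, without repetition). *)

(* Defs.v *)
From HB Require Import structures.
From mathcomp Require Import all_boot all_order all_algebra sesquilinear.
From mathcomp Require Import complex.
From mathcomp Require Import all_classical all_reals all_analysis.

Set Implicit Arguments.
Unset Strict Implicit.
Unset Printing Implicit Defensive.

Import Order.TTheory GRing.Theory Num.Theory.
Import numFieldNormedType.Exports.

Local Open Scope classical_set_scope.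
Local Open Scope ring_scope.

(* R[i] carries no canonical topology; through this numClosedFieldType it gets
   the usual one, and cplx R is convertible to R[i]. *)
Definition cplx (R : realType) : numClosedFieldType := R[i].

Section Complex.
Variable R : realType.
Local Notation C := (cplx R).

(* Norms over C (including the modulus on C) take their real values in C; rnorm
   is the same number as an element of R. *)
Definition rnorm (V : normedZmodType C) (x : V) : R := complex.Re `|x|.

Definition expi (t : R) : C := Complex (cos t) (sin t).

(* u ^ s for the principal branch, for u in the right half-plane 0 < Re u only:
   there the principal argument of u is atan (Im u / Re u). *)
Definition cpowr (u : C) (s : R) : C :=
  Complex (rnorm u `^ s) 0 * expi (s * atan (complex.Im u / complex.Re u)).

Definition disk : set C := [set z | `|z| < 1].

Definition analytic_on_disk (f : C -> C) : Prop :=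
  forall z, disk z -> derivable f z 1.

Definition analytic_selfmap (phi : C -> C) : Prop :=
  analytic_on_disk phi /\ (forall z, disk z -> disk (phi z)).

Definition stolz (M : R) (zeta : C) : set C :=
  [set z | disk z /\ rnorm (z - zeta) < M * (1 - rnorm z)].

Definition nontangential_lim (f : C -> C) (zeta w : C) : Prop :=
  forall M : R, 1 < M -> f z @[z --> within (stolz M zeta) (nbhs zeta)] --> w.

(* F(phi): the boundary points with a finite angular derivative *)
Definition angular_set (phi : C -> C) : set C :=
  [set zeta | `|zeta| = 1 /\
    exists w, [/\ nontangential_lim phi zeta w, `|w| = 1 &
      exists l, nontangential_lim (fun z => (phi z - w) / (z - zeta)) zeta l]].

Definition order_data (k : nat) (phi : C -> C) (zeta : C)
    (b : k.+1.-tuple C) : Prop :=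
  `|b`_0| = 1 /\
  forall eps : C, 0 < eps -> \forall z \near within disk (nbhs zeta),
    `|phi z - \sum_(j < k.+1) b`_j * (z - zeta) ^+ j|
      <= eps * `|z - zeta| ^+ k.

(* D_k(phi, zeta) = (phi(zeta), ..., phi^(k)(zeta)); the coefficients b are
   unique when they exist, and D_k is a dummy value otherwise. *)
Definition data_vector (k : nat) (phi : C -> C) (zeta : C) : k.+1.-tuple C :=
  let b := xget [tuple of nseq k.+1 0] [set b | @order_data k phi zeta b] in
  [tuple (j`!)%:R * tnth b j | j < k.+1].

(* phi (e^{it}) is the nontangential limit w of phi at e^{it}, which exists for
   almost every t by Fatou's theorem. *)
Definition order_of_contact (phi : C -> C) (zeta : C) (c : R) : Prop :=
  0 < c /\ exists w0, [/\ nontangential_lim phi zeta w0, `|w0| = 1 &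
    exists A B delta : R, [/\ 0 < A, 0 < delta &
      {ae (@lebesgue_measure R), forall t : R,
        rnorm (expi t - zeta) < delta ->
        exists2 w, nontangential_lim phi (expi t) w &
          A <= (1 - rnorm w ^+ 2) / rnorm (w0 - w) `^ c <= B}]].

Definition sufficient_data (phi : C -> C) (zeta : C) : Prop :=
  angular_set phi zeta /\
  exists m : nat, [/\ (1 <= m)%N, order_of_contact phi zeta (2 * m)%:R &
    exists b : (2 * m).+1.-tuple C, order_data phi zeta b].

Section Families.
Variables (n : nat) (phi : 'I_n -> C -> C) (zeta : C).

(* M_k(zeta).  Under sufficient data the order of contact is unique, so "order
   of contact at least k" is "some order of contact c >= k". *)
Definition contact_index (k : nat) : set 'I_n :=
  [set j | angular_set (phi j) zeta /\
    exists2 c : R, k%:R <= c & order_of_contact (phi j) zeta c].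

(* script D_k(zeta) *)
Definition data_set (k : nat) : set (k.+1.-tuple C) :=
  [set data_vector k (phi j) zeta | j in contact_index k].

End Families.

(* A Hilbert space of analytic functions on the disk with reproducing kernel
   k w z = k_w(z).  A vector f stands for the function eval f restricted to the
   disk; values of eval f off the disk carry no information. *)
Record rkhs (k : C -> C -> C) := Rkhs {
  rkhs_space :> completeNormedModType C;
  rkhs_dot : {dot rkhs_space for @Num.conj C};
  rkhs_normE : forall f : rkhs_space, `|f| ^+ 2 = rkhs_dot f f;
  eval : rkhs_space -> C -> C;
  eval_linear : forall (a : C) (f g : rkhs_space) z, disk z ->
    eval (a *: f + g) z = a * eval f z + eval g z;
  eval_inj : forall f g : rkhs_space,
    (forall z, disk z -> eval f z = eval g z) -> f = g;
  eval_analytic : forall f : rkhs_space, analytic_on_disk (eval f);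
  rkhs_kernel : forall w, disk w -> exists2 kw : rkhs_space,
    (forall z, disk z -> eval kw z = k w z) &
    (forall f : rkhs_space, rkhs_dot f kw = eval f w)
}.

Definition Dspace (beta : R) :=
  rkhs (fun w z : C => cpowr (1 - w^* * z) (- beta)).

Definition composition_operator (k : C -> C -> C) (H : rkhs k) (phi : C -> C)
    (T : H -> H) : Prop :=
  forall (f : H) z, disk z -> eval (T f) z = eval f (phi z).

Section Operators.
Variable H : normedModType C.

Definition op_norm (T : H -> H) : \bar R :=
  ereal_sup [set (rnorm (T f))%:E | f in [set f : H | `|f| <= 1]].

Definition compact_operator (K : {linear H -> H}) : Prop :=
  compact (closure (K @` [set f : H | `|f| <= 1])).

Definition essential_norm (T : H -> H) : \bar R :=
  ereal_inf [set op_norm (T \- K) | K in compact_operator].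

End Operators.
End Complex.

Arguments data_set {R n} phi zeta k _.

(* Main.v *)
Require Import Defs.
From HB Require Import structures.
From mathcomp Require Import all_boot all_order all_algebra sesquilinear.
From mathcomp Require Import complex.
From mathcomp Require Import all_classical all_reals all_analysis.
From mathcomp Require Import ring lra.

Set Implicit Arguments.
Unset Strict Implicit.
Unset Printing Implicit Defensive.

Import Order.TTheory GRing.Theory Num.Theory.
Import numFieldNormedType.Exports.

Local Open Scope classical_set_scope.
Local Open Scope ring_scope.

(* Normalized kernels tend weakly to 0 at the boundary, so compact operators do not
   affect the limit of || T^* k_w || / || k_w || for T = sum_j c_j C_{phi_j}, and
   T^* k_w = sum_j conj (c_j) k_{phi_j w}. Let w -> zeta along (1 - rho) u with
   |u| = 1, t = |u - zeta| and t ^ k << rho << t ^ (k - 1). Then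
   (1 - conj (phi_i w) phi_j w) / (1 - |w|^2) tends to |d_1| if phi_i and phi_j have
   contact of order at least k and the same data d of order k - 1, and to infinity
   otherwise; hence the Gram matrix of the normalized kernels at the phi_j w
   converges to a block matrix with blocks |d_1| ^ (- beta), which is the claimed sum.

   For maps without angular derivative at zeta this is the Julia-Caratheodory
   theorem. It rests on the Schwarz-Pick inequality, which for merely
   differentiable maps is obtained from a discrete form of Goursat's theorem. *)

(** * The complex plane *)

Section ComplexPlane.
Variable R : realType.
Local Notation C := (cplx R).

(** The two scales play different roles. Over a boundary point [u] at distance t from [zeta], 1 -
    |phi u|^2 has size t ^ c, with c the order of contact; moving inwards by rho adds about 2 |d_1|
    rho. With rho strictly between t ^ k and t ^ (k - 1), contact c >= k makes the boundary term
    negligible and leaves the ratio |d_1|, whereas c <= k - 1 makes it dominate. The same scale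
    separates data. Equal data of order k - 1 leave a difference O(t ^ k); this takes an expansion
    of order k, available because the order of the data equals the order of contact. Different data
    leave at least a multiple of t ^ (k - 1). A radial path has rho = t, and there maps whose data
    differ only beyond first order would stay together. Contact is known only at almost every
    boundary point and through nontangential limits. So [u] is taken from a set of full measure near
    [zeta], expansions are first carried to the boundary, and finitely many estimates are met at one
    common [u]. When only one map of a pair is out of contact, the other still satisfies 1 - |phi
    w|^2 >= a (1 - |w|^2), which is enough. *)

Definition realC (x : R) : C := Complex x 0.

Lemma realCD x y : realC (x + y) = realC x + realC y.
Proof. by apply/eqP; rewrite eq_complex /= addr0 !eqxx. Qed.
Lemma realCN x : realC (- x) = - realC x.
Proof. by apply/eqP; rewrite eq_complex /= oppr0 !eqxx. Qed.
Lemma realCB x y : realC (x - y) = realC x - realC y.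
Proof. by rewrite realCD realCN. Qed.
Lemma realCM x y : realC (x * y) = realC x * realC y.
Proof. by apply/eqP; rewrite eq_complex /= !mulr0 !mul0r subr0 addr0 !eqxx. Qed.
Lemma realC0 : realC 0 = 0. Proof. by []. Qed.
Lemma realC1 : realC 1 = 1. Proof. by []. Qed.
Lemma realC_inj : injective realC. Proof. by move=> x y []. Qed.
Lemma realC_eq0 x : (realC x == 0) = (x == 0).
Proof. by rewrite -realC0 (inj_eq realC_inj). Qed.
Lemma realCV x : realC x^-1 = (realC x)^-1.
Proof.
have [->|x0] := eqVneq x 0; first by rewrite realC0 !invr0 realC0.
have cx0 : realC x != 0 by rewrite realC_eq0.
by apply: (mulfI cx0); rewrite -realCM !divff.
Qed.
Lemma realCX x n : realC (x ^+ n) = realC x ^+ n.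
Proof. by elim: n => [|n IH]; rewrite ?expr0 // !exprS realCM IH. Qed.

(** Carries estimates from [C], whose order is partial, to [R], where linear and nonlinear real
    arithmetic applies; this is why later bounds are stated with [rnorm]. *)
Lemma normE (V : normedZmodType C) (x : V) : `|x| = realC (rnorm x).
Proof.
rewrite /rnorm /realC; have := normr_ge0 x; rewrite lecE /= => /andP[/eqP im0 _].
by case: (`|x|) im0 => a b /= ->.
Qed.

Lemma realC_le x y : (realC x <= realC y) = (x <= y).
Proof. by rewrite lecE /= eqxx. Qed.
Lemma realC_lt x y : (realC x < realC y) = (x < y).
Proof. by rewrite ltcE /= eqxx. Qed.

Lemma realC_gt0P (e : C) : 0 < e -> 0 < complex.Re e /\ e = realC (complex.Re e).
Proof. by case: e => a b; rewrite ltcE /= => /andP[/eqP -> ->]. Qed.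

Section Norm.
Variable V : normedZmodType C.
Implicit Types x y : V.

Lemma rnorm_ge0 x : 0 <= rnorm x.
Proof. by rewrite -realC_le -normE realC0. Qed.
Lemma rnormD x y : rnorm (x + y) <= rnorm x + rnorm y.
Proof. by rewrite -realC_le realCD -!normE ler_normD. Qed.
Lemma rnormN x : rnorm (- x) = rnorm x.
Proof. by rewrite /rnorm normrN. Qed.
Lemma rnorm_distC x y : rnorm (x - y) = rnorm (y - x).
Proof. by rewrite /rnorm distrC. Qed.
Lemma rnormB x y : rnorm (x - y) <= rnorm x + rnorm y.
Proof. by rewrite -[rnorm y]rnormN rnormD. Qed.
Lemma rnorm_eq0 x : (rnorm x == 0) = (x == 0).
Proof. by rewrite -realC_eq0 -normE normr_eq0. Qed.
Lemma rnorm0 : rnorm (0 : V) = 0.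
Proof. by apply/eqP; rewrite rnorm_eq0. Qed.
Lemma rnorm_gt0 x : (0 < rnorm x) = (x != 0).
Proof. by rewrite lt0r rnorm_ge0 andbT rnorm_eq0. Qed.
Lemma rnorm_tri x y z : rnorm (x - z) <= rnorm (x - y) + rnorm (y - z).
Proof. by have := rnormD (x - y) (y - z); rewrite addrA subrK. Qed.
Lemma rnorm_lerB x y : rnorm x - rnorm y <= rnorm (x - y).
Proof. by rewrite lerBlDr; have := rnormD (x - y) y; rewrite subrK. Qed.
Lemma rnorm_sum (I : Type) (s : seq I) (P : pred I) (F : I -> V) :
  rnorm (\sum_(i <- s | P i) F i) <= \sum_(i <- s | P i) rnorm (F i).
Proof.
elim/big_rec2: _ => [|i x y _ le]; first by rewrite rnorm0.
by apply: le_trans (rnormD _ _) _; rewrite lerD2l.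
Qed.
End Norm.

Implicit Types z w : C.

Lemma rnormM z w : rnorm (z * w) = rnorm z * rnorm w.
Proof. by apply: realC_inj; rewrite realCM -!normE normrM. Qed.
Lemma rnormV z : rnorm z^-1 = (rnorm z)^-1.
Proof. by apply: realC_inj; rewrite realCV -!normE normfV. Qed.
Lemma rnormX z n : rnorm (z ^+ n) = rnorm z ^+ n.
Proof. by apply: realC_inj; rewrite realCX -!normE normrX. Qed.
Lemma rnorm1 : rnorm (1 : C) = 1.
Proof. by apply: realC_inj; rewrite -normE normr1. Qed.
Lemma rnorm_conj z : rnorm z^* = rnorm z.
Proof. by rewrite /rnorm norm_conjC. Qed.
Lemma rnorm_realC x : rnorm (realC x) = `|x|.
Proof. by rewrite /rnorm /= expr0n addr0 sqrtr_sqr. Qed.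
Lemma rnorm_sq z : rnorm z ^+ 2 = complex.Re z ^+ 2 + complex.Im z ^+ 2.
Proof. by rewrite /rnorm normc_def /= sqr_sqrtr // addr_ge0 ?sqr_ge0. Qed.
Lemma rnorm_sqE z : realC (rnorm z ^+ 2) = z * z^*.
Proof.
rewrite rnorm_sq; case: z => a b.
by apply/eqP; rewrite eq_complex /=; apply/andP; split; apply/eqP; ring.
Qed.
Lemma Re_le_rnorm z : complex.Re z <= rnorm z.
Proof.
apply: le_trans (ler_norm _) _.
rewrite -(@ler_pXn2r _ 2) ?nnegrE ?rnorm_ge0 // rnorm_sq real_normK ?num_real //.
by rewrite lerDl sqr_ge0.
Qed.
Lemma normRe_le z : `|complex.Re z| <= rnorm z.
Proof.
rewrite ler_norml Re_le_rnorm andbT lerNl; have := Re_le_rnorm (- z).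
by rewrite rnormN; case: z.
Qed.
Lemma normIm_le z : `|complex.Im z| <= rnorm z.
Proof.
have := normRe_le (z * Complex 0 1); rewrite rnormM /rnorm /= expr0n expr1n add0r sqrtr1.
by case: z => a b /=; rewrite mulr1 mulr0 sub0r normrN mulr1.
Qed.
Lemma rnorm_le_ReIm z : rnorm z <= `|complex.Re z| + `|complex.Im z|.
Proof.
rewrite -(@ler_pXn2r _ 2) ?nnegrE ?rnorm_ge0 ?addr_ge0 // rnorm_sq.
by rewrite sqrrD !real_normK ?num_real // lerD2r lerDl mulrn_wge0 // mulr_ge0.
Qed.
Lemma ReD z w : complex.Re (z + w) = complex.Re z + complex.Re w.
Proof. by case: z; case: w. Qed.
Lemma ReB z w : complex.Re (z - w) = complex.Re z - complex.Re w.
Proof. by case: z; case: w. Qed.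
Lemma ImB z w : complex.Im (z - w) = complex.Im z - complex.Im w.
Proof. by case: z; case: w. Qed.

Lemma diskE z : disk z <-> rnorm z < 1.
Proof. by rewrite /disk /= normE -realC1 realC_lt. Qed.
Lemma norm1E z : `|z| = 1 <-> rnorm z = 1.
Proof. by rewrite normE -realC1; split => [/realC_inj //|->]. Qed.

(** * Limits and complex differentiability in terms of [rnorm] *)

Lemma nbhs_rnormP (V : normedModType C) (x : V) (P : set V) :
  nbhs x P <-> exists2 e : R, 0 < e & forall y, rnorm (y - x) < e -> P y.
Proof.
split=> [/nbhs_normP[e /= e0 H]|].
   have [e1 ee] := realC_gt0P e0.
  exists (complex.Re e) => // y ye; apply: H => /=.
  by rewrite ee normE realC_lt rnorm_distC.
move=> [e e0 H]; apply/nbhs_normP; exists (realC e) => /=; first by rewrite -realC0 realC_lt.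
by move=> y /=; rewrite normE realC_lt => ye; apply: H; rewrite rnorm_distC.
Qed.

Lemma cvg_rnormP (T : Type) (F : set_system T) (FF : Filter F)
    (V : normedModType C) (f : T -> V) (l : V) :
  f x @[x --> F] --> l <->
  forall e : R, 0 < e -> \forall x \near F, rnorm (f x - l) < e.
Proof.
split=> [/cvgrPdist_lt H e e0|H].
  have e1 : 0 < realC e by rewrite -realC0 realC_lt.
  by near=> x; rewrite -realC_lt -normE distrC; near: x; exact: H.
apply/cvgrPdist_lt => e /realC_gt0P[e0 ee].
by near=> x; rewrite ee normE realC_lt rnorm_distC; near: x; exact: H.
Unshelve. all: by end_near. Qed.

Lemma continuous_rnormP (f : C -> C) z : {for z, continuous f} <->
  forall e : R, 0 < e -> exists2 d : R, 0 < d &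
    forall w, rnorm (w - z) < d -> rnorm (f w - f z) < e.
Proof.
rewrite /prop_for /continuous_at; split=> [/cvg_rnormP H e e0|H].
  exact/nbhs_rnormP/H.
by apply/(cvg_rnormP (nbhs_filter z)) => e e0; apply/nbhs_rnormP/H.
Qed.

Section ContinuousAt.
Variables (z : C) (f g : C -> C).
Lemma continuous_atD : {for z, continuous f} -> {for z, continuous g} ->
  {for z, continuous (fun w => f w + g w)}.
Proof. by move=> cf cg; exact: (cvgD cf cg). Qed.
Lemma continuous_atM : {for z, continuous f} -> {for z, continuous g} ->
  {for z, continuous (fun w => f w * g w)}.
Proof. by move=> cf cg; exact: (cvgM cf cg). Qed.
Lemma continuous_atV : f z != 0 -> {for z, continuous f} ->
  {for z, continuous (fun w => (f w)^-1)}.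
Proof. by move=> f0 cf; exact: (cvgV f0 cf). Qed.
Lemma continuous_atN : {for z, continuous f} ->
  {for z, continuous (fun w => - f w)}.
Proof. by move=> cf; exact: (cvgN cf). Qed.
Lemma continuous_at_cst (a : C) : {for z, continuous (fun=> a : C)}.
Proof. by apply: cvg_cst; exact: nbhs_filter. Qed.
Lemma continuous_at_id : {for z, continuous (fun w : C => w)}.
Proof. exact: cvg_id. Qed.
End ContinuousAt.

(* Caratheodory's form of complex differentiability: composition and quotient
   rules become algebra on the slope function [g]. *)
Definition cdiff (f : C -> C) z (l : C) := exists g : C -> C,
  [/\ \forall w \near z, f w - f z = g w * (w - z), g z = l &
      {for z, continuous g}].

(** Filling the value [l] into the difference quotient at [z] turns its punctured limit into
    continuity of the slope function. *)
Lemma derivable_cdiff (f : C -> C) z : derivable f z 1 -> exists l, cdiff f z l.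
Proof.
move=> /cvg_ex[/= l Hl].
have H := (@cvg_rnormP _ _ (dnbhs_filter (0 : C)) C
  (fun h : C => h^-1 * (f (h * 1 + z) - f z)) l).1 Hl.
exists l.
exists (fun w => if w == z then l else (f w - f z) / (w - z)); split.
- by near=> w; case: eqVneq => [->|wz]; rewrite ?subrr ?mulr0 // divfK // subr_eq0.
- by rewrite eqxx.
- apply/continuous_rnormP => e e0; rewrite eqxx.
  have /nbhs_rnormP[d d0 Hd] := H _ e0; exists d => // w wz.
  case: eqVneq => [_|nwz]; first by rewrite subrr rnorm0.
  have := Hd (w - z); rewrite subr0 => /(_ wz).
  rewrite subr_eq0 nwz => /(_ isT) /=.
  by rewrite /GRing.scale /= mulr1 subrK mulrC.
Unshelve. all: by end_near. Qed.

Lemma cdiff_continuous f z l : cdiff f z l -> {for z, continuous f}.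
Proof.
move=> [g [H _ cg]].
have c1 : {for z, continuous (fun w => f z + g w * (w - z))}.
  have c2 := continuous_atD (@continuous_at_id z) (@continuous_at_cst z (- z)).
  exact: (continuous_atD (@continuous_at_cst z (f z)) (continuous_atM cg c2)).
apply/continuous_rnormP => e; move/continuous_rnormP: c1 => /[apply] /nbhs_rnormP He.
apply/nbhs_rnormP; near=> w.
have -> : f w - f z = f z + g w * (w - z) - (f z + g z * (z - z)).
  by rewrite -(near H w) //; ring.
by near: w.
Unshelve. all: by end_near. Qed.

Lemma cdiff_cst a z : cdiff (fun=> a) z 0.
Proof.
exists (fun=> 0); split; [|by []|exact: continuous_at_cst].
by near=> w; rewrite subrr mul0r.
Unshelve. all: by end_near. Qed.

Lemma cdiff_id z : cdiff (fun w => w) z 1.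
Proof.
exists (fun=> 1); split; [|by []|exact: continuous_at_cst].
by near=> w; rewrite mul1r.
Unshelve. all: by end_near. Qed.

Lemma cdiffD f1 f2 z l1 l2 : cdiff f1 z l1 -> cdiff f2 z l2 ->
  cdiff (fun w => f1 w + f2 w) z (l1 + l2).
Proof.
move=> [g1 [H1 <- c1]] [g2 [H2 <- c2]]; exists (fun w => g1 w + g2 w); split; [|by []|].
  by near=> w; rewrite mulrDl -(near H1 w) // -(near H2 w) //; ring.
exact: (continuous_atD c1 c2).
Unshelve. all: by end_near. Qed.

Lemma cdiffM f1 f2 z l1 l2 : cdiff f1 z l1 -> cdiff f2 z l2 ->
  cdiff (fun w => f1 w * f2 w) z (l1 * f2 z + f1 z * l2).
Proof.
move=> d1 d2; have cf := cdiff_continuous d2.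
move: d1 d2 => [g1 [H1 <- c1]] [g2 [H2 <- c2]].
exists (fun w => g1 w * f2 w + f1 z * g2 w); split; [|by []|].
  near=> w; rewrite [RHS](_ : _ = g1 w * (w - z) * f2 w + f1 z * (g2 w * (w - z))).
    by rewrite -(near H1 w) // -(near H2 w) //; ring.
  by ring.
exact: (continuous_atD (continuous_atM c1 cf) (continuous_atM (@continuous_at_cst z (f1 z)) c2)).
Unshelve. all: by end_near. Qed.

Lemma cdiffN f z l : cdiff f z l -> cdiff (fun w => - f w) z (- l).
Proof.
move=> d; have := cdiffM (cdiff_cst (-1) z) d.
rewrite mul0r add0r mulN1r; congr cdiff; apply/funext => w; exact: mulN1r.
Qed.

Lemma cdiffB f1 f2 z l1 l2 : cdiff f1 z l1 -> cdiff f2 z l2 ->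
  cdiff (fun w => f1 w - f2 w) z (l1 - l2).
Proof. by move=> d1 d2; apply: cdiffD => //; exact: cdiffN. Qed.

Lemma cdiffV f z l : f z != 0 -> cdiff f z l ->
  cdiff (fun w => (f w)^-1) z (- l / f z ^+ 2).
Proof.
move=> fz0 d; have cf := cdiff_continuous d; move: d => [g [H <- cg]].
exists (fun w => - g w / (f w * f z)); split; [|by []|].
  have fn0 : \forall w \near z, f w != 0.
    have /continuous_rnormP/(_ (rnorm (f z))) := cf.
    rewrite rnorm_gt0 => /(_ fz0)/nbhs_rnormP He; near=> w.
    apply/eqP => fw0; have : rnorm (f w - f z) < rnorm (f z) by exact: (near He w).
    by rewrite fw0 sub0r rnormN ltxx.
  near=> w; have w0 : f w != 0 by near: w.
  rewrite mulrAC mulNr -(near H w) //.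
  by field; rewrite w0 fz0.
apply: (continuous_atM (continuous_atN cg)).
have cfz := continuous_atM cf (@continuous_at_cst z (f z)).
by apply: (continuous_atV _ cfz); rewrite mulf_neq0.
Unshelve. all: by end_near. Qed.

Lemma cdiff_comp f h z l m : cdiff h z l -> cdiff f (h z) m ->
  cdiff (fun w => f (h w)) z (m * l).
Proof.
move=> d1; have ch := cdiff_continuous d1.
move: d1 => [g1 [H1 <- c1]] [g2 [H2 <- c2]].
exists (fun w => g2 (h w) * g1 w); split; [|by []|].
  have H2' : \forall w \near z, f (h w) - f (h z) = g2 (h w) * (h w - h z).
    exact: (ch _ H2).
  by near=> w; rewrite (near H2' w) // (near H1 w) // mulrA.
exact: (continuous_atM (continuous_comp ch c2) c1).
Unshelve. all: by end_near. Qed.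

Lemma cdiff_affine f z l : cdiff f z l -> forall e : R, 0 < e ->
  exists2 d : R, 0 < d & forall w, rnorm (w - z) < d ->
    rnorm (f w - (f z + l * (w - z))) <= e * rnorm (w - z).
Proof.
move=> [g [H <- /continuous_rnormP cg]] e /cg/nbhs_rnormP He.
have /nbhs_rnormP[d d0 Hd] : \forall w \near z,
    rnorm (f w - (f z + g z * (w - z))) <= e * rnorm (w - z).
  near=> w; rewrite opprD addrA (near H w) // -mulrBl rnormM ler_wpM2r ?rnorm_ge0 //.
  by apply: ltW; near: w.
by exists d.
Unshelve. all: by end_near. Qed.

End ComplexPlane.

(** * Goursat's theorem *)

Section Goursat.
Variable R : realType.
Local Notation C := (cplx R).
Implicit Types (f : C -> C) (z w a b : C).

(* The trapezoid rule for the integral of [f] over [z, w], on 2 ^ n equal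
   pieces. *)
Fixpoint seg n f z w : C :=
  if n is m.+1 then seg m f z ((z + w) / 2) + seg m f ((z + w) / 2) w
  else (f z + f w) / 2 * (w - z).

Definition circ n f z a b : C :=
  seg n f z (z + a) + seg n f (z + a) (z + a + b)
  + seg n f (z + a + b) (z + b) + seg n f (z + b) z.

Lemma seg_rev n f z w : seg n f w z = - seg n f z w.
Proof.
elim: n z w => [|n IH] z w /=; first by ring.
by rewrite [w + z]addrC (IH _ w) (IH z); ring.
Qed.

Lemma seg_shift n f p z w : (forall z, f (z + p) = f z) ->
  seg n f (z + p) (w + p) = seg n f z w.
Proof.
move=> fp; elim: n z w => [|n IH] z w /=.
  by rewrite !fp; congr (_ * _); ring.
have -> : (z + p + (w + p)) / 2 = (z + w) / 2 + p by field.
by rewrite !IH.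
Qed.

Lemma seg_sub n f g z w :
  seg n (fun x => f x - g x) z w = seg n f z w - seg n g z w.
Proof.
elim: n z w => [|n IH] z w /=; first by ring.
by rewrite !IH; ring.
Qed.

(** The trapezoid rule is exact on affine functions, so at every level the result is a difference of
    values of a primitive; around a closed path it cancels exactly. *)
Lemma seg_affine n a b z w : seg n (fun x => a + b * x) z w =
  a * (w - z) + b * (w ^+ 2 - z ^+ 2) / 2.
Proof.
elim: n z w => [|n IH] z w /=; first by field.
by rewrite !IH; field.
Qed.

Lemma seg_le n f z w (M : R) :
  (forall t : R, 0 <= t <= 1 -> rnorm (f (z + realC t * (w - z))) <= M) ->
  rnorm (seg n f z w) <= M * rnorm (w - z).
Proof.
elim: n z w => [|n IH] z w H /=.
  rewrite !rnormM ler_wpM2r ?rnorm_ge0 // rnormV.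
  have -> : (2 : C) = realC 2 by rewrite -[2]/(1 + 1) realCD.
  rewrite rnorm_realC ger0_norm // ler_pdivrMr //.
  apply: le_trans (rnormD _ _) _.
  have := H 0; rewrite realC0 mul0r addr0 lexx ler01 => /(_ isT).
  have := H 1; rewrite realC1 mul1r addrC subrK lexx ler01 => /(_ isT).
  by lra.
have h2 : realC 2^-1 = 2^-1 :> C by rewrite realCV -[2]/(1 + 1) realCD.
have e1 : (z + w) / 2 - z = realC 2^-1 * (w - z) by rewrite h2; field.
have e2 : w - (z + w) / 2 = realC 2^-1 * (w - z) by rewrite h2; field.
have -> : M * rnorm (w - z) =
    M * rnorm ((z + w) / 2 - z) + M * rnorm (w - (z + w) / 2).
  by rewrite e1 e2 !rnormM rnorm_realC ger0_norm ?invr_ge0 //; field.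
apply: le_trans (rnormD _ _) _; apply: lerD; apply: IH => t t01.
  rewrite e1 mulrA -realCM; apply: H; lra.
have -> : (z + w) / 2 + realC t * (w - (z + w) / 2) =
    z + realC ((t + 1) / 2) * (w - z).
  by rewrite e2 realCM realCD realC1 h2; field.
by apply: H; lra.
Qed.

Lemma circ_affine n c d z a b : circ n (fun x => c + d * x) z a b = 0.
Proof. by rewrite /circ !seg_affine; field. Qed.

Lemma circ_sub n f g z a b :
  circ n (fun x => f x - g x) z a b = circ n f z a b - circ n g z a b.
Proof. by rewrite /circ !seg_sub; ring. Qed.

(** Each inner side is traversed twice in opposite directions, and level [n.+1] on an outer side is
    level [n] on its two halves. The identity is exact, so subdivision costs no error. *)
Lemma circ_quarters n f z a b : circ n.+1 f z a b =
  circ n f z (a / 2) (b / 2) + circ n f (z + a / 2) (a / 2) (b / 2)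
  + circ n f (z + b / 2) (a / 2) (b / 2)
  + circ n f (z + a / 2 + b / 2) (a / 2) (b / 2).
Proof.
rewrite /circ /=.
have -> : (z + (z + a)) / 2 = z + a / 2 by field.
have -> : (z + a + (z + a + b)) / 2 = z + a + b / 2 by field.
have -> : (z + a + b + (z + b)) / 2 = z + b + a / 2 by field.
have -> : (z + b + z) / 2 = z + b / 2 by field.
have -> : z + a / 2 + a / 2 = z + a by field.
have -> : z + b / 2 + a / 2 = z + a / 2 + b / 2 by ring.
have -> : z + b / 2 + b / 2 = z + b by field.
have -> : z + a / 2 + b / 2 + b / 2 = z + b + a / 2 by field.
have -> : z + a / 2 + b / 2 + a / 2 = z + a + b / 2 by field.
have -> : z + a + b / 2 + b / 2 = z + a + b by field.
rewrite (seg_rev n f (z + a / 2) (z + a / 2 + b / 2)).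
rewrite (seg_rev n f (z + a / 2 + b / 2) (z + b / 2)).
rewrite (seg_rev n f (z + a / 2 + b / 2) (z + a + b / 2)).
rewrite (seg_rev n f (z + a / 2 + b / 2) (z + b + a / 2)).
by ring.
Qed.

(* Every point of the boundary of the parallelogram is within [|a| + |b|] of any
   point of it. *)
Lemma circ_le n f z a b q (M e : R) : 0 <= e -> rnorm a + rnorm b <= M ->
  (exists s t : R, [/\ 0 <= s <= 1, 0 <= t <= 1 & q = z + realC s * a + realC t * b]) ->
  (forall x, rnorm (x - q) <= M -> rnorm (f x) <= e) ->
  rnorm (circ n f z a b) <= 2 * e * M.
Proof.
move=> e0 abM [s [t [s01 t01 qE]]] H.
have near_q (u v : R) : 0 <= u <= 1 -> 0 <= v <= 1 ->
    rnorm (f (z + realC u * a + realC v * b)) <= e.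
  move=> u01 v01; apply: H.
  have -> : z + realC u * a + realC v * b - q = realC (u - s) * a + realC (v - t) * b.
    by rewrite qE !realCB; ring.
  apply: le_trans (rnormD _ _) _; rewrite !rnormM !rnorm_realC.
  have : `|u - s| <= 1 by rewrite ler_norml; lra.
  have : `|v - t| <= 1 by rewrite ler_norml; lra.
  move=> /(ler_wpM2r (rnorm_ge0 b)) + /(ler_wpM2r (rnorm_ge0 a)); lra.
have S1 : rnorm (seg n f z (z + a)) <= e * rnorm a.
  have -> : a = z + a - z by ring.
  rewrite [z + (_ - _)]addrC subrK; apply: seg_le => u u01.
  have := near_q u 0 u01; rewrite realC0 mul0r addr0.
  by rewrite [z + a - z]addrAC subrr add0r; apply; rewrite lexx ler01.
have S2 : rnorm (seg n f (z + a) (z + a + b)) <= e * rnorm b.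
  have e1 : z + a + b - (z + a) = b by ring.
  rewrite -[rnorm b]/(rnorm b) -{2}e1; apply: seg_le => u u01; rewrite e1.
  have := near_q 1 u; rewrite realC1 mul1r; apply=> //; by rewrite lexx ler01.
have S3 : rnorm (seg n f (z + a + b) (z + b)) <= e * rnorm a.
  rewrite seg_rev rnormN; have e1 : z + a + b - (z + b) = a by ring.
  rewrite -{2}e1; apply: seg_le => u u01; rewrite e1 addrAC.
  have := near_q u 1 u01; rewrite realC1 mul1r; apply=> //; by rewrite lexx ler01.
have S4 : rnorm (seg n f (z + b) z) <= e * rnorm b.
  rewrite seg_rev rnormN; have e1 : z + b - z = b by ring.
  rewrite -{2}e1; apply: seg_le => u u01; rewrite e1.
  have := near_q 0 u; rewrite realC0 mul0r addr0; apply=> //; by rewrite lexx ler01.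
have := rnormD (seg n f z (z + a)) (seg n f (z + a) (z + a + b)).
have := rnormD (seg n f z (z + a) + seg n f (z + a) (z + a + b)) (seg n f (z + a + b) (z + b)).
have := rnormD (seg n f z (z + a) + seg n f (z + a) (z + a + b) + seg n f (z + a + b) (z + b)) (seg n f (z + b) z).
have : e * (rnorm a + rnorm b) <= e * M by apply: ler_wpM2l.
rewrite /circ; lra.
Qed.

(** Bisection with discrete sums. The bound is claimed only for large [n], because level [n] on the
    whole is level [n - k] on the pieces of the k-th subdivision. If it failed, nested bad pieces
    would shrink to a point where differentiability contradicts badness. *)
Theorem goursat f z a b :
  (forall s t : R, 0 <= s <= 1 -> 0 <= t <= 1 ->
     exists l, cdiff f (z + realC s * a + realC t * b) l) ->
  forall eta : R, 0 < eta -> exists n0, forall n, (n0 <= n)%N ->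
    rnorm (circ n f z a b) <= eta.
Proof.
move=> fd eta eta0.
pose Z (p : R * R) := z + realC p.1 * a + realC p.2 * b.
(* The share of [eta] given to a piece is proportional to its area. *)
pose good k p := exists n0, forall n, (n0 <= n)%N ->
  rnorm (circ n f (Z p) (realC (2^-1 ^+ k) * a) (realC (2^-1 ^+ k) * b))
    <= eta * (4^-1) ^+ k.
suff : good 0%N (0, 0).
  by rewrite /good /Z /= !expr0 realC0 realC1 !mul1r !mul0r !addr0 mulr1.
pose quarter k (p q : R * R) :=
  (q.1 = p.1 \/ q.1 = p.1 + 2^-1 ^+ k.+1) /\ (q.2 = p.2 \/ q.2 = p.2 + 2^-1 ^+ k.+1).
have good_quarters k p : (forall q, quarter k p q -> good k.+1 q) -> good k p.
  move=> H; pose h := 2^-1 ^+ k.+1 : R.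
  have [n1 H1] : good k.+1 (p.1, p.2) by apply: H; split; left.
  have [n2 H2] : good k.+1 (p.1 + h, p.2) by apply: H; split; [right|left].
  have [n3 H3] : good k.+1 (p.1, p.2 + h) by apply: H; split; [left|right].
  have [n4 H4] : good k.+1 (p.1 + h, p.2 + h) by apply: H; split; right.
  (* Passing to the quarters uses up one level, hence the successor. *)
  exists (n1 + n2 + n3 + n4).+1 => -[//|n]; rewrite ltnS => nn.
  have {}H1 := H1 n (leq_trans _ nn); have {}H2 := H2 n (leq_trans _ nn).
  have {}H3 := H3 n (leq_trans _ nn); have {}H4 := H4 n (leq_trans _ nn).
  rewrite circ_quarters.
  have hc (x : C) : realC (2^-1 ^+ k) * x / 2 = realC h * x.
    by rewrite /h exprSr realCM realCV -[2 in RHS]/(1 + 1) realCD realC1; ring.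
  rewrite !hc.
  have e2 : Z p + realC h * a = Z (p.1 + h, p.2) by rewrite /Z /= realCD; ring.
  have e3 : Z p + realC h * b = Z (p.1, p.2 + h) by rewrite /Z /= realCD; ring.
  have e4 : Z p + realC h * a + realC h * b = Z (p.1 + h, p.2 + h).
    by rewrite /Z /= !realCD; ring.
  rewrite e4 e2 e3; have -> : Z p = Z (p.1, p.2) by [].
  do 3 (apply: le_trans (rnormD _ _) _; rewrite -lerBrDr).
  have -> : eta * 4^-1 ^+ k = eta * 4^-1 ^+ k.+1 * 4 by rewrite exprSr; field.
  move: H1 H2 H3 H4; rewrite -/h => H1 H2 H3 H4.
  have := H1 _; have := H2 _; have := H3 _; have := H4 _.
  have l1 : (n1 <= n1 + n2 + n3 + n4)%N by rewrite -!addnA leq_addr.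
  have l2 : (n2 <= n1 + n2 + n3 + n4)%N by rewrite [(n1 + _)%N]addnC -!addnA leq_addr.
  have l3 : (n3 <= n1 + n2 + n3 + n4)%N by rewrite addnAC leq_addl.
  have l4 : (n4 <= n1 + n2 + n3 + n4)%N by rewrite leq_addl.
  move=> /(_ l4) + /(_ l3) + /(_ l2) + /(_ l1); lra.
(* Every bad piece has a bad quarter; the choice function [nxt] is total, with an arbitrary value on
   good pieces. *)
apply: contrapT => bad0.
have next_ex (kp : nat * (R * R)) : exists q,
    ~ good kp.1 kp.2 -> quarter kp.1 kp.2 q /\ ~ good kp.1.+1 q.
  apply: contrapT => /forallNP nq.
  case: (pselect (good kp.1 kp.2)) => [g|ng]; first by apply: (nq (0, 0)).
  apply: ng; apply: good_quarters => q qq; apply: contrapT => bq.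
  by apply: (nq q).
have [nxt Hn] := choice next_ex.
pose P := fix P k := if k is k'.+1 then nxt (k', P k') else (0, 0).
have Pbad k : ~ good k (P k).
  by elim: k => [//|k IH]; have [] := Hn (k, P k) IH.
have Pq k : quarter k (P k) (P k.+1) by have [] := Hn (k, P k) (Pbad k).
(* The lower ends increase and the upper ends decrease, so the supremum of the lower ends lies in
   every dyadic interval. This is applied to each coordinate. *)
have limit (x : nat -> R) : x 0%N = 0 ->
    (forall k, x k.+1 = x k \/ x k.+1 = x k + 2^-1 ^+ k.+1) ->
    exists2 s, 0 <= s <= 1 & forall k, x k <= s <= x k + 2^-1 ^+ k.
  move=> x0 xS.
  have pos k : 0 < 2^-1 ^+ k :> R by rewrite exprn_gt0 // invr_gt0.
  have xm k m : x k <= x (k + m)%N /\ x (k + m)%N + 2^-1 ^+ (k + m) <= x k + 2^-1 ^+ k.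
    elim: m => [|m [IH1 IH2]]; first by rewrite addn0.
    rewrite addnS; have p1 := pos (k + m).+1.
    have e : 2^-1 ^+ (k + m) = 2 * 2^-1 ^+ (k + m).+1 :> R by rewrite exprS; field.
    by case: (xS (k + m)%N) => ->; move: IH1 IH2; rewrite e; lra.
  have ub k m : x m <= x k + 2^-1 ^+ k.
    have [km|/ltnW mk] := leqP k m.
      by have [] := xm k (m - k)%N; rewrite subnKC // => _; have := pos m; lra.
    by have [+ _] := xm m (k - m)%N; rewrite subnKC //; have := pos k; lra.
  have hs : has_sup (range x).
    split; first by exists (x 0%N), 0%N.
    by exists (x 0%N + 2^-1 ^+ 0) => _ [m _ <-].
  have bnd k : x k <= sup (range x) <= x k + 2^-1 ^+ k.
    apply/andP; split; first by apply: ub_le_sup; [exact: hs.2|exists k].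
    by apply: ge_sup; [exact: hs.1|move=> _ [m _ <-]].
  by exists (sup (range x)) => //; have := bnd 0%N; rewrite x0 expr0 add0r.
have [s s01 Hs] := limit (fun k => (P k).1) erefl (fun k => (Pq k).1).
have [t t01 Ht] := limit (fun k => (P k).2) erefl (fun k => (Pq k).2).
pose q := z + realC s * a + realC t * b.
pose M := rnorm a + rnorm b + 1.
have M0 : 0 < M by rewrite ltr_wpDl // addr_ge0 ?rnorm_ge0.
have [l dl] := fd s t s01 t01.
(* For sides scaled by [h = 2^-1 ^+ k], [circ_le] gives [2 * (e * (h * M)) * (h * M)]; for this [e]
   that is exactly [eta * h ^+ 2]. *)
have e0 : 0 < eta / (2 * M ^+ 2) by rewrite divr_gt0 // mulr_gt0 // exprn_gt0.
have [d d0 Hd] := cdiff_affine dl e0.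
have [k Hk] : exists k, 2^-1 ^+ k * M < d.
  have := @cvg_expr R 2^-1.
  rewrite ger0_norm ?invr_ge0 // invf_lt1 ?ltr1n // => /(_ isT) /cvgrPdist_lt.
  move=> /(_ (d / M) (divr_gt0 d0 M0))[k _ /(_ k (leqnn k))].
  rewrite sub0r normrN ger0_norm ?exprn_ge0 ?invr_ge0 // => lt.
  by exists k; rewrite -ltr_pdivlMr.
apply: (Pbad k); exists 0%N => n _.
(* The affine approximation at the common point [q] contributes nothing around the piece, so only
   the remainder counts, and at every level. *)
pose g x := f q - l * q + l * x.
have -> : circ n f (Z (P k)) (realC (2^-1 ^+ k) * a) (realC (2^-1 ^+ k) * b) =
    circ n (fun x => f x - g x) (Z (P k)) (realC (2^-1 ^+ k) * a) (realC (2^-1 ^+ k) * b).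
  by rewrite circ_sub circ_affine subr0.
have p0 : 0 < 2^-1 ^+ k :> R by rewrite exprn_gt0 // invr_gt0.
have -> : eta * 4^-1 ^+ k =
    2 * (eta / (2 * M ^+ 2) * (2^-1 ^+ k * M)) * (2^-1 ^+ k * M).
  have -> : 4^-1 = 2^-1 * 2^-1 :> R by field.
  by rewrite exprMn; field; rewrite gt_eqF.
apply: (@circ_le _ _ _ _ _ q).
- by apply: mulr_ge0; [exact: ltW|apply: mulr_ge0; exact: ltW].
- rewrite !rnormM !rnorm_realC (ger0_norm (ltW p0)) -mulrDr ler_wpM2l ?(ltW p0) //.
  by rewrite lerDl.
- exists ((s - (P k).1) / 2^-1 ^+ k), ((t - (P k).2) / 2^-1 ^+ k); split.
  + have /andP[s1 s2] := Hs k.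
    by rewrite ler_pdivrMr // divr_ge0 ?subr_ge0 ?mul1r ?lerBlDl // ltW.
  + have /andP[s1 s2] := Ht k.
    by rewrite ler_pdivrMr // divr_ge0 ?subr_ge0 ?mul1r ?lerBlDl // ltW.
  + rewrite !mulrA -!realCM !divfK ?gt_eqF // /q /Z !realCB; ring.
- move=> x xq; have -> : f x - g x = f x - (f q + l * (x - q)) by rewrite /g; ring.
  apply: le_trans (Hd _ (le_lt_trans xq Hk)) _.
  by rewrite ler_wpM2l // ltW.
Qed.

End Goursat.

(** * The Schwarz-Pick inequality *)

Section SchwarzPick.
Variable R : realType.
Local Notation C := (cplx R).
Implicit Types (f : C -> C) (z w a b : C).

Lemma cdiff_of_affine f z (l : C) :
  (forall e : R, 0 < e -> exists2 d : R, 0 < d & forall w, rnorm (w - z) < d ->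
    rnorm (f w - (f z + l * (w - z))) <= e * rnorm (w - z)) ->
  cdiff f z l.
Proof.
move=> H; exists (fun w => if w == z then l else (f w - f z) / (w - z)); split.
- by near=> w; case: eqVneq => [->|wz]; rewrite ?subrr ?mulr0 // divfK // subr_eq0.
- by rewrite eqxx.
- apply/continuous_rnormP => e e0; rewrite eqxx.
  have [d d0 Hd] := H _ (divr_gt0 e0 (ltr0n R 2)); exists d => // w wz.
  case: eqVneq => [_|nwz]; first by rewrite subrr rnorm0.
  have zw : w - z != 0 by rewrite subr_eq0.
  have -> : (f w - f z) / (w - z) - l = (f w - (f z + l * (w - z))) / (w - z).
    by field.
  rewrite rnormM rnormV ltr_pdivrMr ?rnorm_gt0 //.
  apply: le_lt_trans (Hd _ wz) _; rewrite ltr_pM2r ?rnorm_gt0 //.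
  by rewrite ltr_pdivrMr // ltr_pMr // ltr1n.
Unshelve. all: by end_near. Qed.

Lemma is_derive_affineP (f : R -> R) (x l : R) : is_derive x 1 f l <->
  forall e, 0 < e -> exists2 d, 0 < d & forall h, `|h| < d ->
    `|f (x + h) - f x - l * h| <= e * `|h|.
Proof.
split=> [[/cvg_ex[/= l' cl] dl] e e0|H].
  have ll : l' = l by rewrite -dl; apply/esym/cvg_lim.
  move: cl; rewrite ll => /cvgrPdist_le /(_ e e0) /nbhs_normP[d /= d0 Hd].
  exists d => // h hd; have [->|h0] := eqVneq h 0.
    by rewrite addr0 subrr mulr0 subrr normr0 mulr0.
  have := Hd h; rewrite /= sub0r normrN => /(_ hd h0).
  rewrite /GRing.scale /= mulr1 [h + x]addrC => le1.
  have -> : f (x + h) - f x - l * h = - (l - h^-1 * (f (x + h) - f x)) * h by field.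
  by rewrite normrM normrN ler_wpM2r.
have cl : h^-1 *: ((f \o shift x) (h *: 1) - f x) @[h --> 0^'] --> l.
  apply/cvgrPdist_le => e e0; have [d d0 Hd] := H e e0.
  apply/nbhs_normP; exists d => //= h; rewrite /= sub0r normrN => hd h0.
  rewrite /GRing.scale /= mulr1 [h + x]addrC.
  have -> : l - h^-1 * (f (x + h) - f x) = - (f (x + h) - f x - l * h) / h by field.
  by rewrite normrM normrN normfV ler_pdivrMr ?normr_gt0 // Hd.
by split; [apply/cvg_ex; exists l|exact: cvg_lim].
Qed.

(** * The complex exponential and the limit at a punctured centre *)

Definition cexp (s : C) : C := realC (expR (complex.Re s)) * expi (complex.Im s).

Lemma cexpD z w : cexp (z + w) = cexp z * cexp w.
Proof.
case: z => x y; case: w => u v; rewrite /cexp /expi /= expRD cosD sinD.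
by apply/eqP; rewrite eq_complex /=; apply/andP; split; apply/eqP; ring.
Qed.

Lemma rnorm_expi (t : R) : rnorm (expi t) = 1.
Proof. by rewrite /rnorm /= cos2Dsin2 sqrtr1. Qed.

Lemma rnorm_cexp z : rnorm (cexp z) = expR (complex.Re z).
Proof. by rewrite rnormM rnorm_expi mulr1 rnorm_realC ger0_norm ?expR_ge0. Qed.

Lemma cexp_cdiff0 : cdiff cexp 0 1.
Proof.
have cexp0 : cexp 0 = 1.
  by rewrite /cexp /= expR0 realC1 mul1r /expi cos0 sin0.
apply: cdiff_of_affine => e e0; rewrite cexp0.
(* The terms below add up to nine multiples of [e' * rnorm w], so a sixteenth of [e] suffices;
   [e' <= 1] keeps the exponential below 3. *)
have [e' [e'0 ee e1]] : exists e', [/\ 0 < e', e' <= e / 16 & e' <= 1].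
  exists (Num.min (e / 16) 1).
  by rewrite lt_min ltr01 divr_gt0 // !ge_min !lexx orbT.
have [d1 d10 H1] := (is_derive_affineP _ _ _).1 (is_derive_expR 0) _ e'0.
have [d2 d20 H2] := (is_derive_affineP _ _ _).1 (is_derive_sin 0) _ e'0.
have [d3 d30 H3] := (is_derive_affineP _ _ _).1 (is_derive_cos 0) _ e'0.
exists (Num.min (Num.min e' d1) (Num.min d2 d3)); first by rewrite !lt_min e'0 d10 d20 d30.
move=> w; rewrite subr0 !lt_min => /andP[/andP[we w1] /andP[w2 w3]].
have := H1 (complex.Re w) (le_lt_trans (normRe_le w) w1).
have := H2 (complex.Im w) (le_lt_trans (normIm_le w) w2).
have := H3 (complex.Im w) (le_lt_trans (normIm_le w) w3).
rewrite !(add0r, expR0, sin0, cos0, oppr0, mul0r, subr0, addr0, mul1r).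
have := normRe_le w; have := normIm_le w; have nw0 := rnorm_ge0 w.
(* Regrouped so that each summand is a first-order remainder, possibly times a bounded factor, or a
   product of two factors that are both O([rnorm w]). *)
have -> : cexp w - (1 + w) = Complex
   ((expR (complex.Re w) - 1 - complex.Re w) + expR (complex.Re w) * (cos (complex.Im w) - 1))
   (expR (complex.Re w) * (sin (complex.Im w) - complex.Im w)
     + (expR (complex.Re w) - 1) * complex.Im w).
  case: (w) => x y; rewrite /cexp /=.
  by apply/eqP; rewrite eq_complex /=; apply/andP; split; apply/eqP; ring.
move: (rnorm w) (complex.Re w) (complex.Im w) we nw0 => N x y Ne N0 yN xN Hc Hs He.
have xN' : e' * `|x| <= e' * N by rewrite ler_wpM2l // ltW.
have yN' : e' * `|y| <= e' * N by rewrite ler_wpM2l // ltW.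
have Ee : `|expR x - 1| <= 2 * N.
  have := ler_normD (expR x - 1 - x) x; rewrite subrK.
  have : e' * N <= 1 * N by rewrite ler_wpM2r.
  lra.
have E3 : `|expR x| <= 3.
  have := ler_normD (expR x - 1) 1; rewrite subrK normr1; lra.
apply: le_trans (rnorm_le_ReIm _) _ => /=.
have P1 : `|expR x * (cos y - 1)| <= 3 * (e' * N).
  by rewrite normrM ler_pM // (le_trans Hc).
have P2 : `|expR x * (sin y - y)| <= 3 * (e' * N).
  by rewrite normrM ler_pM // (le_trans Hs).
have P3 : `|(expR x - 1) * y| <= 2 * e' * N.
  rewrite normrM; apply: (@le_trans _ _ (2 * N * e')); last lra.
  by apply: ler_pM => //; lra.
have := ler_normD (expR x - 1 - x) (expR x * (cos y - 1)).
have := ler_normD (expR x * (sin y - y)) ((expR x - 1) * y).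
have : e' * N <= e / 16 * N by rewrite ler_wpM2r.
have : 0 <= e * N by rewrite mulr_ge0 // ltW.
lra.
Qed.

Lemma cexp_cdiff z : cdiff cexp z (cexp z).
Proof.
have d1 : cdiff (fun w => w - z) z 1.
  by rewrite -[1]subr0; apply: cdiffB; [exact: cdiff_id|exact: cdiff_cst].
have d2 : cdiff (fun w => cexp (w - z)) z (1 * 1).
  by apply: (cdiff_comp d1); rewrite subrr; exact: cexp_cdiff0.
have := cdiffM (cdiff_cst (cexp z) z) d2.
rewrite mul0r add0r !mulr1; congr cdiff; apply/funext => w.
by rewrite -cexpD addrC subrK.
Qed.

(* In logarithmic coordinates the circles of radius [r' < r] are the vertical
   sides of a rectangle whose horizontal sides cancel by periodicity. *)
Lemma center_limit_le f (L : C) (M r : R) : 0 < r -> r < 1 ->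
  (forall z, 0 < rnorm z -> rnorm z < 1 -> exists l, cdiff f z l) ->
  (forall e : R, 0 < e -> exists2 d : R, 0 < d &
     forall z, 0 < rnorm z -> rnorm z < d -> rnorm (f z - L) <= e) ->
  (forall z, rnorm z = r -> rnorm (f z) <= M) ->
  rnorm L <= M.
Proof.
move=> r0 r1 fd fL fM; apply/ler_addgt0Pr => e e0.
have e20 : 0 < e / 2 by rewrite divr_gt0.
have [d d0 Hd] := fL _ e20.
(* The inner circle lies where [f] is within [e / 2] of [L], so its side contributes [L * b] up to a
   small error. *)
pose r' := Num.min d r / 2.
have r'0 : 0 < r' by rewrite divr_gt0 // lt_min d0.
have r'd : r' < d.
  by rewrite ltr_pdivrMr // (@le_lt_trans _ _ d) ?ge_min ?lexx // ltr_pMr // ltr1n.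
have r'r : r' < r.
  by rewrite ltr_pdivrMr // (@le_lt_trans _ _ r) ?ge_min ?lexx ?orbT // ltr_pMr // ltr1n.
pose F s := f (cexp s).
pose Z := realC (ln r') : C; pose a := realC (ln r - ln r') : C.
pose b := Complex 0 (pi *+ 2) : C.
have Fb s : F (s + b) = F s.
  rewrite /F; congr f; case: s => x y; rewrite /cexp /= addr0; congr (_ * _).
  by rewrite /expi cosD2pi sinD2pi.
have lnr : ln r' < ln r by rewrite ltr_ln ?posrE.
have lnr0 : ln r < 0 by rewrite ln_lt0 // r0.
have Fd (s t : R) : 0 <= s <= 1 -> 0 <= t <= 1 ->
    exists l, cdiff F (Z + realC s * a + realC t * b) l.
  move=> /andP[s0 s1] _; set p := Z + _ + _.
  have [] := fd (cexp p).
  - by rewrite rnorm_cexp expR_gt0.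
  - rewrite rnorm_cexp expR_lt1 /p /= !(mulr0, mul0r, subr0, addr0).
    have : s * (ln r - ln r') <= 1 * (ln r - ln r') by rewrite ler_wpM2r // subr_ge0 ltW.
    lra.
  - by move=> l dl; exists (l * cexp p); exact: (cdiff_comp (cexp_cdiff p) dl).
have [n0 /(_ n0 (leqnn _)) Hn] := goursat Fd e20.
have nb : rnorm b = pi *+ 2.
  by rewrite /rnorm /= expr0n add0r sqrtr_sqr ger0_norm // mulrn_wge0 // pi_ge0.
have S1 : rnorm (seg n0 F (Z + a) (Z + a + b)) <= M * (pi *+ 2).
  have e1 : Z + a + b - (Z + a) = b by ring.
  rewrite -nb -{2}e1; apply: seg_le => t t01; rewrite e1; apply: fM.
  rewrite rnorm_cexp /= !(mulr0, mul0r, subr0, addr0).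
  by rewrite addrC subrK lnK ?posrE.
have S2 : rnorm (seg n0 F Z (Z + b) - L * b) <= e / 2 * (pi *+ 2).
  have e1 : Z + b - Z = b by ring.
  have -> : L * b = seg n0 (fun x => L + 0 * x) Z (Z + b) by rewrite seg_affine e1; ring.
  rewrite -seg_sub -nb -{2}e1; apply: seg_le => t t01; rewrite e1 mul0r addr0.
  by apply: Hd; rewrite rnorm_cexp /= !(mulr0, mul0r, subr0, addr0) lnK ?posrE.
have cE : circ n0 F Z a b = seg n0 F (Z + a) (Z + a + b) - seg n0 F Z (Z + b).
  rewrite /circ (seg_shift n0 (Z + a) Z Fb) (seg_rev n0 F Z (Z + a)).
  by rewrite (seg_rev n0 F Z (Z + b)); ring.
have : rnorm (L * b) <= M * (pi *+ 2) + e / 2 * (pi *+ 2) + e / 2.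
  have -> : L * b = seg n0 F (Z + a) (Z + a + b) - (seg n0 F Z (Z + b) - L * b)
     - circ n0 F Z a b by rewrite cE; ring.
  apply: le_trans (rnormB _ _) _; apply: lerD => //.
  by apply: le_trans (rnormB _ _) _; exact: lerD.
(* The extra [e / 2] left by [goursat] is absorbed when dividing by the length [pi *+ 2]. *)
rewrite rnormM nb; have : 2 <= pi :> R by exact: pi_ge2.
move=> p2 H; have p0 : 0 < pi *+ 2 :> R by rewrite pmulrn_lgt0 // pi_gt0.
rewrite -(ler_pM2r p0); apply: le_trans H _.
have : e / 2 * 2 <= e / 2 * pi by rewrite ler_wpM2l // ltW.
rewrite [pi *+ 2]mulr2n => ?; lra.
Qed.

(** The quotient [f z / z] tends to [l] at 0 and is at most [r^-1] on the circle of radius [r];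
    [center_limit_le] bounds the limit without extending the quotient to 0. *)
Lemma schwarz_derivative f (l : C) :
  (forall z, rnorm z < 1 -> exists l, cdiff f z l) ->
  (forall z, rnorm z < 1 -> rnorm (f z) < 1) ->
  f 0 = 0 -> cdiff f 0 l -> rnorm l <= 1.
Proof.
move=> fd f1 f0 dl; apply: contrapT => /negP; rewrite -ltNge => l1.
(* For [rnorm l > 1] this radius is below 1, and [r^-1] is the mean of 1 and [rnorm l], which is
   smaller than [rnorm l]. *)
pose r := 2 / (1 + rnorm l).
have r0 : 0 < r by rewrite divr_gt0 //; lra.
have r1 : r < 1 by rewrite ltr_pdivrMr; lra.
have : rnorm l <= r^-1.
  apply: (@center_limit_le (fun z => f z / z) _ _ r) => //.
  - move=> z z0 z1; have [m dm] := fd z z1.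
    have nz : z != 0 by rewrite -rnorm_gt0.
    by have := cdiffM dm (cdiffV nz (cdiff_id z)) => dd; eexists; exact: dd.
  - move=> e e0; have [d d0 Hd] := cdiff_affine dl e0; exists d => // z z0 zd.
    have nz : z != 0 by rewrite -rnorm_gt0.
    have := Hd z; rewrite subr0 f0 add0r => /(_ zd) H.
    have -> : f z / z - l = (f z - l * z) / z by field.
    by rewrite rnormM rnormV ler_pdivrMr.
  - move=> z zr; rewrite rnormM rnormV zr -[leRHS]mul1r ler_wpM2r ?invr_ge0 ?(ltW r0) //.
    by apply/ltW/f1; rewrite zr.
rewrite /r invf_div ler_pdivlMr //; lra.
Qed.

(** In the disk both summands are nonnegative, so each bounds the left side from below: the first
    controls distances of images, the second compares with products of the quantities
    [1 - rnorm z ^+ 2]. *)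
Lemma rnorm_1subconj z w : rnorm (1 - w^* * z) ^+ 2 =
  rnorm (z - w) ^+ 2 + (1 - rnorm z ^+ 2) * (1 - rnorm w ^+ 2).
Proof. by rewrite !rnorm_sq; case: z => x y; case: w => u v /=; ring. Qed.

Lemma one_sub_sqr_gt0 z : rnorm z < 1 -> 0 < 1 - rnorm z ^+ 2.
Proof. by move=> z1; rewrite subr_gt0 expr_lt1 // rnorm_ge0. Qed.

Lemma one_sub_conj_neq0 z w : rnorm z < 1 -> rnorm w < 1 -> 1 - w^* * z != 0.
Proof.
move=> z1 w1; rewrite -rnorm_gt0 -(@ltr_pXn2r _ 2) ?nnegrE ?rnorm_ge0 //.
by rewrite expr0n rnorm_1subconj ltr_wpDl ?sqr_ge0 // mulr_gt0 // one_sub_sqr_gt0.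
Qed.

(** The disk automorphism that takes [a] to 0; its inverse is [mobius (- a)]. *)
Definition mobius a z := (z - a) / (1 - a^* * z).

Lemma mobius_sq a z : rnorm z < 1 -> rnorm a < 1 ->
  1 - rnorm (mobius a z) ^+ 2 =
  (1 - rnorm z ^+ 2) * (1 - rnorm a ^+ 2) / rnorm (1 - a^* * z) ^+ 2.
Proof.
move=> z1 a1; have n0 := one_sub_conj_neq0 z1 a1.
have e := rnorm_1subconj z a.
rewrite rnormM rnormV exprMn exprVn.
have -> : rnorm (z - a) ^+ 2 =
   rnorm (1 - a^* * z) ^+ 2 - (1 - rnorm z ^+ 2) * (1 - rnorm a ^+ 2) by rewrite e; ring.
move: n0; rewrite -rnorm_eq0; move: (rnorm (1 - _)) => N n0; field.
exact: n0.
Qed.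

Lemma mobius_disk a z : rnorm z < 1 -> rnorm a < 1 -> rnorm (mobius a z) < 1.
Proof.
move=> z1 a1; have n0 := one_sub_conj_neq0 z1 a1.
suff : rnorm (mobius a z) ^+ 2 < 1 by rewrite expr_lt1 // rnorm_ge0.
rewrite -subr_gt0 mobius_sq //; apply: divr_gt0.
  by rewrite mulr_gt0 // one_sub_sqr_gt0.
by rewrite exprn_gt0 // rnorm_gt0.
Qed.

Lemma mobius_cdiff a z : rnorm z < 1 -> rnorm a < 1 ->
  cdiff (mobius a) z ((1 - a * a^*) / (1 - a^* * z) ^+ 2).
Proof.
move=> z1 a1; have n0 := one_sub_conj_neq0 z1 a1.
have d1 := cdiffB (cdiff_id z) (cdiff_cst a z).
have d2 := cdiffB (cdiff_cst 1 z) (cdiffM (cdiff_cst a^* z) (cdiff_id z)).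
have := cdiffM d1 (@cdiffV _ (fun w => 1 - a^* * w) z _ n0 d2); congr cdiff.
by field.
Qed.

Lemma mobiusNK a z : rnorm z < 1 -> rnorm a < 1 -> mobius (- a) (mobius a z) = z.
Proof.
move=> z1 a1; have n0 := one_sub_conj_neq0 z1 a1.
have n1 := one_sub_conj_neq0 a1 a1.
have na : rnorm (- a) < 1 by rewrite rnormN.
have n2 := one_sub_conj_neq0 (mobius_disk z1 a1) na.
move: n2; rewrite /mobius rmorphN /= => n2.
have e2 : 1 - - a^* * ((z - a) / (1 - a^* * z)) = (1 - a^* * a) / (1 - a^* * z).
  by field.
rewrite e2 opprK; field; by rewrite n1 n0.
Qed.

Section SelfMap.
Variable phi : C -> C.
Hypothesis phi_diff : forall z, rnorm z < 1 -> exists l, cdiff phi z l.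
Hypothesis phi_disk : forall z, rnorm z < 1 -> rnorm (phi z) < 1.

(** Conjugating [phi] by automorphisms moves [w] and [phi w] to 0, which multiplies the derivative
    by [(1 - rnorm w ^+ 2) / (1 - rnorm (phi w) ^+ 2)]; then [schwarz_derivative] applies. *)
Lemma schwarz_pick_derivative w (l : C) : rnorm w < 1 -> cdiff phi w l ->
  rnorm l * (1 - rnorm w ^+ 2) <= 1 - rnorm (phi w) ^+ 2.
Proof.
move=> w1 dl; have f1 := phi_disk w1.
have Nw1 : rnorm (- w) < 1 by rewrite rnormN.
have o1 : rnorm (0 : C) < 1 by rewrite rnorm0.
have m0 : mobius (- w) 0 = w by rewrite /mobius mulr0 subr0 divr1 sub0r opprK.
pose f z := mobius (phi w) (phi (mobius (- w) z)).
have fd z : rnorm z < 1 -> exists l, cdiff f z l.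
  move=> z1; have mz := mobius_disk z1 Nw1; have [m dm] := phi_diff mz.
  have := cdiff_comp (mobius_cdiff z1 Nw1) dm => d1; eexists.
  exact: (cdiff_comp d1 (mobius_cdiff (phi_disk mz) f1)).
have f_disk z : rnorm z < 1 -> rnorm (f z) < 1.
  by move=> z1; apply: mobius_disk => //; apply: phi_disk; exact: mobius_disk.
have f0 : f 0 = 0 by rewrite /f m0 /mobius subrr mul0r.
have pw := one_sub_sqr_gt0 w1; have pf := one_sub_sqr_gt0 f1.
have dl' : cdiff phi (mobius (- w) 0) l by rewrite m0.
have d1 := cdiff_comp (mobius_cdiff o1 Nw1) dl'.
have f1' : rnorm (phi (mobius (- w) 0)) < 1 by rewrite m0.
have d2 := cdiff_comp d1 (mobius_cdiff f1' f1).
have := schwarz_derivative fd f_disk f0 d2.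
rewrite m0 mulr0 subr0 expr1n divr1 rmorphN /= mulrNN -!rnorm_sqE.
rewrite [(phi w)^* * _]mulrC -rnorm_sqE -realC1 -!realCB -realCX -realCV -realCM.
rewrite !rnormM !rnorm_realC.
have -> : (1 - rnorm (phi w) ^+ 2) / (1 - rnorm (phi w) ^+ 2) ^+ 2 =
    (1 - rnorm (phi w) ^+ 2)^-1 by field; rewrite gt_eqF.
rewrite (ger0_norm (ltW pw)) ger0_norm ?invr_ge0 ?(ltW pf) //.
by rewrite mulrC ler_pdivrMr // mul1r.
Qed.

(* With [u t] the real part of [phi (t p)] in the direction of [phi p] and
   [q = |p|], the derivative bound says that [artanh u - artanh (q t)] is nonincreasing; [E] is
   the exponential of twice this difference. *)
Lemma schwarz p : phi 0 = 0 -> rnorm p < 1 -> rnorm (phi p) <= rnorm p.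
Proof.
move=> phi0 p1; have [->|np0] := eqVneq (phi p) 0; first by rewrite rnorm0 rnorm_ge0.
have np : rnorm (phi p) != 0 by rewrite rnorm_eq0.
(* The rotation [lam] puts the final value [phi p] on the positive real axis, so that a real
   function of one variable suffices. *)
have [lam nlam lamE] : exists2 lam : C, rnorm lam = 1 &
    complex.Re (lam * phi p) = rnorm (phi p).
  exists ((phi p)^* / realC (rnorm (phi p))).
    by rewrite rnormM rnormV rnorm_conj rnorm_realC ger0_norm ?rnorm_ge0 // divff.
  rewrite mulrAC [_^* * _]mulrC -rnorm_sqE -realCV -realCM /=.
  by rewrite expr2 mulfK.
set q := rnorm p; have q0 : 0 <= q := rnorm_ge0 p.
pose u (t : R) := complex.Re (lam * phi (realC t * p)).
have u1 : u 1 = rnorm (phi p) by rewrite /u realC1 mul1r.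
have u0 : u 0 = 0 by rewrite /u realC0 mul0r phi0 mulr0.
have tp (t : R) : 0 <= t <= 1 -> rnorm (realC t * p) = t * q /\ t * q < 1.
  move=> /andP[t0 t1]; rewrite rnormM rnorm_realC ger0_norm //; split => //.
  by apply: le_lt_trans p1; rewrite -[leRHS]mul1r ler_wpM2r.
have ut1 (t : R) : 0 <= t <= 1 -> u t ^+ 2 <= rnorm (phi (realC t * p)) ^+ 2 /\
    rnorm (phi (realC t * p)) < 1.
  move=> /tp[e1 e2]; split; last by apply: phi_disk; rewrite e1.
  rewrite -[leLHS]real_normK ?num_real // ler_pXn2r ?nnegrE ?rnorm_ge0 //.
  by apply: le_trans (normRe_le _) _; rewrite rnormM nlam mul1r.
have du (t : R) : 0 <= t <= 1 -> exists2 du, is_derive t 1 u du &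
    du * (1 - (t * q) ^+ 2) <= q * (1 - u t ^+ 2).
  move=> t01; have [e1 e2] := tp _ t01.
  have [l dl] : exists l, cdiff phi (realC t * p) l by apply: phi_diff; rewrite e1.
  exists (complex.Re (lam * (l * p))); last first.
    have := @schwarz_pick_derivative _ l _ dl; rewrite e1 => /(_ e2) H.
    apply: (@le_trans _ _ (q * (rnorm l * (1 - (t * q) ^+ 2)))).
      rewrite [q * (_ * _)]mulrA ler_wpM2r //.
        have tq0 : 0 <= t * q by rewrite mulr_ge0 //; case/andP: t01.
        by rewrite subr_ge0 expr_le1 ?(ltW e2).
      by apply: le_trans (Re_le_rnorm _) _; rewrite !rnormM nlam mul1r mulrC.
    rewrite ler_wpM2l //; apply: le_trans H _.
    by rewrite lerD2l lerN2; case: (ut1 _ t01).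
  apply/is_derive_affineP => e e0.
  have e'0 : 0 < e / (q + 1) by rewrite divr_gt0 // ltr_wpDl.
  have [d d0 Hd] := cdiff_affine dl e'0; exists (d / (q + 1)).
    by rewrite divr_gt0 // ltr_wpDl.
  move=> h; rewrite ltr_pdivlMr ?ltr_wpDl // => hd.
  have eh : realC (t + h) * p - realC t * p = realC h * p by rewrite realCD; ring.
  have nh : rnorm (realC h * p) = `|h| * q by rewrite rnormM rnorm_realC.
  have := Hd (realC (t + h) * p); rewrite eh nh => H.
  have {}H : rnorm (phi (realC (t + h) * p) - (phi (realC t * p) + l * (realC h * p)))
      <= e / (q + 1) * (`|h| * q).
    by apply: H; apply: le_lt_trans hd; rewrite ler_wpM2l // lerDl.
  have -> : u (t + h) - u t - complex.Re (lam * (l * p)) * h =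
      complex.Re (lam * (phi (realC (t + h) * p) - (phi (realC t * p) + l * (realC h * p)))).
    rewrite /u; move: (phi (realC (t + h) * p)) (phi (realC t * p)) => [x1 y1] [x2 y2].
    by case: (l) => l1 l2; case: (p) => p1' p2; case: (lam) => m1 m2 /=; ring.
  apply: le_trans (normRe_le _) _; rewrite rnormM nlam mul1r; apply: le_trans H _.
  rewrite -mulrA ler_wpM2l ?(ltW e0) // mulrCA ler_piMr // mulrC ler_pdivrMr ?ltr_wpDl //.
  by rewrite mul1r lerDl.
pose E (t : R) := (1 + u t) * (1 - q * t) * ((1 - u t) * (1 + q * t))^-1.
have ub (t : R) : 0 <= t <= 1 -> 0 < 1 - u t /\ 0 < 1 + u t.
  move=> /ut1[H1 H2]; have : `|u t| < 1.
    rewrite -(@ltr_pXn2r _ 2) ?nnegrE // expr1n real_normK ?num_real //.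
    by apply: le_lt_trans H1 _; rewrite expr_lt1 ?rnorm_ge0.
  by rewrite ltr_norml => /andP[]; lra.
have qt (t : R) : 0 <= t <= 1 -> 0 < 1 - q * t /\ 0 < 1 + q * t.
  move=> t01; have [_] := tp _ t01; have : 0 <= t * q by rewrite mulr_ge0 //; case/andP: t01.
  by rewrite mulrC => ? ?; split; lra.
have dE (t : R) : 0 <= t <= 1 -> exists2 dE, is_derive t 1 E dE & dE <= 0.
  move=> t01; have [v dv Hv] := du t t01; have [a1 a2] := ub t t01; have [b1 b2] := qt t t01.
  have nz : (1 - u t) * (1 + q * t) != 0 by rewrite mulf_neq0 ?gt_eqF.
  have dd : is_derive t 1 E (((v * (1 - q * t) - (1 + u t) * q) * ((1 - u t) * (1 + q * t))
       - (1 + u t) * (1 - q * t) * (- v * (1 + q * t) + (1 - u t) * q))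
       / ((1 - u t) * (1 + q * t)) ^+ 2).
    rewrite /E; apply: is_derive_eq; rewrite /GRing.scale /=.
    by field; rewrite ?gt_eqF.
  eexists; first exact: dd.
  rewrite pmulr_lle0 ?invr_gt0 ?exprn_gt0 ?mulr_gt0 //.
  have -> : (v * (1 - q * t) - (1 + u t) * q) * ((1 - u t) * (1 + q * t))
       - (1 + u t) * (1 - q * t) * (- v * (1 + q * t) + (1 - u t) * q) =
     2 * (v * (1 - (t * q) ^+ 2) - q * (1 - u t ^+ 2)) by ring.
  by rewrite pmulr_rle0 // subr_le0.
(* [E 0 = 1] because [u 0 = 0], and [E 1 <= 1] unfolds to [u 1 <= q]. *)
have : E 1 <= E 0.
  have I01 (t : R) : t \in `]0, 1[ -> 0 <= t <= 1.
    by rewrite in_itv /= => /andP[/ltW -> /ltW ->].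
  apply: (@ler0_derive1_nincr R E 0 1); rewrite ?lexx ?ler01 //.
  - by move=> t /I01/dE[v [dv _] _].
  - by move=> t /I01/dE[v dv le0]; rewrite derive1E derive_val.
  - apply: derivable_within_continuous => t; rewrite in_itv /= => /dE[v [dv _] _].
    exact: dv.
have [a1 a2] := ub 1 (introT andP (conj ler01 (lexx 1))).
have [b1 b2] := qt 1 (introT andP (conj ler01 (lexx 1))).
rewrite /E u0 !mulr0 !subr0 !addr0 !mulr1 invr1 ler_pdivrMr ?mulr_gt0 //; last by rewrite mulr1 in b2.
by rewrite u1 mul1r -/q; lra.
Qed.

End SelfMap.

(** This is [schwarz] for the conjugated map at [mobius w z]. By [mobius_sq] the comparison of
    pseudohyperbolic distances becomes an inequality without denominators, convenient for points
    near the boundary. *)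
Theorem schwarz_pick (phi : C -> C) z w :
  (forall z, rnorm z < 1 -> exists l, cdiff phi z l) ->
  (forall z, rnorm z < 1 -> rnorm (phi z) < 1) ->
  rnorm z < 1 -> rnorm w < 1 ->
  (1 - rnorm z ^+ 2) * (1 - rnorm w ^+ 2) * rnorm (1 - (phi w)^* * phi z) ^+ 2 <=
  (1 - rnorm (phi z) ^+ 2) * (1 - rnorm (phi w) ^+ 2) * rnorm (1 - w^* * z) ^+ 2.
Proof.
move=> phi_diff phi_disk z1 w1.
have Nw1 : rnorm (- w) < 1 by rewrite rnormN.
pose f x := mobius (phi w) (phi (mobius (- w) x)).
have fd x : rnorm x < 1 -> exists l, cdiff f x l.
  move=> x1; have mx := mobius_disk x1 Nw1; have [m dm] := phi_diff _ mx.
  have := cdiff_comp (mobius_cdiff x1 Nw1) dm => d1; eexists.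
  exact: (cdiff_comp d1 (mobius_cdiff (phi_disk _ mx) (phi_disk _ w1))).
have f_disk x : rnorm x < 1 -> rnorm (f x) < 1.
  move=> x1; apply: mobius_disk; last exact: phi_disk.
  by apply: phi_disk; exact: mobius_disk.
have f0 : f 0 = 0.
  by rewrite /f {2}/mobius mulr0 subr0 divr1 sub0r opprK /mobius subrr mul0r.
have := schwarz fd f_disk f0 (mobius_disk z1 w1).
rewrite /f mobiusNK // -(@ler_pXn2r _ 2) ?nnegrE ?rnorm_ge0 //.
rewrite -lerN2 -(lerD2l 1) !mobius_sq ?phi_disk //.
have n1 := one_sub_conj_neq0 z1 w1.
have n2 := one_sub_conj_neq0 (phi_disk _ z1) (phi_disk _ w1).
rewrite ler_pdivrMr ?exprn_gt0 ?rnorm_gt0 // mulrAC.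
by rewrite ler_pdivlMr ?exprn_gt0 ?rnorm_gt0.
Qed.

End SchwarzPick.

(** * The Julia-Caratheodory theorem *)

Section JuliaCaratheodory.
Variable R : realType.
Local Notation C := (cplx R).
Implicit Types (z w : C).

(** [psi = (G - 1) / (G + 1)] carries the right half-plane to the disk, with
    [1 - |psi|^2 = 4 Re G / |G + 1|^2]; in [schwarz_pick] for [psi] the factors [|G + 1|] cancel. *)
Lemma halfplane_pick (G : C -> C) z w :
  (forall z, rnorm z < 1 -> exists l, cdiff G z l) ->
  (forall z, rnorm z < 1 -> 0 < complex.Re (G z)) ->
  rnorm z < 1 -> rnorm w < 1 ->
  (1 - rnorm z ^+ 2) * (1 - rnorm w ^+ 2) * rnorm (G z + (G w)^*) ^+ 2 <=
  4 * complex.Re (G z) * complex.Re (G w) * rnorm (1 - w^* * z) ^+ 2.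
Proof.
move=> Gd G0 z1 w1.
have G1 x : rnorm x < 1 -> G x + 1 != 0.
  move=> /G0; case: (G x) => u v /= u0; rewrite eq_complex /= negb_and addr0.
  by rewrite gt_eqF // addr_gt0.
pose psi x := (G x - 1) / (G x + 1).
have psi_sq x : rnorm x < 1 ->
    1 - rnorm (psi x) ^+ 2 = 4 * complex.Re (G x) / rnorm (G x + 1) ^+ 2.
  move=> /G1 n0; have : rnorm (G x + 1) ^+ 2 != 0 by rewrite expf_eq0 rnorm_eq0.
  rewrite /psi rnormM rnormV exprMn exprVn.
  have -> : rnorm (G x - 1) ^+ 2 = rnorm (G x + 1) ^+ 2 - 4 * complex.Re (G x).
    by rewrite !rnorm_sq; case: (G x) => u v /=; ring.
  by move: (rnorm _ ^+ 2) => N N0; field.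
have psi_disk x : rnorm x < 1 -> rnorm (psi x) < 1.
  move=> x1; suff : rnorm (psi x) ^+ 2 < 1 by rewrite expr_lt1 // rnorm_ge0.
  rewrite -subr_gt0 psi_sq //; apply: divr_gt0; first by rewrite mulr_gt0 // G0.
  by rewrite exprn_gt0 // rnorm_gt0 G1.
have psi_diff x : rnorm x < 1 -> exists l, cdiff psi x l.
  move=> x1; have [l dl] := Gd x x1; eexists.
  apply: (cdiffM (cdiffB dl (cdiff_cst 1 x))).
  exact: (@cdiffV _ (fun x => G x + 1) x _ (G1 x x1) (cdiffD dl (cdiff_cst 1 x))).
have := schwarz_pick psi_diff psi_disk z1 w1.
have nz := G1 z z1; have nw := G1 w w1.
have nwc : (G w)^* + 1 != 0 by rewrite -(conjC_eq0 (G w + 1)) rmorphD /= conjC1 in nw.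
have -> : 1 - (psi w)^* * psi z = 2 * (G z + (G w)^*) / ((G z + 1) * ((G w)^* + 1)).
  rewrite /psi rmorphM rmorphB fmorphV rmorphD /= conjC1.
  by field; rewrite nz nwc.
rewrite !psi_sq // !rnormM rnormV rnormM.
have -> : rnorm ((G w)^* + 1) = rnorm (G w + 1).
  by rewrite -rnorm_conj rmorphD /= conjCK conjC1.
have -> : rnorm (2 : C) = 2 by rewrite -[2]/(1 + 1) -realC1 -realCD rnorm_realC ger0_norm.
move: nz nw; rewrite -!rnorm_gt0.
move: (rnorm (G z + 1)) (rnorm (G w + 1)) => N1 N2 p1 p2 H.
set A := _ * rnorm (_ + _) ^+ 2; set B := 4 * _ * _ * _.
rewrite -(@ler_pM2r _ (4 / (N1 * N2) ^+ 2)); last first.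
  by rewrite divr_gt0 // exprn_gt0 // mulr_gt0.
apply: le_trans (le_trans H _); rewrite /A /B le_eqVlt; apply/orP; left; apply/eqP.
  by field; rewrite !gt_eqF.
by field; rewrite !gt_eqF.
Qed.

Section SelfMap.
Variable phi : C -> C.
Hypothesis phi_self : analytic_selfmap phi.

Lemma selfmap_disk z : rnorm z < 1 -> rnorm (phi z) < 1.
Proof. by move=> /diskE z1; apply/diskE; exact: phi_self.2. Qed.

Lemma selfmap_cdiff z : rnorm z < 1 -> exists l, cdiff phi z l.
Proof. by move=> /diskE z1; apply: derivable_cdiff; exact: phi_self.1. Qed.

Definition self_pick z w := @schwarz_pick R phi z w selfmap_cdiff selfmap_disk.

Variable zeta : C.
Hypothesis zeta1 : rnorm zeta = 1.

Lemma rnorm_boundary (x y : C) : rnorm x = 1 -> rnorm (1 - x^* * y) = rnorm (x - y).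
Proof.
move=> x1; have xx : x^* * x = 1 by rewrite mulrC -rnorm_sqE x1 expr1n.
by rewrite -{1}xx -mulrBr rnormM rnorm_conj x1 mul1r.
Qed.

Lemma rnorm_1subconj_le (x w z : C) : rnorm x = 1 -> rnorm z <= 1 ->
  rnorm (1 - w^* * z) <= rnorm (x - w) + rnorm (x - z).
Proof.
move=> x1 z1; have -> : 1 - w^* * z = (1 - x^* * z) + (x - w)^* * z.
  by rewrite rmorphB /=; ring.
apply: le_trans (rnormD _ _) _; rewrite rnorm_boundary // addrC lerD2r.
by rewrite rnormM rnorm_conj ler_piMr ?rnorm_ge0.
Qed.

(** Schwarz-Pick at two points where the ratio is at most [M] gives [|phi w_n - phi w_m| <= 2 M |1 -
    conj w_m w_n|], and both points are close to [zeta]. So the images form a Cauchy sequence, and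
    the ratio bound forces the limit onto the circle. *)
Lemma julia_limit_point (M : R) : 0 < M ->
  (forall d, 0 < d -> exists w, [/\ rnorm w < 1, rnorm (w - zeta) < d &
     1 - rnorm (phi w) <= M * (1 - rnorm w)]) ->
  exists2 eta : C, rnorm eta = 1 & forall d, 0 < d ->
    exists w, [/\ rnorm w < 1, rnorm (w - zeta) < d, rnorm (phi w - eta) < d &
      1 - rnorm (phi w) <= M * (1 - rnorm w)].
Proof.
move=> M0 H.
have /choice[w Hw] : forall n : nat, exists w, [/\ rnorm w < 1,
    rnorm (w - zeta) < n.+1%:R^-1 & 1 - rnorm (phi w) <= M * (1 - rnorm w)].
  by move=> n; apply: H; rewrite invr_gt0 ltr0n.
have close n m : rnorm (phi (w n) - phi (w m)) <= 2 * M * (n.+1%:R^-1 + m.+1%:R^-1).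
  have [n1 n2 n3] := Hw n; have [m1 m2 m3] := Hw m.
  have fn := selfmap_disk n1; have fm := selfmap_disk m1.
  have bound k : 1 - rnorm (phi (w k)) ^+ 2 <= 2 * M * (1 - rnorm (w k) ^+ 2).
    have [k1 k2 k3] := Hw k; have k4 := selfmap_disk k1.
    have := rnorm_ge0 (phi (w k)); have := rnorm_ge0 (w k); nra.
  have := self_pick n1 m1.
  have pn := one_sub_sqr_gt0 n1; have pm := one_sub_sqr_gt0 m1.
  have pfn := one_sub_sqr_gt0 fn; have pfm := one_sub_sqr_gt0 fm.
  set X := rnorm (1 - (phi _)^* * _); set Y := rnorm (1 - (w m)^* * w n) => P.
  have XY : X <= 2 * M * Y.
    rewrite -(@ler_pXn2r _ 2) ?nnegrE ?rnorm_ge0 ?mulr_ge0 ?rnorm_ge0 ?(ltW M0) //.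
    rewrite -(ler_pM2l (mulr_gt0 pn pm)); apply: le_trans P _.
    have -> : (1 - rnorm (w n) ^+ 2) * (1 - rnorm (w m) ^+ 2) * (2 * M * Y) ^+ 2 =
      (2 * M * (1 - rnorm (w n) ^+ 2)) * (2 * M * (1 - rnorm (w m) ^+ 2)) * Y ^+ 2 by ring.
    by rewrite ler_wpM2r ?sqr_ge0 // ler_pM ?(ltW pfn) ?(ltW pfm).
  have fX : rnorm (phi (w n) - phi (w m)) <= X.
    rewrite -(@ler_pXn2r _ 2) ?nnegrE ?rnorm_ge0 // rnorm_1subconj lerDl.
    by rewrite mulr_ge0 // ltW.
  apply: le_trans fX (le_trans XY _); rewrite ler_pM2l ?mulr_gt0 //.
  apply: le_trans (rnorm_1subconj_le (w m) zeta1 (ltW n1)) _.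
  by rewrite !(rnorm_distC zeta) addrC lerD // ltW.
have small e : 0 < e -> exists N, forall n, (N <= n)%N -> n.+1%:R^-1 < e :> R.
  move=> e0; have [N _ HN] := near_infty_natSinv_lt (PosNum e0).
  by exists N => n Nn; exact: HN.
have cauchyR (x : nat -> R) : (forall n m, `|x n - x m| <= rnorm (phi (w n) - phi (w m))) ->
    cvgn x.
  move=> Hx; apply/cauchy_cvgP/cauchy_exP => e e0.
  have e40 : 0 < e / (4 * M) by rewrite divr_gt0 // mulr_gt0.
  have [N HN] := small _ e40; exists (x N); exists N => // n /= Nn.
  rewrite /ball /=; apply: le_lt_trans (Hx _ _) (le_lt_trans (close _ _) _).
  have -> : e = 2 * M * (e / (4 * M) + e / (4 * M)) by field; rewrite gt_eqF.
  by rewrite ltr_pM2l ?mulr_gt0 // ltrD // HN.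
have cRe : cvgn (fun n => complex.Re (phi (w n))).
  by apply: cauchyR => n m; rewrite -ReB; exact: normRe_le.
have cIm : cvgn (fun n => complex.Im (phi (w n))).
  by apply: cauchyR => n m; rewrite -ImB; exact: normIm_le.
move: cRe cIm => /cvg_ex[/= x /cvgrPdist_lt cx] /cvg_ex[/= y /cvgrPdist_lt cy].
pose eta : C := Complex x y.
have conv e : 0 < e -> exists n, rnorm (phi (w n) - eta) < e /\ n.+1%:R^-1 < e.
  move=> e0; have e20 : 0 < e / 2 by rewrite divr_gt0.
  have [N1 _ H1] := cx _ e20; have [N2 _ H2] := cy _ e20; have [N3 H3] := small _ e0.
  pose n := (N1 + N2 + N3)%N; exists n; split; last by apply: H3; rewrite leq_addl.
  apply: le_lt_trans (rnorm_le_ReIm _) _; rewrite ReB ImB /=.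
  have := H1 n; have := H2 n; rewrite /= !(distrC _ (complex.Re _)) !(distrC _ (complex.Im _)).
  have -> : (N2 <= n)%N by rewrite /n addnAC leq_addl.
  have -> : (N1 <= n)%N by rewrite /n -addnA leq_addr.
  by move=> /(_ isT) + /(_ isT); lra.
exists eta; last first.
  move=> d d0; have [n [n1 n2]] := conv _ d0; exists (w n).
  by have [w1 w2 w3] := Hw n; split => //; exact: lt_trans w2 n2.
apply/eqP; rewrite eq_le; apply/andP; split; apply/ler_addgt0Pr => e e0.
  have [n [n1 _]] := conv _ e0; have [w1 _ _] := Hw n; have := selfmap_disk w1.
  have := rnorm_lerB eta (phi (w n)); rewrite rnorm_distC; lra.
have e20 : 0 < e / (1 + M) by rewrite divr_gt0 // addr_gt0.
have [n [n1 n2]] := conv _ e20; have [w1 w2 w3] := Hw n.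
have := rnorm_lerB (phi (w n)) eta; have := rnorm_lerB zeta (w n).
rewrite zeta1 rnorm_distC => h1 h2.
have h3 : M * (1 - rnorm (w n)) <= M * (e / (1 + M)).
  by rewrite ler_wpM2l ?(ltW M0) // (le_trans h1) // ltW // (lt_trans w2).
have h4 : e = e / (1 + M) + M * (e / (1 + M)) by field; rewrite gt_eqF // addr_gt0.
move: h3 h4 n1; move: (e / (1 + M)) => e'; lra.
Qed.

Definition julia_point (M : R) (eta : C) := forall d, 0 < d ->
  exists w, [/\ rnorm w < 1, rnorm (w - zeta) < d, rnorm (phi w - eta) < d &
    1 - rnorm (phi w) <= M * (1 - rnorm w)].

(** Schwarz-Pick with the second point [w] near [zeta] and [phi w] near [eta]. The constant 32 is 2
    * 4 * 4: the ratio bound for squares, [|1 - conj w z| <= 2 Y], and [|phi z - phi w| >= X / 2].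
    It only has to be finite, since the sole use is that the infimum of the Cayley ratios is
    positive. *)
Lemma julia (M : R) (eta z : C) : 0 < M -> rnorm eta = 1 -> julia_point M eta ->
  rnorm z < 1 ->
  (1 - rnorm z ^+ 2) * rnorm (eta - phi z) ^+ 2 <=
  32 * M * (1 - rnorm (phi z) ^+ 2) * rnorm (zeta - z) ^+ 2.
Proof.
move=> M0 eta1 jp z1; have f1 := selfmap_disk z1.
set X := rnorm (eta - phi z); set Y := rnorm (zeta - z).
have X0 : 0 < X by have := rnorm_lerB eta (phi z); rewrite -/X eta1; lra.
have Y0 : 0 < Y by have := rnorm_lerB zeta z; rewrite -/Y zeta1; lra.
have d0 : 0 < Num.min (X / 2) Y by rewrite lt_min Y0 divr_gt0.
have [w [w1 w2 w3 w4]] := jp _ d0; have fw := selfmap_disk w1.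
move: w2 w3; rewrite !lt_min => /andP[_ w2] /andP[w3 _].
have P := self_pick z1 w1.
have pz := one_sub_sqr_gt0 z1; have pw := one_sub_sqr_gt0 w1.
have pfz := one_sub_sqr_gt0 f1; have pfw := one_sub_sqr_gt0 fw.
have b1 : 1 - rnorm (phi w) ^+ 2 <= 2 * M * (1 - rnorm w ^+ 2).
  by have := rnorm_ge0 (phi w); have := rnorm_ge0 w; nra.
have b2 : rnorm (1 - w^* * z) ^+ 2 <= 4 * Y ^+ 2.
  have -> : 4 * Y ^+ 2 = (2 * Y) ^+ 2 by ring.
  rewrite ler_pXn2r ?nnegrE ?rnorm_ge0 ?mulr_ge0 ?rnorm_ge0 //.
  apply: le_trans (rnorm_1subconj_le w zeta1 (ltW z1)) _.
  by rewrite (rnorm_distC zeta w) -/Y; lra.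
have b3 : X ^+ 2 / 4 <= rnorm (1 - (phi w)^* * phi z) ^+ 2.
  rewrite rnorm_1subconj; apply: (@le_trans _ _ (rnorm (phi z - phi w) ^+ 2)); last first.
    by rewrite lerDl mulr_ge0 // ltW.
  have -> : X ^+ 2 / 4 = (X / 2) ^+ 2 by field.
  rewrite ler_pXn2r ?nnegrE ?rnorm_ge0 ?divr_ge0 ?rnorm_ge0 //.
  have := rnorm_tri eta (phi w) (phi z); rewrite -/X !(rnorm_distC _ (phi w)); lra.
rewrite -(ler_pM2l pw).
have h1 : (1 - rnorm z ^+ 2) * (1 - rnorm w ^+ 2) * (X ^+ 2 / 4) <=
   (1 - rnorm z ^+ 2) * (1 - rnorm w ^+ 2) * rnorm (1 - (phi w)^* * phi z) ^+ 2.
  by rewrite ler_pM2l ?mulr_gt0.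
have h2 : (1 - rnorm (phi z) ^+ 2) * (1 - rnorm (phi w) ^+ 2) * rnorm (1 - w^* * z) ^+ 2
   <= (1 - rnorm (phi z) ^+ 2) * (2 * M * (1 - rnorm w ^+ 2)) * (4 * Y ^+ 2).
  apply: ler_pM; rewrite ?sqr_ge0 ?mulr_ge0 ?(ltW pfz) ?(ltW pfw) //.
  by rewrite ler_pM2l.
have := le_trans h1 (le_trans P h2); lra.
Qed.

(** Carries the disk to the right half-plane with the pole at [eta]; its real part is the Poisson
    kernel, so [julia] compares real parts of two such transforms. *)
Definition cayley (eta v : C) := (eta + v) / (eta - v).

Lemma boundary_neq (eta v : C) : rnorm eta = 1 -> rnorm v < 1 -> eta - v != 0.
Proof.
move=> e1 v1; rewrite -rnorm_gt0; have := rnorm_lerB eta v; rewrite e1; lra.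
Qed.

Lemma Re_cayley (eta v : C) : rnorm eta = 1 -> rnorm v < 1 ->
  complex.Re (cayley eta v) = (1 - rnorm v ^+ 2) / rnorm (eta - v) ^+ 2.
Proof.
move=> e1 v1; have n0 := boundary_neq e1 v1.
have -> : cayley eta v = (eta + v) * (eta - v)^* * realC (rnorm (eta - v) ^+ 2)^-1.
  have n1 : (eta - v)^* != 0 by rewrite conjC_eq0.
  rewrite realCV rnorm_sqE /cayley; move: ((eta - v)^*) n1 => x n1.
  by field; rewrite n0 n1.
have <- : rnorm eta ^+ 2 - rnorm v ^+ 2 = 1 - rnorm v ^+ 2 by rewrite e1 expr1n.
move: (rnorm (eta - v) ^+ 2) => N; rewrite !rnorm_sq.
by case: eta {e1 n0} => a b; case: v {v1} => c d /=; ring.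
Qed.

Lemma cayley_cdiff (eta z l : C) (f : C -> C) : eta - f z != 0 -> cdiff f z l ->
  exists m, cdiff (fun w => cayley eta (f w)) z m.
Proof.
move=> n0 d; eexists; apply: (cdiffM (cdiffD (cdiff_cst eta z) d)).
exact: (@cdiffV _ (fun w => eta - f w) z _ n0 (cdiffB (cdiff_cst eta z) d)).
Qed.

Lemma nontangentialP (f : C -> C) (x l : C) : nontangential_lim f x l <->
  forall M e : R, 1 < M -> 0 < e -> exists2 d, 0 < d & forall z, rnorm z < 1 ->
    rnorm (z - x) < M * (1 - rnorm z) -> rnorm (z - x) < d -> rnorm (f z - l) < e.
Proof.
split=> [H M e M1 e0|H M M1].
  have := (cvg_rnormP (within_filter (stolz M x) (nbhs_filter x)) f l).1 (H M M1) e e0.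
  move=> /nbhs_rnormP[d d0 Hd]; exists d => // z z1 z2 z3.
  by apply: Hd => //; split => //; exact/diskE.
apply/(cvg_rnormP (within_filter (stolz M x) (nbhs_filter x))) => e e0.
have [d d0 Hd] := H M e M1 e0; apply/nbhs_rnormP; exists d => // z zd [/diskE z1 z2].
exact: Hd.
Qed.

(* [c] is the least ratio of the real parts of the Cayley transforms of
   [phi z] and [z]; subtracting almost [c] times the latter leaves a map [G] into
   the half-plane with a small ratio at some [w], and Pick's inequality carries
   this smallness from [w] to the Stolz regions at [zeta]. *)
Lemma cayley_ratio_limit (M0 : R) (eta : C) : 0 < M0 -> rnorm eta = 1 ->
  julia_point M0 eta -> exists2 c : R, 0 < c &
  forall M e : R, 1 < M -> 0 < e -> exists2 d, 0 < d & forall z, rnorm z < 1 ->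
    rnorm (z - zeta) < M * (1 - rnorm z) -> rnorm (z - zeta) < d ->
    rnorm (cayley eta (phi z) * (zeta - z) - realC c * (zeta + z)) < e.
Proof.
move=> M00 eta1 jp.
pose E := [set r | exists2 z, rnorm z < 1 &
  r = complex.Re (cayley eta (phi z)) / complex.Re (cayley zeta z)].
have res z : rnorm z < 1 -> 0 < complex.Re (cayley zeta z).
  move=> z1; rewrite Re_cayley //; apply: divr_gt0; first exact: one_sub_sqr_gt0.
  by rewrite exprn_gt0 // rnorm_gt0 boundary_neq.
have lbE : lbound E (32 * M0)^-1.
  move=> _ [z z1 ->]; have f1 := selfmap_disk z1.
  rewrite ler_pdivlMr ?res // !Re_cayley //.
  have n1 := boundary_neq eta1 f1; have n2 := boundary_neq zeta1 z1.
  rewrite ler_pdivlMr ?exprn_gt0 ?rnorm_gt0 //.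
  have -> : (32 * M0)^-1 * ((1 - rnorm z ^+ 2) / rnorm (zeta - z) ^+ 2) *
     rnorm (eta - phi z) ^+ 2 = ((1 - rnorm z ^+ 2) * rnorm (eta - phi z) ^+ 2) /
     (32 * M0 * rnorm (zeta - z) ^+ 2).
    move: n2; rewrite -rnorm_gt0; move: (rnorm (zeta - z)) => N N0.
    by field; rewrite !gt_eqF.
  rewrite ler_pdivrMr; last first.
    by apply: mulr_gt0; [rewrite mulr_gt0|rewrite exprn_gt0 // rnorm_gt0].
  by have := julia M00 eta1 jp z1; lra.
have E0 : E !=set0 by eexists; exists 0 => //; rewrite rnorm0.
have hinf : has_inf E by split => //; exists (32 * M0)^-1.
pose c := inf E.
have c0 : 0 < c.
  by apply: lt_le_trans (lb_le_inf E0 lbE); rewrite invr_gt0 mulr_gt0.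
exists c => // M e M1 e0.
(* The errors proportional to [del] are [32 * del * M] and [2 * del]; this value makes their sum
   [e / 4]. *)
pose del := e / (4 * (32 * M + 2)).
have P0 : 0 < 32 * M + 2 by lra.
have del0 : 0 < del by rewrite divr_gt0 // mulr_gt0.
pose G z := cayley eta (phi z) - realC (c - del) * cayley zeta z.
have ReG z : complex.Re (G z) =
    complex.Re (cayley eta (phi z)) - (c - del) * complex.Re (cayley zeta z).
  rewrite /G ReB; congr (_ - _).
  by move: (cayley zeta z) => [a b] /=; rewrite mul0r subr0.
have G0 z : rnorm z < 1 -> 0 < complex.Re (G z).
  move=> z1; rewrite ReG; have s0 := res z z1.
  have : c <= complex.Re (cayley eta (phi z)) / complex.Re (cayley zeta z).
    by apply: ge_inf; [exact: hinf.2|exists z].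
  by rewrite ler_pdivlMr // => ?; nra.
have Gd z : rnorm z < 1 -> exists l, cdiff G z l.
  move=> z1; have [l dl] := selfmap_cdiff z1.
  have [m1 d1] := cayley_cdiff (boundary_neq eta1 (selfmap_disk z1)) dl.
  have [m2 d2] := cayley_cdiff (boundary_neq zeta1 z1) (cdiff_id z).
  by eexists; exact: (cdiffB d1 (cdiffM (cdiff_cst _ z) d2)).
have [_ [w w1 ->]] := inf_adherent del0 hinf.
rewrite -/c ltr_pdivrMr ?res // => Hw.
have Gw : complex.Re (G w) <= 2 * del * complex.Re (cayley zeta w) by rewrite ReG; lra.
have Y0 : 0 < rnorm (zeta - w) by rewrite rnorm_gt0 boundary_neq.
(* Pick's inequality bounds [X ^+ 2] by a multiple of [Re (G z) * Re (G w)]. As [Re (G z) <= X], one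
   factor [X] cancels and the smallness of [Re (G w)] remains. *)
have key z : rnorm z < 1 -> rnorm (z - zeta) <= rnorm (zeta - w) ->
    rnorm (G z + (G w)^*) * (1 - rnorm z) <= 32 * del.
  move=> z1 zw; have := halfplane_pick Gd G0 z1 w1.
  have pz := one_sub_sqr_gt0 z1; have pw := one_sub_sqr_gt0 w1.
  have gz := G0 z z1; have gw := G0 w w1.
  set X := rnorm (G z + _) => P.
  have XG : complex.Re (G z) + complex.Re (G w) <= X.
    by have := Re_le_rnorm (G z + (G w)^*); rewrite ReD -/X; case: (G w).
  have b2 : rnorm (1 - w^* * z) ^+ 2 <= 4 * rnorm (zeta - w) ^+ 2.
    have -> : 4 * rnorm (zeta - w) ^+ 2 = (2 * rnorm (zeta - w)) ^+ 2 by ring.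
    rewrite ler_pXn2r ?nnegrE ?rnorm_ge0 ?mulr_ge0 ?rnorm_ge0 //.
    apply: le_trans (rnorm_1subconj_le w zeta1 (ltW z1)) _.
    by rewrite (rnorm_distC zeta z); lra.
  have X0 : 0 < X by lra.
  have h1 : 4 * complex.Re (G z) * complex.Re (G w) * rnorm (1 - w^* * z) ^+ 2 <=
     4 * X * (2 * del * complex.Re (cayley zeta w)) * (4 * rnorm (zeta - w) ^+ 2).
    apply: ler_pM; rewrite ?sqr_ge0 ?mulr_ge0 ?(ltW gz) ?(ltW gw) //.
    apply: ler_pM; rewrite ?mulr_ge0 ?(ltW gz) ?(ltW gw) //.
    by rewrite ler_pM2l //; lra.
  have h2 : complex.Re (cayley zeta w) * rnorm (zeta - w) ^+ 2 = 1 - rnorm w ^+ 2.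
    by rewrite Re_cayley // divfK // expf_eq0 gt_eqF.
  have {h1 h2}P : (1 - rnorm w ^+ 2) * X * ((1 - rnorm z ^+ 2) * X) <=
     (1 - rnorm w ^+ 2) * X * (32 * del).
    have := le_trans P h1; rewrite -h2; lra.
  move: P; rewrite ler_pM2l ?mulr_gt0 // => P; apply: le_trans P.
  rewrite mulrC ler_pM2r //; have := rnorm_ge0 z; nra.
(* The point [w] is fixed before [z]: the first bound is what [key] asks for, the second makes the
   fixed term in [G w] small. *)
pose d := Num.min (rnorm (zeta - w)) (e / (4 * (rnorm (G w) + 1))).
have g1 : 0 < rnorm (G w) + 1 by have := rnorm_ge0 (G w); lra.
exists d; first by rewrite lt_min Y0 divr_gt0 // mulr_gt0.
move=> z z1 z2; rewrite lt_min => /andP[zw zd].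
have K := key z z1 (ltW zw).
have -> : cayley eta (phi z) * (zeta - z) - realC c * (zeta + z) =
    (G z + (G w)^*) * (zeta - z) - (G w)^* * (zeta - z) - realC del * (zeta + z).
  move: ((G w)^*) => y; rewrite /G realCB [cayley zeta z]/cayley.
  by have := boundary_neq zeta1 z1; move: (cayley eta _) => x n0; field.
have t1 : rnorm ((G z + (G w)^*) * (zeta - z)) <= 32 * del * M.
  rewrite rnormM (rnorm_distC zeta).
  apply: (@le_trans _ _ (rnorm (G z + (G w)^*) * (M * (1 - rnorm z)))).
    by rewrite ler_wpM2l ?rnorm_ge0 // ltW.
  by rewrite mulrCA mulrC ler_wpM2r //; lra.
have t2 : rnorm ((G w)^* * (zeta - z)) <= e / 4.
  rewrite rnormM rnorm_conj (rnorm_distC zeta).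
  move: zd; rewrite ltr_pdivlMr ?mulr_gt0 // => zd.
  have := rnorm_ge0 (z - zeta); have := rnorm_ge0 (G w); nra.
have t3 : rnorm (realC del * (zeta + z)) <= del * 2.
  rewrite rnormM rnorm_realC ger0_norm ?(ltW del0) // ler_pM2l //.
  by apply: le_trans (rnormD _ _) _; rewrite zeta1; lra.
have t4 : del * (32 * M + 2) = e / 4.
  by rewrite /del; field; rewrite gt_eqF.
apply: le_lt_trans (rnormB _ _) _.
have := rnormB ((G z + (G w)^*) * (zeta - z)) ((G w)^* * (zeta - z)).
lra.
Qed.

(** As [cayley eta v + 1 = 2 * eta / (eta - v)], the function [h] differs from
    [cayley eta (phi z) * (zeta - z)] by [zeta - z] only. Its limit [2 c zeta] is nonzero because
    [c > 0], and the difference quotient of [phi] is [2 * eta / h]. *)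
Lemma julia_angular (M0 : R) (eta : C) : 0 < M0 -> rnorm eta = 1 ->
  julia_point M0 eta -> angular_set phi zeta.
Proof.
move=> M00 eta1 jp; have [c c0 Hc] := cayley_ratio_limit M00 eta1 jp.
split; first exact/norm1E.
pose h z := 2 * eta * (zeta - z) / (eta - phi z).
pose l := 2 * eta * (2 * realC c * zeta)^-1.
have hl : nontangential_lim h zeta (2 * realC c * zeta).
  apply/nontangentialP => M e M1 e0; have e20 : 0 < e / 2 by rewrite divr_gt0.
  have [d d0 Hd] := Hc M _ M1 e20.
  exists (Num.min d (e / (2 * (1 + c)))).
    by rewrite lt_min d0 divr_gt0 // mulr_gt0 // addr_gt0.
  move=> z z1 z2; rewrite lt_min => /andP[z3 z4].
  have n0 := boundary_neq eta1 (selfmap_disk z1).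
  have -> : h z - 2 * realC c * zeta =
    (cayley eta (phi z) * (zeta - z) - realC c * (zeta + z))
      + (realC c * (z - zeta) - (z - zeta)).
    by rewrite /h /cayley; field.
  apply: le_lt_trans (rnormD _ _) _.
  have := rnormB (realC c * (z - zeta)) (z - zeta).
  rewrite rnormM rnorm_realC ger0_norm ?(ltW c0) //.
  have := Hd z z1 z2 z3; move: z4; rewrite ltr_pdivlMr ?mulr_gt0 ?addr_gt0 //.
  lra.
have D : nontangential_lim (fun z => (phi z - eta) / (z - zeta)) zeta l.
  have -> : (fun z => (phi z - eta) / (z - zeta)) = (fun z => 2 * eta * (h z)^-1).
    apply/funext => z; rewrite /h.
    have n2 : 2 * eta != 0 by rewrite mulf_neq0 // -rnorm_gt0 ?eta1.
    rewrite -[2 * eta * _ / _]mulrA invfM invf_div mulrA divff // mul1r.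
    by rewrite -(opprB z) -(opprB (phi z)) invrN mulrNN.
  move=> M M1; have cv : 2 * realC c * zeta != 0.
    apply: mulf_neq0; last by rewrite -rnorm_gt0 zeta1.
    by rewrite mulf_neq0 ?pnatr_eq0 // realC_eq0 gt_eqF.
  have fl := within_filter (stolz M zeta) (nbhs_filter zeta).
  apply: (@cvgM C _ _ fl (fun=> 2 * eta) (fun z => (h z)^-1)); first exact: cvg_cst.
  by apply: (@cvgV C _ _ fl h) => //; exact: hl.
exists eta; split; [|exact/norm1E|by exists l].
(* A finite limit of the difference quotient forces [phi z] to tend to [eta]. *)
apply/nontangentialP => M e M1 e0.
have [d d0 Hd] := (nontangentialP _ _ _).1 D M 1 M1 ltr01.
have l1 : 0 < rnorm l + 1 by have := rnorm_ge0 l; lra.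
exists (Num.min d (e / (rnorm l + 1))); first by rewrite lt_min d0 divr_gt0.
move=> z z1 z2; rewrite lt_min => /andP[z3 z4].
have nz : z - zeta != 0 by rewrite -rnorm_gt0 rnorm_distC rnorm_gt0 boundary_neq.
have := Hd z z1 z2 z3; move: z4; rewrite ltr_pdivlMr // => z4.
have {2}-> : phi z - eta = (phi z - eta) / (z - zeta) * (z - zeta) by rewrite divfK.
move: ((phi z - eta) / (z - zeta)) => x xl; rewrite rnormM.
have := rnorm_lerB x l; have := rnorm_ge0 x; have := rnorm_ge0 l.
have : 0 < rnorm (z - zeta) by rewrite rnorm_gt0.
nra.
Qed.

(** Proved by contraposition: a ratio that stays bounded along points tending to [zeta] yields a
    [julia_point], hence an angular derivative. *)
Theorem julia_caratheodory : ~ angular_set phi zeta -> forall M : R, exists2 d, 0 < d &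
  forall w, rnorm w < 1 -> rnorm (w - zeta) < d -> M * (1 - rnorm w) < 1 - rnorm (phi w).
Proof.
move=> nang M; apply: contrapT => H; apply: nang.
(* [M] is an arbitrary real, while [julia_limit_point] takes a positive bound. *)
have M0 : 0 < `|M| + 1 by rewrite ltr_wpDl.
have [eta e1 jp] : exists2 eta : C, rnorm eta = 1 & julia_point (`|M| + 1) eta.
  apply: julia_limit_point => // d d0; apply: contrapT => /forallNP H1; apply: H.
  exists d => // w w1 wd; rewrite ltNge; apply/negP => wM; apply: (H1 w); split => //.
  apply: le_trans wM _; rewrite ler_wpM2r ?subr_ge0 ?(ltW w1) //.
  by rewrite (le_trans (ler_norm _)) // lerDl.
exact: julia_angular e1 jp.
Qed.

(** Schwarz-Pick against the base point 0, with the constant depending on [|phi 0|]. It keeps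
    boundary derivatives away from 0 and bounds the companion map when only one map of a pair is out
    of contact. *)
Lemma selfmap_one_sub_ge : exists2 c : R, 0 < c &
  forall z, rnorm z < 1 -> c * (1 - rnorm z) <= 1 - rnorm (phi z).
Proof.
have o1 : rnorm (0 : C) < 1 by rewrite rnorm0.
have f0 := selfmap_disk o1; set a := rnorm (phi 0) in f0.
exists ((1 - a) / 4); first by rewrite divr_gt0 // subr_gt0.
move=> z z1; have fz := selfmap_disk z1; have := self_pick z1 o1.
rewrite rnorm0 expr0n subr0 mulr1 conjC0 mul0r subr0 rnorm1 expr1n mulr1.
have a0 : 0 <= a := rnorm_ge0 _.
have b0 := rnorm_ge0 (phi z); have c0 := rnorm_ge0 z.
have : (1 - a) ^+ 2 <= rnorm (1 - (phi 0)^* * phi z) ^+ 2.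
  rewrite ler_pXn2r ?nnegrE ?rnorm_ge0 ?subr_ge0 ?(ltW f0) //.
  have := rnorm_lerB 1 ((phi 0)^* * phi z); rewrite rnorm1 rnormM rnorm_conj -/a.
  have : a * rnorm (phi z) <= a * 1 by rewrite ler_wpM2l // ltW.
  lra.
move=> h1 h2.
have h3 : (1 - rnorm z ^+ 2) * (1 - a) ^+ 2 <=
    (1 - rnorm (phi z) ^+ 2) * (1 - a ^+ 2).
  by apply: le_trans h2; rewrite ler_wpM2l // ltW // one_sub_sqr_gt0.
have h4 : (1 - rnorm z ^+ 2) * (1 - a) <= (1 - rnorm (phi z) ^+ 2) * (1 + a).
  have p : 0 < 1 - a by rewrite subr_gt0.
  by rewrite -(ler_pM2r p); lra.
have h5 : (1 - rnorm z) * (1 - a) <= (1 - rnorm z ^+ 2) * (1 - a).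
  by rewrite ler_wpM2r ?subr_ge0 ?(ltW f0) //; nra.
have h6 : (1 - rnorm (phi z) ^+ 2) * (1 + a) <= (2 * (1 - rnorm (phi z))) * 2.
  apply: ler_pM; first exact/ltW/one_sub_sqr_gt0.
  - lra.
  - nra.
  - lra.
lra.
Qed.

End SelfMap.
End JuliaCaratheodory.

(** * Boundary Taylor data *)

Section TaylorData.
Variable R : realType.
Local Notation C := (cplx R).
Implicit Types (b : nat -> C) (z w x y : C).

(** [n] counts coefficients, so data of order [k] go with [taylor b k.+1]; an infinite sequence [b]
    lets the order drop without changing the coefficients. *)
Definition taylor b n x : C := \sum_(j < n) b j * x ^+ j.

Lemma taylorS b n x : taylor b n.+1 x = taylor b n x + b n * x ^+ n.
Proof. by rewrite /taylor big_ord_recr. Qed.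

Lemma taylor_shift b n x : taylor b n.+1 x = b 0%N + x * taylor (fun j => b j.+1) n x.
Proof.
rewrite /taylor big_ord_recl /= expr0 mulr1; congr (_ + _); rewrite big_distrr /=.
by apply: eq_bigr => j _; rewrite /bump /= add1n exprS; ring.
Qed.

Lemma taylorB b b' n x : taylor (fun j => b j - b' j) n x = taylor b n x - taylor b' n x.
Proof. by rewrite /taylor -sumrB; apply: eq_bigr => j _; rewrite mulrBl. Qed.

Lemma taylor0 b n : taylor b n.+1 0 = b 0%N.
Proof. by rewrite taylor_shift mul0r addr0. Qed.

Lemma expr_sub_le x y (r : R) n : rnorm x <= r -> rnorm y <= r ->
  rnorm (x ^+ n.+1 - y ^+ n.+1) <= n.+1%:R * r ^+ n * rnorm (x - y).
Proof.
move=> xr yr; have r0 : 0 <= r by apply: le_trans (rnorm_ge0 x) xr.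
elim: n => [|n IH]; first by rewrite !expr1 expr0 !mul1r.
have -> : x ^+ n.+2 - y ^+ n.+2 = x * (x ^+ n.+1 - y ^+ n.+1) + y ^+ n.+1 * (x - y).
  by rewrite (exprS x) (exprS y n.+1); ring.
apply: le_trans (rnormD _ _) _; rewrite !rnormM rnormX.
have h1 : rnorm x * rnorm (x ^+ n.+1 - y ^+ n.+1) <= r * (n.+1%:R * r ^+ n * rnorm (x - y)).
  by apply: ler_pM; rewrite ?rnorm_ge0.
have h2 : rnorm y ^+ n.+1 * rnorm (x - y) <= r ^+ n.+1 * rnorm (x - y).
  by rewrite ler_wpM2r ?rnorm_ge0 // lerXn2r ?nnegrE ?rnorm_ge0.
have -> : n.+2%:R * r ^+ n.+1 * rnorm (x - y) =
  r * (n.+1%:R * r ^+ n * rnorm (x - y)) + r ^+ n.+1 * rnorm (x - y).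
  by rewrite -(natr1 n.+1) exprS; ring.
exact: lerD.
Qed.

(** What remains of a polynomial after removing its linear part has Lipschitz constant O(r) on the
    ball of radius [r]. This resolves displacements [x - y] far smaller than [x] itself, as for a
    boundary point and the point at small depth below it. *)
Lemma taylor_lipschitz b n : exists2 K : R, 0 <= K & forall x y (r : R), r <= 1 ->
  rnorm x <= r -> rnorm y <= r ->
  rnorm (taylor b n.+2 x - taylor b n.+2 y - b 1%N * (x - y)) <= K * r * rnorm (x - y).
Proof.
elim: n => [|n [K K0 IH]].
  exists 0 => // x y r _ _ _; rewrite !taylorS /taylor !big_ord0 !add0r !expr0 !expr1.
  by rewrite [X in rnorm X](_ : _ = 0) ?rnorm0 ?mul0r //; ring.
exists (K + rnorm (b n.+2) * n.+2%:R); first by rewrite addr_ge0 ?mulr_ge0 ?rnorm_ge0.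
move=> x y r r1 xr yr; have r0 : 0 <= r by apply: le_trans (rnorm_ge0 x) xr.
rewrite (taylorS b n.+2 x) (taylorS b n.+2 y).
have -> : taylor b n.+2 x + b n.+2 * x ^+ n.+2 - (taylor b n.+2 y + b n.+2 * y ^+ n.+2)
    - b 1%N * (x - y) = (taylor b n.+2 x - taylor b n.+2 y - b 1%N * (x - y))
    + b n.+2 * (x ^+ n.+2 - y ^+ n.+2) by ring.
apply: le_trans (rnormD _ _) _; rewrite !mulrDl; apply: lerD; first exact: IH.
rewrite rnormM -!mulrA ler_wpM2l ?rnorm_ge0 //.
apply: le_trans (expr_sub_le _ xr yr) _.
rewrite -!mulrA ler_wpM2l // ler_wpM2r ?rnorm_ge0 //.
by rewrite exprS ler_piMr // exprn_ile1.
Qed.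

Lemma taylor_linear b n : exists2 K : R, 0 <= K & forall x, rnorm x <= 1 ->
  rnorm (taylor b n.+2 x - b 0%N - b 1%N * x) <= K * rnorm x ^+ 2.
Proof.
have [K K0 H] := taylor_lipschitz b n; exists K => // x x1.
have := H x 0 (rnorm x) x1 (lexx _); rewrite rnorm0 rnorm_ge0 taylor0 subr0 => /(_ isT).
by rewrite expr2 mulrA.
Qed.

(** Powers of [x] are split off up to the first nonzero coefficient, which then dominates; its index
    is at most [n] and [x] is small, so the bound by the n-th power follows. *)
Lemma taylor_lower b n : (exists2 j, (j <= n)%N & b j != 0) ->
  exists c d : R, [/\ 0 < c, 0 < d & forall x, rnorm x < d ->
    c * rnorm x ^+ n <= rnorm (taylor b n.+1 x)].
Proof.
elim: n b => [|n IH] b [j jn bj].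
  move: jn bj; rewrite leqn0 => /eqP -> b0; exists (rnorm (b 0%N)), 1; split => //.
    by rewrite rnorm_gt0.
  by move=> x _; rewrite expr0 mulr1 taylor_shift /taylor big_ord0 mulr0 addr0.
have [b0|b0] := eqVneq (b 0%N) 0.
  have [] := IH (fun j => b j.+1).
    case: j jn bj => [|j] jn bj; first by rewrite b0 eqxx in bj.
    by exists j.
  move=> c [d [c0 d0 H]]; exists c, d; split => // x xd.
  rewrite taylor_shift b0 add0r rnormM exprS mulrCA ler_wpM2l ?rnorm_ge0 //.
  exact: H.
have [K K0 HK] := taylor_linear b n.
pose L := K + rnorm (b 1%N) + 1.
have L0 : 0 < L by rewrite ltr_wpDl // addr_ge0 ?rnorm_ge0.
have nb : 0 < rnorm (b 0%N) by rewrite rnorm_gt0.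
exists (rnorm (b 0%N) / 2), (Num.min 1 (rnorm (b 0%N) / (2 * L))); split.
- by rewrite divr_gt0.
- by rewrite lt_min ltr01 divr_gt0 // mulr_gt0.
move=> x; rewrite lt_min => /andP[x1 x2].
have nx := rnorm_ge0 x.
have := HK x (ltW x1); set Tx := taylor _ _ _ => H1.
have := rnorm_lerB (b 0%N) (- (Tx - b 0%N)).
rewrite rnormN opprK [b 0%N + _]addrC subrK => H2.
have := rnormD (Tx - b 0%N - b 1%N * x) (b 1%N * x); rewrite subrK rnormM => H3.
have H4 : K * rnorm x ^+ 2 <= K * rnorm x.
  by rewrite ler_wpM2l // expr2 ler_piMr // ltW.
have H5 : rnorm x * L < rnorm (b 0%N) / 2.
  move: x2; rewrite ltr_pdivlMr ?mulr_gt0 // => x2.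
  by rewrite ltr_pdivlMr //; lra.
have H6 : rnorm (b 0%N) / 2 * rnorm x ^+ n.+1 <= rnorm (b 0%N) / 2.
  by rewrite ler_piMr ?divr_ge0 ?rnorm_ge0 // exprn_ile1 // ltW.
by move: H5; rewrite /L; lra.
Qed.

Section Data.
Variables (phi : C -> C) (zeta : C).
Hypothesis zeta1 : rnorm zeta = 1.

Definition has_data b k := forall e : R, 0 < e -> exists2 d, 0 < d &
  forall z, rnorm z < 1 -> rnorm (z - zeta) < d ->
    rnorm (phi z - taylor b k.+1 (z - zeta)) <= e * rnorm (z - zeta) ^+ k.

Lemma order_data_has_data k (b : k.+1.-tuple C) : order_data phi zeta b <->
  rnorm b`_0 = 1 /\ has_data (fun j => b`_j) k.
Proof.
split=> [[b0 H]|[b0 H]]; split; try exact/norm1E.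
- move=> e e0; have e1 : 0 < realC e by rewrite -realC0 realC_lt.
  have /nbhs_rnormP[d d0 Hd] := H _ e1; exists d => // z z1 zd.
  have := Hd z zd; rewrite /disk /= => /(_ ((diskE z).2 z1)).
  by rewrite !normE -realCX -realCM realC_le.
- move=> e /realC_gt0P[e0 ->]; have [d d0 Hd] := H _ e0.
  apply/nbhs_rnormP; exists d => // z zd /diskE z1.
  by rewrite !normE -realCX -realCM realC_le; exact: Hd.
Qed.

(** The top term joins the error. This gains a full order over the remainder of order [k], and lets
    maps with equal data of order [k] be compared up to O(t ^ (k + 1)). *)
Lemma has_data_big_o b k : has_data b k.+1 -> exists2 K : R, 0 < K & exists2 d, 0 < d &
  forall z, rnorm z < 1 -> rnorm (z - zeta) < d ->
    rnorm (phi z - taylor b k.+1 (z - zeta)) <= K * rnorm (z - zeta) ^+ k.+1.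
Proof.
move=> H; have [d d0 Hd] := H 1 ltr01; exists (1 + rnorm (b k.+1)).
  by rewrite ltr_wpDr ?rnorm_ge0.
exists d => // z z1 zd; have := Hd z z1 zd; rewrite taylorS.
have := rnormD (phi z - (taylor b k.+1 (z - zeta) + b k.+1 * (z - zeta) ^+ k.+1))
   (b k.+1 * (z - zeta) ^+ k.+1).
rewrite opprD addrA subrK rnormM rnormX; lra.
Qed.

Lemma has_dataS b k : has_data b k.+1 -> has_data b k.
Proof.
move=> /has_data_big_o[K K0 [d d0 H]] e e0.
exists (Num.min d (e / K)); first by rewrite lt_min d0 divr_gt0.
move=> z z1; rewrite lt_min => /andP[zd ze]; apply: le_trans (H z z1 zd) _.
rewrite exprS mulrA ler_wpM2r ?exprn_ge0 ?rnorm_ge0 //.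
by move: ze; rewrite ltr_pdivlMr // mulrC => /ltW.
Qed.

Lemma has_data_le b k k' : (k' <= k)%N -> has_data b k -> has_data b k'.
Proof.
elim: k => [|k IH]; first by rewrite leqn0 => /eqP ->.
by rewrite leq_eqVlt => /predU1P[-> //|]; rewrite ltnS => kk /has_dataS/(IH kk).
Qed.

Lemma radial_point (s : R) : 0 < s -> s <= 1 ->
  rnorm (realC (1 - s) * zeta) = 1 - s /\ rnorm (realC (1 - s) * zeta - zeta) = s.
Proof.
move=> s0 s1; split.
  by rewrite rnormM rnorm_realC zeta1 mulr1 ger0_norm // subr_ge0.
have -> : realC (1 - s) * zeta - zeta = realC (- s) * zeta.
  by rewrite realCB realCN realC1; ring.
by rewrite rnormM rnorm_realC zeta1 mulr1 normrN ger0_norm // ltW.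
Qed.

(** On the radius to [zeta], two different polynomials stay at least [c s ^ k] apart at distance
    [s], but both are within [(c / 4) s ^ k] of [phi]. *)
Lemma has_data_unique b b' k : has_data b k -> has_data b' k ->
  forall j, (j <= k)%N -> b j = b' j.
Proof.
move=> H H' j jk; apply: contrapT => /eqP bj.
have [] := @taylor_lower (fun j => b j - b' j) k; first by exists j; rewrite ?subr_eq0.
move=> c [d [c0 d0 Hd]].
have c40 : 0 < c / 4 by rewrite divr_gt0.
have [d1 d10 H1] := H _ c40; have [d2 d20 H2] := H' _ c40.
pose s := Num.min (Num.min 1 d) (Num.min d1 d2) / 2.
have m0 : 0 < Num.min (Num.min 1 d) (Num.min d1 d2) by rewrite !lt_min ltr01 d0 d10.
have s0 : 0 < s by rewrite divr_gt0.
have : s < Num.min (Num.min 1 d) (Num.min d1 d2) by rewrite ltr_pdivrMr // ltr_pMr // ltr1n.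
rewrite !lt_min => /andP[/andP[s1 sd] /andP[sd1 sd2]].
have [z1 z2] := radial_point s0 (ltW s1); move: z1 z2; set z := _ * zeta => z1 z2.
have := H1 z; have := H2 z; have := Hd (z - zeta); rewrite z1 z2 taylorB => h0 h2 h1.
have lt1 : 1 - s < 1 by rewrite ltrBlDr ltrDl.
have {}h1 := h1 lt1 sd1; have {}h2 := h2 lt1 sd2; have {}h0 := h0 sd.
have := rnormB (phi z - taylor b' k.+1 (z - zeta)) (phi z - taylor b k.+1 (z - zeta)).
rewrite [X in rnorm X <= _](_ : _ = taylor b k.+1 (z - zeta) - taylor b' k.+1 (z - zeta)).
  have : 0 < c * s ^+ k by rewrite mulr_gt0 // exprn_gt0.
  lra.
by ring.
Qed.

Lemma nontangential_unique l l' :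
  nontangential_lim phi zeta l -> nontangential_lim phi zeta l' -> l = l'.
Proof.
move=> /nontangentialP H /nontangentialP H'; apply/eqP; rewrite -subr_eq0 -rnorm_eq0.
rewrite eq_le rnorm_ge0 andbT; apply/ler_addgt0Pr => e e0; rewrite add0r.
have e20 : 0 < e / 2 by rewrite divr_gt0.
have two1 : 1 < 2 :> R by rewrite ltr1n.
have [d1 d10 H1] := H 2 _ two1 e20; have [d2 d20 H2] := H' 2 _ two1 e20.
pose s := Num.min 1 (Num.min d1 d2) / 2.
have m0 : 0 < Num.min 1 (Num.min d1 d2) by rewrite !lt_min ltr01 d10.
have s0 : 0 < s by rewrite divr_gt0.
have : s < Num.min 1 (Num.min d1 d2) by rewrite ltr_pdivrMr // ltr_pMr // ltr1n.
rewrite !lt_min => /andP[s1 /andP[sd1 sd2]].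
have [z1 z2] := radial_point s0 (ltW s1); move: z1 z2; set z := _ * zeta => z1 z2.
have := H1 z; have := H2 z; rewrite z1 z2 => h2 h1.
have lt1 : 1 - s < 1 by rewrite ltrBlDr ltrDl.
have lt2 : s < 2 * (1 - (1 - s)) by lra.
have {}h1 := h1 lt1 lt2 sd1; have {}h2 := h2 lt1 lt2 sd2.
have := rnorm_tri l (phi z) l'; rewrite (rnorm_distC l (phi z)); lra.
Qed.

Lemma has_data1_bound b k : has_data b k.+1 -> exists2 K : R, 0 < K & exists2 d, 0 < d &
  forall z, rnorm z < 1 -> rnorm (z - zeta) < d ->
    rnorm (phi z - b 0%N) <= K * rnorm (z - zeta).
Proof.
move=> /(has_data_le (ltn0Sn k))/has_data_big_o[K K0 [d d0 H]].
exists K => //; exists d => // z z1 zd; have := H z z1 zd.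
by rewrite expr1 taylor_shift /taylor big_ord0 mulr0 addr0.
Qed.

Lemma has_data_nontangential b k : has_data b k.+1 -> nontangential_lim phi zeta (b 0%N).
Proof.
move=> /has_data1_bound[K K0 [d d0 H]]; apply/nontangentialP => M e M1 e0.
exists (Num.min d (e / K)); first by rewrite lt_min d0 divr_gt0.
move=> z z1 _; rewrite lt_min => /andP[zd ze]; apply: le_lt_trans (H z z1 zd) _.
by move: ze; rewrite ltr_pdivlMr // mulrC.
Qed.

(* Testing [phi] along [zeta (1 - s (1 + i y))] gives [Re a >= y Im a] for every
   real [y], where [a = conj b_0 b_1 zeta]. *)
Lemma has_data_derivative b : analytic_selfmap phi -> has_data b 1 ->
  rnorm (b 0%N) = 1 -> (b 0%N)^* * b 1%N * zeta = realC (rnorm (b 1%N)) /\ b 1%N != 0.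
Proof.
move=> self H b01; set a := _ * zeta.
have b00 : (b 0%N)^* * b 0%N = 1 by rewrite mulrC -rnorm_sqE b01 expr1n.
have [c c0 Hc] := selfmap_one_sub_ge self.
have test (y e : R) : 0 < e -> exists s : R, [/\ 0 < s, s < e,
    rnorm (zeta - realC s * (1 + Complex 0 y) * zeta) < 1 &
    1 - rnorm (phi (zeta - realC s * (1 + Complex 0 y) * zeta)) <=
    s * (complex.Re a - y * complex.Im a) + s * e].
  move=> e0; pose N : R := 1 + `|y|.
  have N0 : 0 < N by rewrite ltr_wpDr.
  have [d d0 Hd] := H _ (divr_gt0 e0 N0).
  (* [N] bounds the modulus of [1 + i y]: [s < d / N] keeps the point in the range of the expansion,
     [s * N ^+ 2 < 1] keeps it in the disk. *)
  pose m := Num.min e (Num.min (d / N) (N ^+ 2)^-1).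
  have m0 : 0 < m by rewrite !lt_min e0 divr_gt0 // invr_gt0 exprn_gt0.
  pose s := m / 2; have s0 : 0 < s by rewrite divr_gt0.
  have : s < m by rewrite ltr_pdivrMr // ltr_pMr // ltr1n.
  rewrite !lt_min => /andP[se /andP[sd sN]].
  pose x : C := - (realC s * (1 + Complex 0 y) * zeta).
  have nx : rnorm x <= s * N.
    rewrite rnormN !rnormM zeta1 mulr1 rnorm_realC ger0_norm ?(ltW s0) //.
    rewrite ler_pM2l //; apply: le_trans (rnorm_le_ReIm _) _.
    by rewrite /= addr0 add0r normr1.
  have z1 : rnorm (zeta + x) < 1.
    have -> : zeta + x = Complex (1 - s) (- (s * y)) * zeta.
      rewrite -[X in X + _]mul1r /x -mulNr -mulrDl; congr (_ * _).
      by apply/eqP; rewrite eq_complex /=; apply/andP; split; apply/eqP; ring.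
    rewrite rnormM zeta1 mulr1; suff : rnorm (Complex (1 - s) (- (s * y)) : C) ^+ 2 < 1.
      by rewrite expr_lt1 ?rnorm_ge0.
    rewrite rnorm_sq /=.
    have : s * N ^+ 2 < 1 by move: sN; rewrite -div1r ltr_pdivlMr // exprn_gt0.
    have -> : N ^+ 2 = 1 + 2 * `|y| + y ^+ 2.
      by rewrite -[y ^+ 2]real_normK ?num_real // /N; ring.
    have := normr_ge0 y; move: (`|y|) => ay ay0 h; nra.
  have := Hd (zeta + x); rewrite [zeta + x]addrC addrK [x + zeta]addrC => /(_ z1) h.
  have {}h : rnorm (phi (zeta + x) - taylor b 2 x) <= e / N * (s * N).
    have xd : rnorm x < d by apply: le_lt_trans nx _; move: sd; rewrite ltr_pdivlMr.
    apply: le_trans (h xd) _; rewrite expr1 ler_wpM2l // divr_ge0 // ltW //.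
  exists s; split => //.
  have := Re_le_rnorm ((b 0%N)^* * phi (zeta + x)).
  rewrite rnormM rnorm_conj b01 mul1r -/x => h1.
  have h2 : rnorm ((b 0%N)^* * (phi (zeta + x) - taylor b 2 x)) <= s * e.
    rewrite rnormM rnorm_conj b01 mul1r; apply: le_trans h _.
    by rewrite mulrCA mulfVK ?gt_eqF // mulrC.
  have h3 : (b 0%N)^* * taylor b 2 x = 1 - realC s * (1 + Complex 0 y) * a.
    rewrite -[X in _ = X - _]b00 !taylorS /taylor big_ord0 add0r expr0 expr1 /x /a; ring.
  have := normRe_le ((b 0%N)^* * (phi (zeta + x) - taylor b 2 x)).
  move: h2; rewrite mulrBr h3 => h2; rewrite ReB ler_norml => /andP[h4 _].
  have h5 : complex.Re (1 - realC s * (1 + Complex 0 y) * a) =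
     1 - s * (complex.Re a - y * complex.Im a).
    by case: (a) => p q /=; ring.
  rewrite h5 in h4; lra.
have nonneg (y : R) : 0 <= complex.Re a - y * complex.Im a.
  apply/ler_addgt0Pr => e e0; have [s [s0 _ z1 h]] := test y e e0.
  have f1 := selfmap_disk self z1.
  rewrite -(@ler_pM2l _ s) // mulr0 mulrDr; lra.
have Im0 : complex.Im a = 0.
  apply: contrapT => /eqP i0; have := nonneg ((complex.Re a + 1) / complex.Im a).
  by rewrite divfK //; lra.
(* The radial test [y = 0] against [selfmap_one_sub_ge] gives strict positivity, hence
   [b 1 != 0]. *)
have Re0 : c <= complex.Re a.
  apply/ler_addgt0Pr => e e0.
  have e'0 : 0 < Num.min e 1 by rewrite lt_min e0 ltr01.
  have [s [s0 + z1 h]] := test 0 _ e'0; rewrite lt_min => /andP[se s1].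
  move: z1 h.
  have -> : zeta - realC s * (1 + Complex 0 0) * zeta = realC (1 - s) * zeta.
    by rewrite -[Complex 0 0]/(0 : C) addr0 realCB realC1; ring.
  have [-> _] := radial_point s0 (ltW s1).
  move=> z1; have [zz _] := radial_point s0 (ltW s1).
  have := Hc (realC (1 - s) * zeta); rewrite zz => /(_ z1) h1 h2.
  have : s * Num.min e 1 <= s * e by rewrite ler_wpM2l ?(ltW s0) // ge_min lexx.
  by move=> h3; rewrite -(@ler_pM2l _ s) //; lra.
have na : rnorm a = rnorm (b 1%N) by rewrite /a !rnormM rnorm_conj b01 zeta1 mul1r mulr1.
have aE : a = realC (complex.Re a) by move: Im0; case: (a) => p q /= ->.
have aR : rnorm a = complex.Re a.
  by rewrite {1}aE rnorm_realC ger0_norm // (le_trans (ltW c0)).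
rewrite -na aR; split => //.
by rewrite -rnorm_gt0 -na aR (lt_le_trans c0).
Qed.

End Data.
End TaylorData.

(** * Tangential approach *)

Section BoundaryApproach.
Variable R : realType.
Local Notation C := (cplx R).
Implicit Types (b : nat -> C) (z w u v : C).

Section Expansion.
Variables (phi : C -> C) (zeta : C).
Hypothesis zeta1 : rnorm zeta = 1.

(** The data concern points of the disk, whereas contact concerns boundary values. The expansion is
    carried to [v] along the radius ending at [u]; its points are within [2 * T] of [zeta], whence
    the factor [2 ^+ K.+1]. *)
Lemma boundary_value_data b K : has_data phi zeta b K.+1 ->
  forall e : R, 0 < e -> exists2 d, 0 < d & forall u v, rnorm u = 1 ->
    0 < rnorm (u - zeta) -> rnorm (u - zeta) < d -> nontangential_lim phi u v ->
    rnorm (v - taylor b K.+2 (u - zeta)) <= e * rnorm (u - zeta) ^+ K.+1.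
Proof.
move=> H e e0; have p2 : 0 < 2 ^+ K.+1 :> R by rewrite exprn_gt0.
have [d d0 Hd] := H _ (divr_gt0 e0 p2).
have [L L0 HL] := taylor_lipschitz b K.
exists (Num.min (d / 2) 2^-1); first by rewrite lt_min (divr_gt0 d0) ?invr_gt0 ?ltr0n.
move=> u v u1; set T := rnorm (u - zeta) => T0.
rewrite lt_min => /andP[Td T1] /nontangentialP Hv.
apply/ler_addgt0Pr => e' e'0; have e'20 : 0 < e' / 2 by rewrite divr_gt0.
have [d2 d20 Hd2] := Hv 2 _ (ltr1n R 2) e'20.
pose N := L + rnorm (b 1%N) + 1.
have N0 : 0 < N by rewrite ltr_wpDl // addr_ge0 ?rnorm_ge0.
pose m := Num.min (Num.min T d2) (e' / (2 * N)).
have m0 : 0 < m by rewrite !lt_min T0 d20 divr_gt0 // mulr_gt0.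
pose s := m / 2; have s0 : 0 < s by rewrite divr_gt0.
have : s < m by rewrite ltr_pdivrMr // ltr_pMr // ltr1n.
rewrite !lt_min => /andP[/andP[sT sd] se].
have s1 : s <= 1 by lra.
have [z1 z2] := radial_point u1 s0 s1; move: z1 z2; set z := _ * u => z1 z2.
have zl1 : rnorm z < 1 by rewrite z1; lra.
have zT : rnorm (z - zeta) <= 2 * T.
  by apply: le_trans (rnorm_tri z u zeta) _; rewrite z2 -/T; lra.
have h1 : rnorm (phi z - taylor b K.+2 (z - zeta)) <= e * T ^+ K.+1.
  apply: le_trans (Hd z zl1 _) _; first by apply: le_lt_trans zT _; lra.
  rewrite -mulrA ler_pM2l // ler_pdivrMl // -exprMn.
  by rewrite lerXn2r ?nnegrE ?rnorm_ge0 ?mulr_ge0 ?rnorm_ge0.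
have h2 : rnorm (phi z - v) < e' / 2 by apply: Hd2; rewrite ?z1 ?z2 //; lra.
have h3 : rnorm (taylor b K.+2 (z - zeta) - taylor b K.+2 (u - zeta)) <= e' / 2.
  have e1 : z - zeta - (u - zeta) = z - u by ring.
  have := HL (z - zeta) (u - zeta) 1 (lexx _); rewrite e1 z2 mulr1 => h.
  have {}h : rnorm (taylor b K.+2 (z - zeta) - taylor b K.+2 (u - zeta)
      - b 1%N * (z - u)) <= L * s.
    by apply: h; rewrite -/T; lra.
  have := rnormD (taylor b K.+2 (z - zeta) - taylor b K.+2 (u - zeta)
      - b 1%N * (z - u)) (b 1%N * (z - u)).
  rewrite subrK rnormM z2.
  move: se; rewrite ltr_pdivlMr ?mulr_gt0 // /N; lra.
have -> : v - taylor b K.+2 (u - zeta) = (phi z - taylor b K.+2 (z - zeta)) - (phi z - v)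
   + (taylor b K.+2 (z - zeta) - taylor b K.+2 (u - zeta)) by ring.
apply: le_trans (rnormD _ _) _.
have := rnormB (phi z - taylor b K.+2 (z - zeta)) (phi z - v); lra.
Qed.

Lemma boundary_value_linear b K : has_data phi zeta b K.+1 ->
  forall e : R, 0 < e -> exists2 d, 0 < d & forall u v, rnorm u = 1 ->
    0 < rnorm (u - zeta) -> rnorm (u - zeta) < d -> nontangential_lim phi u v ->
    rnorm (v - b 0%N - b 1%N * (u - zeta)) <= e * rnorm (u - zeta).
Proof.
move=> /(has_data_le (ltn0Sn K)) H e e0; have [d d0 Hd] := boundary_value_data H e0.
exists d => // u v u1 T0 Td hv; have := Hd u v u1 T0 Td hv.
by rewrite !taylorS /taylor big_ord0 add0r expr0 !expr1 mulr1 opprD addrA.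
Qed.

(** The expansions at [u] and at [(1 - rho) u] are subtracted. The polynomials differ by
    [- rho b_1 u] up to O(T rho) by [taylor_lipschitz], and the two remainders give the term in
    [T ^+ K.+1]. *)
Lemma radial_expansion b K : has_data phi zeta b K.+1 ->
  forall e : R, 0 < e -> exists2 d, 0 < d & forall u v (rho : R), rnorm u = 1 ->
    0 < rnorm (u - zeta) -> rnorm (u - zeta) < d -> nontangential_lim phi u v ->
    0 < rho -> rho <= rnorm (u - zeta) ->
    rnorm (phi (realC (1 - rho) * u) - v + realC rho * b 1%N * u) <=
      e * (rnorm (u - zeta) ^+ K.+1 + rho).
Proof.
move=> H e e0; have e20 : 0 < e / 2 by rewrite divr_gt0.
have p2 : 0 < 2 ^+ K.+1 :> R by rewrite exprn_gt0.
have [d1 d10 H1] := H _ (divr_gt0 e20 p2).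
have [d2 d20 H2] := boundary_value_data H e20.
have [L L0 HL] := taylor_lipschitz b K.
pose d := Num.min (Num.min (d1 / 2) d2) (Num.min 2^-1 (e / (2 * (L + 1)))).
have L1 : 0 < L + 1 by rewrite ltr_wpDl.
exists d; first by rewrite !lt_min d20 divr_gt0 //= invr_gt0 ltr0n divr_gt0 // mulr_gt0.
move=> u v rho u1; set T := rnorm (u - zeta) => T0.
rewrite !lt_min => /andP[/andP[Td1 Td2] /andP[T1 Te]] hv r0 rT.
have r1 : rho <= 1 by lra.
have [z1 z2] := radial_point u1 r0 r1; move: z1 z2; set z := _ * u => z1 z2.
have zl1 : rnorm z < 1 by rewrite z1; lra.
have zT : rnorm (z - zeta) <= 2 * T.
  by apply: le_trans (rnorm_tri z u zeta) _; rewrite z2 -/T; lra.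
have h1 : rnorm (phi z - taylor b K.+2 (z - zeta)) <= e / 2 * T ^+ K.+1.
  apply: le_trans (H1 z zl1 _) _; first by apply: le_lt_trans zT _; lra.
  rewrite -[e / 2 / _ * _]mulrA ler_pM2l // ler_pdivrMl // -exprMn.
  by rewrite lerXn2r ?nnegrE ?rnorm_ge0 ?mulr_ge0 ?rnorm_ge0.
have h2 := H2 u v u1 T0 Td2 hv; rewrite -/T in h2.
have h3 : rnorm (taylor b K.+2 (z - zeta) - taylor b K.+2 (u - zeta) - b 1%N * (z - u))
    <= e * rho.
  have e1 : z - zeta - (u - zeta) = z - u by ring.
  have := HL (z - zeta) (u - zeta) (2 * T); rewrite e1 z2 => h.
  apply: le_trans (h _ zT _) _; [by lra|by rewrite -/T; lra|].
  rewrite ler_wpM2r ?(ltW r0) //.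
  by move: Te; rewrite ltr_pdivlMr ?mulr_gt0 //; nra.
have -> : phi z - v + realC rho * b 1%N * u = (phi z - taylor b K.+2 (z - zeta))
   - (v - taylor b K.+2 (u - zeta))
   + (taylor b K.+2 (z - zeta) - taylor b K.+2 (u - zeta) - b 1%N * (z - u)).
  by rewrite {5}/z realCB realC1; ring.
apply: le_trans (rnormD _ _) _.
have := rnormB (phi z - taylor b K.+2 (z - zeta)) (v - taylor b K.+2 (u - zeta)).
lra.
Qed.

(* The approach point over [u] is [(1 - rho) u] with [t ^ (p+1) << rho << t ^ p]
   for [t = |u - zeta|]. *)
Definition gap p u : R := rnorm (u - zeta) ^+ p * Num.sqrt (rnorm (u - zeta)).
Definition approach p u : C := realC (1 - gap p u) * u.

(** With rho = T ^ (p + 1/2), both rho / T ^ p and T ^ (p + 1) / rho equal the square root of T;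
    [T < 4^-1] makes this root at most one half. *)
Lemma gap_facts p u : (1 <= p)%N -> 0 < rnorm (u - zeta) -> rnorm (u - zeta) < 4^-1 ->
  [/\ 0 < gap p u, gap p u <= rnorm (u - zeta) / 2
      & rnorm (u - zeta) ^+ p.+1 = gap p u * Num.sqrt (rnorm (u - zeta))].
Proof.
rewrite /gap; move: (rnorm (u - zeta)) => T p1 T0 T4.
have s0 : 0 < Num.sqrt T by rewrite sqrtr_gt0.
have ss : Num.sqrt T ^+ 2 = T by rewrite sqr_sqrtr // ltW.
have s2 : Num.sqrt T <= 2^-1.
  rewrite -(@ler_pXn2r _ 2) ?nnegrE ?(ltW s0) ?invr_ge0 // ss.
  have -> : 2^-1 ^+ 2 = 4^-1 :> R by field.
  exact: ltW.
have T1 : T <= 1 by lra.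
split => //.
- by rewrite mulr_gt0 // exprn_gt0.
- apply: ler_pM; rewrite ?exprn_ge0 ?(ltW T0) ?(ltW s0) //.
  by case: p p1 => // p _; rewrite exprS ler_piMr ?(ltW T0) // exprn_ile1 // ltW.
- by rewrite exprSr -[X in _ * X]ss expr2 mulrA.
Qed.

Lemma approach_facts p u : (1 <= p)%N -> rnorm u = 1 -> 0 < rnorm (u - zeta) ->
  rnorm (u - zeta) < 4^-1 ->
  [/\ rnorm (approach p u) = 1 - gap p u, rnorm (approach p u) < 1,
      rnorm (approach p u - u) = gap p u, rnorm (u - zeta) / 2 <= rnorm (approach p u - zeta) &
      rnorm (approach p u - zeta) <= 2 * rnorm (u - zeta)].
Proof.
move=> p1 u1 T0 T4; have [r0 rT _] := gap_facts p1 T0 T4.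
have r1 : gap p u <= 1 by lra.
have [z1 z2] := radial_point u1 r0 r1; rewrite -/(approach p u) in z1 z2.
split => //; first by rewrite z1; lra.
  have := rnorm_tri u (approach p u) zeta; rewrite (rnorm_distC u (approach p u)) z2; lra.
have := rnorm_tri (approach p u) u zeta; rewrite z2; lra.
Qed.

Hypothesis self : analytic_selfmap phi.

(** With [x - v = - r b_1 u + err], expand [1 - |x|^2] around [v]. Contact makes [1 - |v|^2] O(T ^
    (K + 1)), which is o(r) because [p <= K]; the linear term is [2 r Re (conj v b_1 u)], and by
    [has_data_derivative] that real part tends to [|b_1|]. *)
Lemma high_contact_expansion b K p (B : R) : has_data phi zeta b K.+1 ->
  rnorm (b 0%N) = 1 -> (1 <= p)%N -> (p <= K)%N -> 0 <= B ->
  forall e : R, 0 < e -> exists2 d, 0 < d & forall u v, rnorm u = 1 ->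
    0 < rnorm (u - zeta) -> rnorm (u - zeta) < d -> nontangential_lim phi u v ->
    0 <= 1 - rnorm v ^+ 2 -> 1 - rnorm v ^+ 2 <= B * rnorm (b 0%N - v) ^+ K.+1 ->
    `|1 - rnorm (phi (approach p u)) ^+ 2 - 2 * rnorm (b 1%N) * gap p u| <= e * gap p u.
Proof.
move=> H b01 p1 pK B0 e e0.
have [aE _] := has_data_derivative zeta1 self (has_data_le (ltn0Sn K) H) b01.
pose N := rnorm (b 1%N) + 1.
have N1 : 1 <= N by rewrite lerDr rnorm_ge0.
(* The four error terms amount to 1 + 2 + 4 + 1 multiples of [e1 * r]. *)
have [e1 [e10 e1e e12]] : exists e1 : R, [/\ 0 < e1, 8 * e1 <= e & e1 <= 2^-1].
  exists (Num.min (e / 8) 2^-1); rewrite lt_min divr_gt0 // invr_gt0 ltr0n; split => //.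
    by rewrite mulrC -ler_pdivlMr // ge_min lexx.
  by rewrite ge_min lexx orbT.
have [d1 d10 H1] := radial_expansion H e10.
have [d2 d20 H2] := boundary_value_linear H ltr01.
pose Q := B * N ^+ K.+1 + 1.
have Q0 : 0 < Q by rewrite ltr_wpDl // mulr_ge0 // exprn_ge0 //; lra.
pose d := Num.min (Num.min d1 d2) (Num.min (Num.min 4^-1 (e1 / (2 * N ^+ 2))) ((e1 / Q) ^+ 2)).
have N0 : 0 < N by lra.
have N20 : 0 < N ^+ 2 by rewrite exprn_gt0.
exists d.
  rewrite !lt_min d10 d20 invr_gt0 ltr0n /=; apply/andP; split.
    by rewrite divr_gt0 // mulr_gt0.
  by rewrite exprn_gt0 // divr_gt0.
move=> u v u1 T0; rewrite !lt_min => /andP[/andP[Td1 Td2] /andP[/andP[T4 TN] TQ]] hv v1 vB.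
have [r0 rT rK] := gap_facts p1 T0 T4.
have rTT : gap p u <= rnorm (u - zeta) by lra.
have h1 := H1 u v _ u1 T0 Td1 hv r0 rTT.
have h2 := H2 u v u1 T0 Td2 hv.
rewrite -/(approach p u) in h1.
move: rT rTT rK h1 h2 T0 T4 TN TQ r0; set T := rnorm (u - zeta); set r := gap p u.
set x := phi (approach p u); set q := Num.sqrt T => rT rTT rK h1 h2 T0 T4 TN TQ r0.
have q0 : 0 < q by rewrite sqrtr_gt0.
have q2 : q ^+ 2 = T by rewrite sqr_sqrtr // ltW.
have q1 : q <= 1 by rewrite -(@ler_pXn2r _ 2) ?nnegrE ?(ltW q0) // q2 expr1n; lra.
have qQ : q * Q <= e1.
  rewrite -ler_pdivlMr // -(@ler_pXn2r _ 2) ?nnegrE ?(ltW q0) ?divr_ge0 ?(ltW e10) ?(ltW Q0) //.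
  by rewrite q2 ltW.
have TK : T ^+ K.+1 <= r * q.
  rewrite -rK; apply: ler_wiXn2l; rewrite ?(ltW T0) //; lra.
have rq : r * q <= r by rewrite ler_piMr // ltW.
set err := x - v + _ in h1.
have herr : rnorm err <= 2 * e1 * r.
  apply: le_trans h1 _; have : e1 * T ^+ K.+1 <= e1 * r by rewrite ler_wpM2l ?(ltW e10) //; lra.
  lra.
have hv0 : rnorm (v - b 0%N) <= N * T.
  have := rnormD (v - b 0%N - b 1%N * (u - zeta)) (b 1%N * (u - zeta)).
  by rewrite subrK rnormM -/T /N; lra.
have vle : rnorm v <= 1 by rewrite -(@ler_pXn2r _ 2) ?nnegrE ?rnorm_ge0 // expr1n; lra.
have TN2 : T * (2 * N ^+ 2) <= e1 by rewrite -ler_pdivlMr ?mulr_gt0 // ltW.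
have t1 : 1 - rnorm v ^+ 2 <= e1 * r.
  apply: le_trans vB _; rewrite (rnorm_distC (b 0%N)).
  apply: (@le_trans _ _ (B * (N * T) ^+ K.+1)).
    by rewrite ler_wpM2l // lerXn2r ?nnegrE ?rnorm_ge0 // mulr_ge0 // ltW.
  rewrite exprMn mulrA; apply: (@le_trans _ _ (Q * (r * q))).
    apply: ler_pM => //; rewrite ?exprn_ge0 ?(ltW T0) //; last by rewrite lerDl.
    by rewrite mulr_ge0 // exprn_ge0 // ltW.
  by rewrite mulrCA mulrC ler_wpM2r ?(ltW r0) // mulrC.
have t2 : `|complex.Re (v^* * b 1%N * u) - rnorm (b 1%N)| <= e1.
  have -> : rnorm (b 1%N) = complex.Re ((b 0%N)^* * b 1%N * zeta) by rewrite aE.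
  rewrite -ReB; apply: le_trans (normRe_le _) _.
  have -> : v^* * b 1%N * u - (b 0%N)^* * b 1%N * zeta =
    (v - b 0%N)^* * (b 1%N * u) + (b 0%N)^* * (b 1%N * (u - zeta)).
    by rewrite rmorphB /=; ring.
  apply: le_trans (rnormD _ _) _; rewrite !rnormM !rnorm_conj u1 b01 mul1r mulr1 -/T.
  have bN : rnorm (b 1%N) <= N by rewrite lerDl.
  have : rnorm (v - b 0%N) * rnorm (b 1%N) <= N * T * N.
    by apply: ler_pM; rewrite ?rnorm_ge0.
  have : rnorm (b 1%N) * T <= N * T by rewrite ler_wpM2r // ltW.
  have : N * T <= N * T * N by rewrite ler_peMr // mulr_ge0 // ltW.
  move: TN2; rewrite expr2; lra.
have hD : rnorm (x - v) <= N * r.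
  have := rnormB err (realC r * b 1%N * u); rewrite /err addrK !rnormM u1 mulr1 rnorm_realC.
  rewrite ger0_norm ?(ltW r0) // /N; have : e1 * r <= 2^-1 * r by rewrite ler_wpM2r // ltW.
  move: herr; rewrite /err; lra.
have t3 : rnorm (x - v) ^+ 2 <= e1 * r.
  apply: (@le_trans _ _ ((N * r) ^+ 2)).
    by rewrite lerXn2r ?nnegrE ?rnorm_ge0 // mulr_ge0 // ltW.
  have -> : (N * r) ^+ 2 = N ^+ 2 * r * r by ring.
  rewrite ler_wpM2r ?(ltW r0) //; have : N ^+ 2 * r <= N ^+ 2 * T by rewrite ler_wpM2l // ltW.
  have : 0 <= N ^+ 2 * T by rewrite mulr_ge0 // ltW.
  lra.
have t4 : `|complex.Re (v^* * err)| <= 2 * e1 * r.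
  apply: le_trans (normRe_le _) _; rewrite rnormM rnorm_conj.
  apply: le_trans herr; by rewrite ler_piMl ?rnorm_ge0.
have -> : 1 - rnorm x ^+ 2 - 2 * rnorm (b 1%N) * r = (1 - rnorm v ^+ 2)
   + 2 * r * (complex.Re (v^* * b 1%N * u) - rnorm (b 1%N)) - 2 * complex.Re (v^* * err)
   - rnorm (x - v) ^+ 2.
  rewrite /err; move: (rnorm (b 1%N)) => n1; rewrite !rnorm_sq.
  by case: (x) => ? ?; case: (v) => ? ?; case: (b 1%N) => ? ?; case: (u) => ? ? /=; ring.
have t5 : `|2 * r * (complex.Re (v^* * b 1%N * u) - rnorm (b 1%N))| <= 2 * r * e1.
  have r2 : 0 <= 2 * r by lra.
  by rewrite normrM (ger0_norm r2); exact: ler_wpM2l.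
have er : 8 * e1 * r <= e * r by rewrite ler_wpM2r // ltW.
have er0 : 0 <= e1 * r by rewrite mulr_ge0 // ltW.
have := sqr_ge0 (rnorm (x - v)).
move: t1 t3 t4 t5 er er0 v1; rewrite !ler_norml; lra.
Qed.

(** As [b_1] is nonzero, [|b_0 - v|] is comparable to T, so low contact gives
    [1 - |v|^2 >= A' T ^ (K + 1)]. Since [K < p], this far exceeds the gap and survives the move
    from [v] to the approach point. *)
Lemma low_contact_expansion b K p (A : R) : has_data phi zeta b K.+1 ->
  rnorm (b 0%N) = 1 -> (1 <= p)%N -> (K < p)%N -> 0 < A ->
  forall M : R, 0 < M -> exists2 d, 0 < d & forall u v, rnorm u = 1 ->
    0 < rnorm (u - zeta) -> rnorm (u - zeta) < d -> nontangential_lim phi u v ->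
    A * rnorm (b 0%N - v) ^+ K.+1 <= 1 - rnorm v ^+ 2 ->
    M * gap p u <= 1 - rnorm (phi (approach p u)) ^+ 2.
Proof.
move=> H b01 p1 pK A0 M M0.
have [_ nb1] := has_data_derivative zeta1 self (has_data_le (ltn0Sn K) H) b01.
move: nb1; rewrite -rnorm_gt0 => b10.
pose n := rnorm (b 1%N).
pose A' := A * (n / 2) ^+ K.+1.
have A'0 : 0 < A' by rewrite mulr_gt0 // exprn_gt0 // divr_gt0.
(* The move from [v] to [x] costs at most [4 * rnorm (x - v)]; its part in [T ^+ K.+1] is then a
   quarter of the lower bound, and [Q] below takes care of the part in [r]. *)
have e10 : 0 < A' / 16 by rewrite divr_gt0.
have n20 : 0 < n / 2 by rewrite divr_gt0.
have [d1 d10 H1] := radial_expansion H e10.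
have [d2 d20 H2] := boundary_value_linear H n20.
pose Q := 16 * (n + A' / 16) + 2 * M.
have Q0 : 0 < Q by rewrite addr_gt0 ?mulr_gt0 // addr_gt0.
pose d := Num.min (Num.min d1 d2) (Num.min 4^-1 ((A' / Q) ^+ 2)).
exists d.
  by rewrite !lt_min d10 d20 invr_gt0 ltr0n /= exprn_gt0 // divr_gt0.
move=> u v u1 T0; rewrite !lt_min => /andP[/andP[Td1 Td2] /andP[T4 TQ]] hv vA.
have [r0 rT _] := gap_facts p1 T0 T4.
have rK : gap p u <= rnorm (u - zeta) ^+ p * Num.sqrt (rnorm (u - zeta)) by [].
have rTT : gap p u <= rnorm (u - zeta) by lra.
have h1 := H1 u v _ u1 T0 Td1 hv r0 rTT.
have h2 := H2 u v u1 T0 Td2 hv.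
have [_ w1 _ _ _] := approach_facts p1 u1 T0 T4.
have f1 := selfmap_disk self w1.
rewrite -/(approach p u) in h1.
move: rT rTT rK h1 h2 T0 T4 TQ r0 f1; set T := rnorm (u - zeta); set r := gap p u.
set x := phi (approach p u); set q := Num.sqrt T => rT rTT rK h1 h2 T0 T4 TQ r0 f1.
have q0 : 0 < q by rewrite sqrtr_gt0.
have q2 : q ^+ 2 = T by rewrite sqr_sqrtr // ltW.
have qQ : q * Q <= A'.
  rewrite -ler_pdivlMr // -(@ler_pXn2r _ 2) ?nnegrE ?(ltW q0) ?divr_ge0 ?(ltW A'0) ?(ltW Q0) //.
  by rewrite q2 ltW.
have TK0 : 0 < T ^+ K.+1 by rewrite exprn_gt0.
have rq : r <= T ^+ K.+1 * q.
  apply: le_trans rK _; rewrite ler_wpM2r ?(ltW q0) //; apply: ler_wiXn2l; rewrite ?(ltW T0) //.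
  lra.
have hv0 : n / 2 * T <= rnorm (b 0%N - v).
  have := rnormB (v - b 0%N - b 1%N * (u - zeta)) (v - b 0%N).
  rewrite [X in rnorm X <= _](_ : _ = - (b 1%N * (u - zeta))); last by ring.
  by rewrite rnormN rnormM -/T -/n (rnorm_distC (b 0%N)); lra.
have hv1 : A' * T ^+ K.+1 <= 1 - rnorm v ^+ 2.
  apply: le_trans vA; rewrite /A' -mulrA -exprMn ler_pM2l // lerXn2r ?nnegrE ?rnorm_ge0 //.
  by rewrite mulr_ge0 // ltW.
have vle : rnorm v <= 1.
  rewrite -(@ler_pXn2r _ 2) ?nnegrE ?rnorm_ge0 // expr1n.
  have : 0 <= A' * T ^+ K.+1 by rewrite mulr_ge0 // ltW.
  lra.
have hD : rnorm (x - v) <= (n + A' / 16) * r + A' / 16 * T ^+ K.+1.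
  have := rnormB (x - v + realC r * b 1%N * u) (realC r * b 1%N * u).
  rewrite addrK !rnormM u1 mulr1 rnorm_realC ger0_norm ?(ltW r0) // -/n; lra.
have hx : rnorm x <= rnorm v + rnorm (x - v).
  by have := rnormD v (x - v); rewrite addrC subrK.
have hx2 : rnorm x ^+ 2 <= rnorm v ^+ 2 + 4 * rnorm (x - v).
  have := rnorm_ge0 x; have := rnorm_ge0 v; have := rnorm_ge0 (x - v); nra.
have rT2 : r * Q <= A' * T ^+ K.+1.
  apply: (@le_trans _ _ (T ^+ K.+1 * q * Q)); first by rewrite ler_wpM2r // ltW.
  by rewrite -mulrA mulrC ler_wpM2r // ltW.
have p1r : 0 <= (n + A' / 16) * r by rewrite mulr_ge0 ?(ltW r0) // addr_ge0 // ltW.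
have p2r : 0 <= M * r by rewrite mulr_ge0 // ltW.
move: rT2; rewrite /Q; lra.
Qed.

End Expansion.

(** * The unit circle up to null sets *)

Lemma expi_surj z : rnorm z = 1 -> exists t, z = expi t.
Proof.
move=> z1; have := rnorm_sq z; rewrite z1 expr1n; case: z {z1} => x y /= xy.
have x1 : -1 <= x <= 1 by rewrite -ler_norml -(@ler_pXn2r _ 2) ?nnegrE // expr1n
  real_normK ?num_real //; have := sqr_ge0 y; lra.
have sE : Num.sqrt (1 - x ^+ 2) = `|y| by rewrite xy [x ^+ 2 + _]addrC addrK sqrtr_sqr.
have [y0|y0] := leP 0 y.
  by exists (acos x); rewrite /expi acosK // sin_acos // sE ger0_norm.
by exists (- acos x); rewrite /expi cosN sinN acosK // sin_acos // sE ltr0_norm // opprK.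
Qed.

Lemma expi_continuous (t e : R) : 0 < e -> exists2 d, 0 < d &
  forall s, `|s - t| < d -> rnorm (expi s - expi t) < e.
Proof.
move=> e0; have e20 : 0 < e / 2 by rewrite divr_gt0.
have /cvgrPdist_lt/(_ _ e20)/nbhs_normP[d1 /= d10 H1] := @continuous_cos R t.
have /cvgrPdist_lt/(_ _ e20)/nbhs_normP[d2 /= d20 H2] := @continuous_sin R t.
exists (Num.min d1 d2); first by rewrite lt_min d10 d20.
move=> s; rewrite lt_min => /andP[s1 s2].
apply: le_lt_trans (rnorm_le_ReIm _) _ => /=.
have h1 : `|cos t - cos s| < e / 2 by apply: H1; rewrite /= distrC.
have h2 : `|sin t - sin s| < e / 2 by apply: H2; rewrite /= distrC.
by rewrite distrC [X in _ + X]distrC; lra.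
Qed.

Lemma ae_dense (P : R -> Prop) (t d : R) : 0 < d ->
  {ae (@lebesgue_measure R), forall s, P s} -> exists2 s, `|s - t| < d & P s.
Proof.
move=> d0 [A [mA A0 PA]]; apply: contrapT => H.
have sub : `]t - d, t + d[ `<=` A.
  move=> s /=; rewrite in_itv /= => /andP[s1 s2]; apply: PA => Ps; apply: H; exists s => //.
  by rewrite ltr_norml; lra.
pose I : set R := `]t - d, t + d[%classic.
have : (lebesgue_measure I <= lebesgue_measure A)%E.
  apply: le_measure.
  - by rewrite inE; exact: measurable_itv.
  - by rewrite inE; exact: mA.
  - exact: sub.
rewrite A0 /I lebesgue_measure_itv /= lte_fin.
have -> : t - d < t + d by lra.
by rewrite -EFinB lee_fin; lra.
Qed.

(* Almost every point of the unit circle close enough to [zeta]. *)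
Definition circle_near (zeta : C) : set_system R := [set P | exists2 d : R, 0 < d &
  {ae (@lebesgue_measure R), forall t, rnorm (expi t - zeta) < d -> P t}].

Global Instance circle_near_filter zeta : Filter (circle_near zeta).
Proof.
split.
- by exists 1 => //; exact: aeW.
- move=> P Q [d1 d10 H1] [d2 d20 H2]; exists (Num.min d1 d2); first by rewrite lt_min d10.
  have AE := ae_filter_ringOfSetsType (@lebesgue_measure R).
  apply: (@filterS2 _ _ AE _ _ _ _ H1 H2) => t h1 h2; rewrite lt_min => /andP[t1 t2].
  by split; [exact: h1|exact: h2].
- move=> P Q PQ [d d0 H]; exists d => //.
  have AE := ae_filter_ringOfSetsType (@lebesgue_measure R).
  by apply: (@filterS _ _ AE _ _ _ H) => t h td; exact/PQ/h.
Qed.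

(** The filter is proper, because a null set contains no interval; one point for each tolerance is
    all that the approach sequence takes. *)
Lemma circle_near_ex zeta (P : set R) : rnorm zeta = 1 -> circle_near zeta P -> exists t, P t.
Proof.
move=> /expi_surj[t0 ->] [d d0 H]; have [d1 d10 H1] := expi_continuous t0 d0.
by have [t t1 t2] := ae_dense t0 d10 H; exists t; exact/t2/H1.
Qed.

Lemma circle_near_dist zeta (P : C -> Prop) (d : R) : 0 < d ->
  (forall u, rnorm u = 1 -> rnorm (u - zeta) < d -> P u) ->
  \forall t \near circle_near zeta, P (expi t).
Proof. by move=> d0 H; exists d => //; apply: aeW => t td; apply: H; rewrite ?rnorm_expi. Qed.

End BoundaryApproach.

(** * Contact and data *)

Section Contact.
Variable R : realType.
Local Notation C := (cplx R).
Variables (phi : C -> C) (zeta : C).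
Hypothesis zeta1 : rnorm zeta = 1.
Hypothesis self : analytic_selfmap phi.
Implicit Types (b : nat -> C).

(** Contact restated with the coefficients of the data: the boundary value at [zeta] is [b 0], and
    almost every boundary value nearby differs from it, so the denominators may be cleared. *)
Lemma contact_near b K (c : R) : has_data phi zeta b K.+1 ->
  order_of_contact phi zeta c -> exists A B : R, [/\ 0 < A, 0 < B &
  \forall t \near circle_near zeta, 0 < rnorm (expi t - zeta) /\
    exists v, [/\ nontangential_lim phi (expi t) v, v != b 0%N,
      A * rnorm (b 0%N - v) `^ c <= 1 - rnorm v ^+ 2 &
      1 - rnorm v ^+ 2 <= B * rnorm (b 0%N - v) `^ c]].
Proof.
move=> H [c0 [w0 [hw0 _ [A [B [d [A0 d0 ae]]]]]]].
have w0E : w0 = b 0%N.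
  by apply: (nontangential_unique zeta1 hw0); exact: (@has_data_nontangential _ _ _ _ _ H).
exists A, (`|B| + 1); split; [by []|by rewrite ltr_wpDl|].
exists d => //.
have AE := ae_filter_ringOfSetsType (@lebesgue_measure R).
apply: (@filterS _ _ AE _ _ _ ae) => t ht td; have [v hv /andP[vA vB]] := ht td.
(* At [v = w0] the quotient is a division by zero, of value 0, which the positive lower bound [A]
   excludes. *)
have vw : v != w0.
  apply/eqP => vw; move: vA; rewrite vw subrr rnorm0 powR0 ?gt_eqF // invr0 mulr0.
  by rewrite leNgt A0.
have pos : 0 < rnorm (w0 - v) `^ c by rewrite powR_gt0 // rnorm_gt0 subr_eq0 eq_sym.
split.
  rewrite rnorm_gt0 subr_eq0; apply/eqP => tz; move/eqP: vw; apply.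
  by rewrite tz in hv; exact: (nontangential_unique zeta1 hv hw0).
exists v; rewrite -w0E; split => //; first by rewrite -ler_pdivlMr.
rewrite -ler_pdivrMr //; apply: le_trans vB _.
by rewrite (le_trans (ler_norm _)) // lerDl.
Qed.

(** At a common boundary point both bounds hold with [y = |b_0 - v|]; for [c > c'] they force
    [y ^ (c - c') >= A / B], although [y] tends to 0. Exchanging the roles gives uniqueness of the
    order. *)
Lemma contact_order_le b K (c c' : R) : has_data phi zeta b K.+1 ->
  order_of_contact phi zeta c -> order_of_contact phi zeta c' -> c <= c'.
Proof.
move=> H hc hc'; rewrite leNgt; apply/negP => cc.
have [A1 [B [_ B0 HB]]] := contact_near H hc.
have [A [B1 [A0 _ HA]]] := contact_near H hc'.
have cc0 : 0 < c - c' by rewrite subr_gt0.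
have AB0 : 0 < A / B by rewrite divr_gt0.
have [d d0 Hd] : exists2 d : R, 0 < d & forall y, 0 < y -> y < d -> y `^ (c - c') < A / B.
  have /cvgrPdist_lt/(_ _ AB0) := powR_cvg0 cc0.
  move=> /nbhs_normP[d /= d0 Hd]; exists d => // y y0 yd.
  have := Hd y; rewrite /= !sub0r !normrN gtr0_norm // => /(_ yd y0).
  by rewrite ger0_norm // powR_ge0.
have [d1 d10 H1] := boundary_value_linear H ltr01.
pose N := rnorm (b 1%N) + 1; have N0 : 0 < N by rewrite ltr_wpDl ?rnorm_ge0.
have small : \forall t \near circle_near zeta, rnorm (expi t - zeta) < Num.min d1 (d / N).
  by apply: (@circle_near_dist _ _ (fun u => rnorm (u - zeta) < Num.min d1 (d / N))
      (Num.min d1 (d / N))) => //; rewrite lt_min d10 divr_gt0.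
have [t [[[T0 [v [hv vb _ vB]]] [_ [v' [hv' _ vA _]]]]]] :=
  circle_near_ex zeta1 (filterI (filterI HB HA) small).
rewrite /= lt_min => /andP[Td1 TdN].
have vv : v' = v := nontangential_unique (rnorm_expi t) hv' hv.
rewrite vv in vA.
have y0 : 0 < rnorm (b 0%N - v) by rewrite rnorm_gt0 subr_eq0 eq_sym.
have yd : rnorm (b 0%N - v) < d.
  have := H1 _ _ (rnorm_expi t) T0 Td1 hv.
  have := rnormD (v - b 0%N - b 1%N * (expi t - zeta)) (b 1%N * (expi t - zeta)).
  rewrite subrK rnormM (rnorm_distC (b 0%N)).
  by move: TdN; rewrite ltr_pdivlMr // /N; lra.
have := Hd _ y0 yd; have := le_trans vA vB.
have -> : c = c' + (c - c') by ring.
rewrite powRD; last by apply/implyP => _; rewrite gt_eqF.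
have p0 : 0 < rnorm (b 0%N - v) `^ c' by rewrite powR_gt0.
rewrite mulrCA mulrC ler_pM2l // [c' + _]addrC addrK => h1.
by rewrite ltr_pdivlMr // mulrC ltNge h1.
Qed.

(** [data_vector] selects coefficients by choice; uniqueness of the data identifies them with [b],
    which may come from an expansion of higher order. *)
Lemma data_vectorE b p : has_data phi zeta b p -> rnorm (b 0%N) = 1 ->
  forall j : 'I_p.+1, tnth (data_vector p phi zeta) j = (j`!)%:R * b j.
Proof.
move=> H b01 j; rewrite /data_vector.
set S := [set b0 | _]; have S1 : S !=set0.
  exists [tuple b j | j < p.+1]; apply/order_data_has_data; split.
    by rewrite -(tnth_nth 0 _ ord0) tnth_mktuple.
  move=> e e0; have [d d0 Hd] := H e e0; exists d => // z z1 zd.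
  rewrite [taylor _ _ _](_ : _ = taylor b p.+1 (z - zeta)); first exact: Hd.
  by apply: eq_bigr => i _; rewrite -(tnth_nth 0 _ i) tnth_mktuple.
rewrite tnth_mktuple; have := xgetPex [tuple of nseq p.+1 0] S1.
set b' := xget _ _ => /order_data_has_data[_ H'].
rewrite (tnth_nth 0); congr (_ * _); symmetry.
by apply: (has_data_unique zeta1 H H'); rewrite -ltnS.
Qed.

Hypothesis data : angular_set phi zeta -> sufficient_data phi zeta.
Variable p : nat.
Hypothesis p1 : (1 <= p)%N.

(** Membership in [contact_index] at [p.+1], for a single map. *)
Definition in_contact := angular_set phi zeta /\
  exists2 c : R, p.+1%:R <= c & order_of_contact phi zeta c.

Lemma sufficient_has_data : angular_set phi zeta -> exists K b,
  [/\ order_of_contact phi zeta K.+1%:R, has_data phi zeta b K.+1 & rnorm (b 0%N) = 1].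
Proof.
move=> /data[_ [m [m1 hm [b /order_data_has_data[b0 hb]]]]].
exists (2 * m).-1, (fun j => b`_j); rewrite prednK ?muln_gt0 //.
Qed.

Lemma contact_approach : in_contact -> exists b,
  [/\ has_data phi zeta b p.+1, rnorm (b 0%N) = 1, b 1%N != 0 & forall e : R, 0 < e ->
    \forall t \near circle_near zeta,
    `|1 - rnorm (phi (approach zeta p (expi t))) ^+ 2 -
       2 * rnorm (b 1%N) * gap zeta p (expi t)| <= e * gap zeta p (expi t)].
Proof.
move=> [ang [c kc hc]]; have [K [b [hK hb b0]]] := sufficient_has_data ang.
(* The order [c] from [in_contact] and the order [K.+1] from the data agree by
   [contact_order_le]. *)
have pK : (p <= K)%N.
  by rewrite -ltnS -(ler_nat R) (le_trans kc) // (contact_order_le hb).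
exists b; split => //; first by apply: has_data_le hb; rewrite ltnS.
  by have [] := has_data_derivative zeta1 self (has_data_le (ltn0Sn K) hb) b0.
move=> e e0; have [A [B [A0 B0 HA]]] := contact_near hb hK.
have [d d0 Hd] := high_contact_expansion zeta1 self hb b0 p1 pK (ltW B0) e0.
have small : \forall t \near circle_near zeta, rnorm (expi t - zeta) < d.
  exact: (@circle_near_dist _ _ (fun u => rnorm (u - zeta) < d) d).
apply: filterS2 HA small => t [T0 [v [hv _ vA vB]]] Td.
rewrite !powR_mulrn ?rnorm_ge0 // in vA vB.
apply: (Hd _ v (rnorm_expi t)) => //.
by apply: le_trans vA; rewrite mulr_ge0 ?exprn_ge0 ?rnorm_ge0 // ltW.
Qed.

(** Contact fails for one of two reasons: the angular derivative exists but the order is at most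
    [p], where the boundary term dominates, or there is no angular derivative, where
    Julia-Caratheodory is used at the approach point itself. *)
Lemma noncontact_approach (M : R) : ~ in_contact -> 0 < M ->
  \forall t \near circle_near zeta, 0 < rnorm (expi t - zeta) ->
    M * gap zeta p (expi t) <= 1 - rnorm (phi (approach zeta p (expi t))) ^+ 2.
Proof.
move=> nc M0; have [ang|nang] := pselect (angular_set phi zeta).
  have [K [b [hK hb b0]]] := sufficient_has_data ang.
  have Kp : (K < p)%N.
    rewrite ltnNge; apply/negP => pK; apply: nc; split => //; exists K.+1%:R => //.
    by rewrite ler_nat ltnS.
  have [A [B [A0 B0 HA]]] := contact_near hb hK.
  have [d d0 Hd] := low_contact_expansion zeta1 self hb b0 p1 Kp A0 M0.
  have small : \forall t \near circle_near zeta, rnorm (expi t - zeta) < d.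
    exact: (@circle_near_dist _ _ (fun u => rnorm (u - zeta) < d) d).
  apply: filterS2 HA small => t [T0 [v [hv _ vA vB]]] Td _.
  rewrite !powR_mulrn ?rnorm_ge0 // in vA vB.
  exact: (Hd _ v (rnorm_expi t)).
have [d d0 Hd] := julia_caratheodory self zeta1 nang M.
apply: (@circle_near_dist _ zeta (fun u => 0 < rnorm (u - zeta) ->
  M * gap zeta p u <= 1 - rnorm (phi (approach zeta p u)) ^+ 2) (Num.min 4^-1 (d / 2))).
  by rewrite lt_min invr_gt0 ltr0n divr_gt0.
move=> u u1; rewrite lt_min => /andP[T4 Td] T0.
have [w1 w2 _ _ w5] := approach_facts p1 u1 T0 T4.
have wd : rnorm (approach zeta p u - zeta) < d by apply: le_lt_trans w5 _; lra.
have := Hd _ w2 wd; rewrite w1.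
have := selfmap_disk self w2; have := rnorm_ge0 (phi (approach zeta p u)).
by nra.
Qed.

End Contact.

(** * Several maps at a common approach point *)

Section Family.
Variable R : realType.
Local Notation C := (cplx R).
Variables (zeta : C) (p : nat).
Hypothesis zeta1 : rnorm zeta = 1.
Hypothesis p1 : (1 <= p)%N.
Implicit Types (b : nat -> C) (f g : C -> C).

(** The polynomials of degree [p] cancel, and by [has_data_big_o] the remainders are O(T ^ (p + 1)),
    that is, the gap times O(sqrt T). *)
Lemma same_data_approach f g b b' : has_data f zeta b p.+1 -> has_data g zeta b' p.+1 ->
  (forall j, (j <= p)%N -> b j = b' j) -> forall e : R, 0 < e ->
  \forall t \near circle_near zeta, 0 < rnorm (expi t - zeta) ->
    rnorm (f (approach zeta p (expi t)) - g (approach zeta p (expi t)))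
      <= e * gap zeta p (expi t).
Proof.
move=> /has_data_big_o[K K0 [d d0 Hd]] /has_data_big_o[K' K'0 [d' d'0 Hd']] bb e e0.
pose Q := (K + K') * 2 ^+ p.+1.
have Q0 : 0 < Q by apply: mulr_gt0; [rewrite addr_gt0|rewrite exprn_gt0].
apply: (@circle_near_dist _ zeta (fun u => 0 < rnorm (u - zeta) ->
  rnorm (f (approach zeta p u) - g (approach zeta p u)) <= e * gap zeta p u)
  (Num.min (Num.min 4^-1 ((e / Q) ^+ 2)) (Num.min (d / 2) (d' / 2)))).
  by rewrite !lt_min invr_gt0 ltr0n exprn_gt0 ?divr_gt0.
move=> u u1; rewrite !lt_min => /andP[/andP[T4 TQ] /andP[Td Td']] T0.
have [r0 _ rK] := gap_facts p1 T0 T4.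
have [_ w1 _ _ w5] := approach_facts p1 u1 T0 T4.
set w := approach zeta p u in w1 w5 *.
have td : 2 * rnorm (u - zeta) < d by lra.
have td' : 2 * rnorm (u - zeta) < d' by lra.
have h1 := Hd w w1 (le_lt_trans w5 td); have h2 := Hd' w w1 (le_lt_trans w5 td').
have tE : taylor b p.+1 (w - zeta) = taylor b' p.+1 (w - zeta).
  by apply: eq_bigr => j _; rewrite bb // -ltnS.
have -> : f w - g w = (f w - taylor b p.+1 (w - zeta)) - (g w - taylor b' p.+1 (w - zeta)).
  by rewrite tE; ring.
apply: le_trans (rnormB _ _) _; apply: le_trans (lerD h1 h2) _.
rewrite -mulrDl; set T := rnorm (u - zeta) in T0 T4 TQ rK w5 *.
apply: (@le_trans _ _ ((K + K') * (2 * T) ^+ p.+1)).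
  by rewrite ler_wpM2l ?addr_ge0 ?(ltW K0) ?(ltW K'0) // lerXn2r ?nnegrE ?rnorm_ge0 // mulr_ge0 // ltW.
rewrite exprMn mulrA -/Q rK mulrCA mulrC ler_wpM2r ?(ltW r0) //.
rewrite mulrC -ler_pdivlMr // -(@ler_pXn2r _ 2) ?nnegrE ?sqrtr_ge0 ?divr_ge0 ?(ltW e0) ?(ltW Q0) //.
by rewrite sqr_sqrtr ?(ltW T0) // ltW.
Qed.

(** By [taylor_lower] the polynomials differ by at least a multiple of T ^ p, which exceeds the gap
    by the factor 1 / sqrt T. *)
Lemma distinct_data_approach f g b b' : has_data f zeta b p -> has_data g zeta b' p ->
  (exists2 j, (j <= p)%N & b j != b' j) -> forall M : R, 0 < M ->
  \forall t \near circle_near zeta, 0 < rnorm (expi t - zeta) ->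
    M * gap zeta p (expi t) <=
    rnorm (f (approach zeta p (expi t)) - g (approach zeta p (expi t))).
Proof.
move=> H H' [j jp bb] M M0.
have [] := @taylor_lower _ (fun j => b j - b' j) p; first by exists j; rewrite ?subr_eq0.
move=> c [d0 [c0 d00 Hd0]]; have c40 : 0 < c / 4 by rewrite divr_gt0.
have [d1 d10 H1] := H _ c40; have [d2 d20 H2] := H' _ c40.
pose Q := M * 2 * 2 ^+ p / c.
have P20 : 0 < 2 ^+ p :> R by rewrite exprn_gt0.
have Q0 : 0 < Q by rewrite divr_gt0 // !mulr_gt0.
apply: (@circle_near_dist _ zeta (fun u => 0 < rnorm (u - zeta) ->
  M * gap zeta p u <= rnorm (f (approach zeta p u) - g (approach zeta p u)))
  (Num.min (Num.min 4^-1 (Q^-1 ^+ 2)) (Num.min (d0 / 2) (Num.min (d1 / 2) (d2 / 2))))).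
  by rewrite !lt_min invr_gt0 ltr0n exprn_gt0 ?invr_gt0 // !divr_gt0.
move=> u u1; rewrite !lt_min => /andP[/andP[T4 TQ] /andP[Td0 /andP[Td1 Td2]]] T0.
have [r0 _ _] := gap_facts p1 T0 T4.
have [_ w1 _ w4 w5] := approach_facts p1 u1 T0 T4.
set w := approach zeta p u in w1 w4 w5 *.
have td0 : 2 * rnorm (u - zeta) < d0 by lra.
have td1 : 2 * rnorm (u - zeta) < d1 by lra.
have td2 : 2 * rnorm (u - zeta) < d2 by lra.
have h0 := Hd0 (w - zeta) (le_lt_trans w5 td0).
have h1 := H1 w w1 (le_lt_trans w5 td1).
have h2 := H2 w w1 (le_lt_trans w5 td2).
rewrite taylorB in h0.
have h3 : c / 2 * rnorm (w - zeta) ^+ p <= rnorm (f w - g w).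
  have := rnormD (f w - g w) ((g w - taylor b' p.+1 (w - zeta)) - (f w - taylor b p.+1 (w - zeta))).
  have := rnormB (g w - taylor b' p.+1 (w - zeta)) (f w - taylor b p.+1 (w - zeta)).
  rewrite [X in _ -> rnorm X <= _ -> _](_ : _ = taylor b p.+1 (w - zeta) - taylor b' p.+1 (w - zeta)).
    by lra.
  by ring.
apply: le_trans h3; set T := rnorm (u - zeta) in T0 T4 TQ w4 w5 *.
have h4 : (T / 2) ^+ p <= rnorm (w - zeta) ^+ p.
  by rewrite lerXn2r ?nnegrE ?rnorm_ge0 // divr_ge0 // ltW.
have c20 : 0 <= c / 2 by rewrite divr_ge0 // ltW.
apply: le_trans (ler_wpM2l c20 h4).
rewrite /gap -/T exprMn exprVn.
have q0 : 0 <= Num.sqrt T := sqrtr_ge0 T.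
have qQ : Num.sqrt T * Q <= 1.
  rewrite -ler_pdivlMr // div1r -(@ler_pXn2r _ 2) ?nnegrE ?invr_ge0 ?(ltW Q0) //.
  by rewrite sqr_sqrtr ?(ltW T0) // ltW.
have -> : M * (T ^+ p * Num.sqrt T) = c / 2 * (T ^+ p / 2 ^+ p) * (Num.sqrt T * Q).
  by rewrite /Q; field; rewrite !gt_eqF.
by rewrite ler_piMr // mulr_ge0 // divr_ge0 ?(ltW P20) // exprn_ge0 // ltW.
Qed.

Variables (n : nat) (phi : 'I_n -> C -> C).
Hypothesis self : forall j, analytic_selfmap (phi j).
Hypothesis data : forall j, angular_set (phi j) zeta -> sufficient_data (phi j) zeta.
Hypothesis ang : exists j, angular_set (phi j) zeta.

(** Finitely many maps and pairs give finitely many conditions that hold at almost every point near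
    [zeta], so one point meets them all. The coefficients [b j] are a dummy 0 for maps out of
    contact. *)
Theorem approach_asymptotics : exists b : 'I_n -> nat -> C,
  (forall j, contact_index phi zeta p.+1 j -> b j 1%N != 0 /\
     forall i : 'I_p.+1, tnth (data_vector p (phi j) zeta) i = (i`!)%:R * b j i) /\
  forall e : R, 0 < e -> exists w, [/\ rnorm w < 1, rnorm (w - zeta) < e,
    forall i j, contact_index phi zeta p.+1 i -> contact_index phi zeta p.+1 j ->
      data_vector p (phi i) zeta = data_vector p (phi j) zeta ->
      rnorm (1 - (phi i w)^* * phi j w - realC (rnorm (b i 1%N) * (1 - rnorm w ^+ 2)))
        <= e * (1 - rnorm w ^+ 2),
    forall i j, contact_index phi zeta p.+1 i -> contact_index phi zeta p.+1 j ->
      data_vector p (phi i) zeta <> data_vector p (phi j) zeta ->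
      1 - rnorm w ^+ 2 <= e * rnorm (1 - (phi i w)^* * phi j w) &
    forall j, ~ contact_index phi zeta p.+1 j ->
      1 - rnorm w ^+ 2 <= e * (1 - rnorm (phi j w) ^+ 2)].
Proof.
have /choice[b Hb] : forall j, exists b, contact_index phi zeta p.+1 j ->
  [/\ has_data (phi j) zeta b p.+1, rnorm (b 0%N) = 1, b 1%N != 0 & forall e : R, 0 < e ->
    \forall t \near circle_near zeta,
    `|1 - rnorm (phi j (approach zeta p (expi t))) ^+ 2 -
       2 * rnorm (b 1%N) * gap zeta p (expi t)| <= e * gap zeta p (expi t)].
  move=> j; have [cj|ncj] := pselect (contact_index phi zeta p.+1 j).
    have [b Hb] := contact_approach zeta1 (self j) (@data j) p1 cj; by exists b.
  by exists (fun=> 0).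
have dE j : contact_index phi zeta p.+1 j ->
    forall i : 'I_p.+1, tnth (data_vector p (phi j) zeta) i = (i`!)%:R * b j i.
  move=> /Hb[h1 h2 _ _] i; apply: data_vectorE => //.
  exact: has_data_le h1.
have same i j : contact_index phi zeta p.+1 i -> contact_index phi zeta p.+1 j ->
    data_vector p (phi i) zeta = data_vector p (phi j) zeta <->
    forall l, (l <= p)%N -> b i l = b j l.
  move=> ci cj; split=> [dd l|bb].
    rewrite -ltnS => lp; have := dE i ci (Ordinal lp); rewrite dd dE //= => bb.
    have l0 : (l`!)%:R != 0 :> C by rewrite pnatr_eq0 -lt0n fact_gt0.
    by apply/esym/(mulfI l0).
  by apply: eq_from_tnth => l; rewrite !dE // bb // -ltnS.
exists b; split; first by move=> j cj; have [_ _ ? _] := Hb j cj; split => //; exact: dE.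
move=> e e0.
pose N := \sum_j rnorm (b j 1%N) + 1.
have N0 : 0 < N by rewrite ltr_wpDl // sumr_ge0 // => j _; exact: rnorm_ge0.
have bN j : rnorm (b j 1%N) <= N.
  rewrite /N (bigD1 j) //= -addrA lerDl addr_ge0 // sumr_ge0 // => i _; exact: rnorm_ge0.
have e40 : 0 < e / 4 by rewrite divr_gt0.
(* [1 - rnorm w ^+ 2] is at most twice the gap, so quantities of at least [2 / e] gaps are what the
   last two estimates take. *)
have M0 : 0 < 2 / e by rewrite divr_gt0.
have [j0 aj0] := ang.
(* A map with an angular derivative at [zeta] provides this through [contact_near]. *)
have T_pos : \forall t \near circle_near zeta, 0 < rnorm (expi t - zeta).
  have [K [b' [hK hb _]]] := sufficient_has_data (@data j0) aj0.
  have [A [B [_ _]]] := contact_near zeta1 hb hK.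
  by apply: filterS => t [].
have T_small : \forall t \near circle_near zeta,
    rnorm (expi t - zeta) < Num.min (Num.min 4^-1 (e / 2)) (e / (4 * N)).
  apply: (@circle_near_dist _ _ (fun u => rnorm (u - zeta) <
    Num.min (Num.min 4^-1 (e / 2)) (e / (4 * N)))
    (Num.min (Num.min 4^-1 (e / 2)) (e / (4 * N)))) => //.
  by rewrite !lt_min invr_gt0 ltr0n !divr_gt0 // mulr_gt0.
have near1 : \forall t \near circle_near zeta, forall j, contact_index phi zeta p.+1 j ->
    `|1 - rnorm (phi j (approach zeta p (expi t))) ^+ 2 -
       2 * rnorm (b j 1%N) * gap zeta p (expi t)| <= e / 4 * gap zeta p (expi t).
  apply: filter_forall => j; have [cj|ncj] := pselect (contact_index phi zeta p.+1 j).
    by have [_ _ _ /(_ _ e40)] := Hb j cj; apply: filterS => t + _.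
  by near=> t => /ncj.
have near2 : \forall t \near circle_near zeta, forall j, ~ contact_index phi zeta p.+1 j ->
    0 < rnorm (expi t - zeta) ->
    2 / e * gap zeta p (expi t) <= 1 - rnorm (phi j (approach zeta p (expi t))) ^+ 2.
  apply: filter_forall => j; have [cj|ncj] := pselect (contact_index phi zeta p.+1 j).
    by near=> t.
  by have := noncontact_approach zeta1 (self j) (@data j) p1 ncj M0; apply: filterS => t + _.
have near3 : \forall t \near circle_near zeta, forall i j,
    contact_index phi zeta p.+1 i -> contact_index phi zeta p.+1 j ->
    data_vector p (phi i) zeta = data_vector p (phi j) zeta ->
    0 < rnorm (expi t - zeta) ->
    rnorm (phi i (approach zeta p (expi t)) - phi j (approach zeta p (expi t)))
      <= e / 4 * gap zeta p (expi t).
  apply: filter_forall => i; apply: filter_forall => j.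
  have [[ci [cj dd]]|nc] := pselect (contact_index phi zeta p.+1 i /\
    contact_index phi zeta p.+1 j /\ data_vector p (phi i) zeta = data_vector p (phi j) zeta).
    have [hi _ _ _] := Hb i ci; have [hj _ _ _] := Hb j cj.
    have := same_data_approach hi hj ((same i j ci cj).1 dd) e40.
    by apply: filterS => t + _ _ _.
  by near=> t => ci cj dd; case: nc.
have near4 : \forall t \near circle_near zeta, forall i j,
    contact_index phi zeta p.+1 i -> contact_index phi zeta p.+1 j ->
    data_vector p (phi i) zeta <> data_vector p (phi j) zeta ->
    0 < rnorm (expi t - zeta) ->
    2 / e * gap zeta p (expi t) <=
    rnorm (phi i (approach zeta p (expi t)) - phi j (approach zeta p (expi t))).
  apply: filter_forall => i; apply: filter_forall => j.
  have [[ci [cj dd]]|nc] := pselect (contact_index phi zeta p.+1 i /\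
    contact_index phi zeta p.+1 j /\ data_vector p (phi i) zeta <> data_vector p (phi j) zeta).
    have [hi _ _ _] := Hb i ci; have [hj _ _ _] := Hb j cj.
    have bb : exists2 l, (l <= p)%N & b i l != b j l.
      apply: contrapT => H; apply: dd; apply/same => // l lp.
      by apply: contrapT => /eqP bl; apply: H; exists l.
    have := distinct_data_approach (has_dataS hi) (has_dataS hj) bb M0.
    by apply: filterS => t + _ _ _.
  by near=> t => ci cj dd; case: nc.
have [t [[Tp Ts] [[h1 h2] [h3 h4]]]] := circle_near_ex zeta1
  (filterI (filterI T_pos T_small) (filterI (filterI near1 near2) (filterI near3 near4))).
move: Tp Ts h1 h2 h3 h4 => /= T0; rewrite !lt_min => /andP[/andP[T4 Te] TN] h1 h2 h3 h4.
have [r0 rT _] := gap_facts p1 T0 T4.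
have [w1 w2 _ _ w5] := approach_facts p1 (rnorm_expi t) T0 T4.
move: h1 h2 h3 h4 r0 rT w1 w2 w5; set w := approach _ _ _; set r := gap _ _ _.
set T := rnorm (expi t - zeta) in T0 T4 Te TN * => h1 h2 h3 h4 r0 rT w1 w2 w5.
clearbody r.
have wE : 1 - rnorm w ^+ 2 = 2 * r - r ^+ 2 by rewrite w1; ring.
have r1 : r <= 1 by lra.
have rr : r ^+ 2 <= r by rewrite expr2 ler_piMl // ltW.
have rw : r <= 1 - rnorm w ^+ 2 by rewrite wE; lra.
have rw2 : 1 - rnorm w ^+ 2 <= 2 * r by rewrite wE; have := sqr_ge0 r; lra.
exists w; split => //.
- by apply: le_lt_trans w5 _; lra.
- move=> i j ci cj dd.
  have f1 := selfmap_disk (self i) w2.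
  (* The diagonal quantity [1 - |phi_i w|^2] plus a correction by [phi_i w - phi_j w]; the term in
     [r ^+ 2] comes from [1 - |w|^2 = 2 r - r ^+ 2]. *)
  have -> : 1 - (phi i w)^* * phi j w - realC (rnorm (b i 1%N) * (1 - rnorm w ^+ 2)) =
     realC (1 - rnorm (phi i w) ^+ 2 - 2 * rnorm (b i 1%N) * r)
     + (phi i w)^* * (phi i w - phi j w) + realC (rnorm (b i 1%N) * r ^+ 2).
    rewrite wE [RHS]addrAC -realCD [(phi i w)^* * (_ - _)]mulrBr.
    rewrite [(phi i w)^* * phi i w]mulrC -rnorm_sqE addrA -realCD addrAC -realC1 -realCB.
    by congr (realC _ - _); ring.
  apply: (@le_trans _ _ (e * r)); last by rewrite ler_wpM2l // ltW.
  apply: le_trans (rnormD _ _) _; rewrite rnorm_realC.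
  have := rnormD (realC (1 - rnorm (phi i w) ^+ 2 - 2 * rnorm (b i 1%N) * r))
    ((phi i w)^* * (phi i w - phi j w)).
  rewrite rnorm_realC rnormM rnorm_conj.
  have a1 := h1 i ci; have a2 := h3 i j ci cj dd T0.
  have a3 : rnorm (phi i w) * rnorm (phi i w - phi j w) <= rnorm (phi i w - phi j w).
    by rewrite ler_piMl ?rnorm_ge0 // ltW.
  have a4 : `|rnorm (b i 1%N) * r ^+ 2| <= e / 4 * r.
    have n0 : 0 <= rnorm (b i 1%N) * r ^+ 2.
      by apply: mulr_ge0; [exact: rnorm_ge0|exact: sqr_ge0].
    rewrite (ger0_norm n0) expr2 mulrA ler_wpM2r ?(ltW r0) //.
    apply: (@le_trans _ _ (N * T)).
      by apply: ler_pM; rewrite ?rnorm_ge0 ?(ltW r0) //; lra.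
    by move: TN; rewrite ltr_pdivlMr ?mulr_gt0 //; lra.
  have er : 0 <= e * r by rewrite mulr_ge0 // ltW.
  lra.
- move=> i j ci cj dd; have := h4 i j ci cj dd T0.
  have fi := selfmap_disk (self i) w2; have fj := selfmap_disk (self j) w2.
  have : rnorm (phi i w - phi j w) <= rnorm (1 - (phi i w)^* * phi j w).
    rewrite (rnorm_distC (phi i w)) -(@ler_pXn2r _ 2) ?nnegrE ?rnorm_ge0 // rnorm_1subconj lerDl.
    by rewrite mulr_ge0 // ltW // one_sub_sqr_gt0.
  move=> g1 g2; have g3 := le_trans g2 g1; move: g3; rewrite mulrAC ler_pdivrMr //; lra.
- move=> j nj; have := h2 j nj T0; rewrite mulrAC ler_pdivrMr //; lra.
Unshelve. all: by end_near. Qed.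

End Family.

(** * Essential norms *)

Section Hilbert.
Variables (R : realType) (H : completeNormedModType (cplx R)).
Local Notation C := (cplx R).
Variable dot : {dot H for @Num.conj C}.
Hypothesis dot_norm : forall f : H, `|f| ^+ 2 = dot f f.
Implicit Types f g : H.

Lemma dotC f g : dot f g = (dot g f)^*.
Proof. by rewrite (hermC dot) /= expr0 mul1r. Qed.

Lemma dotDl f g h : dot (f + g) h = dot f h + dot g h.
Proof. exact: linearDl. Qed.

Lemma dotZl (a : C) f g : dot (a *: f) g = a * dot f g.
Proof. exact: linearZl. Qed.

Lemma dotDr f g h : dot f (g + h) = dot f g + dot f h.
Proof. by rewrite dotC dotDl rmorphD /= -!dotC. Qed.

Lemma dotZr (a : C) f g : dot f (a *: g) = a^* * dot f g.
Proof. by rewrite dotC dotZl rmorphM /= -dotC. Qed.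

Lemma dot_suml (I : Type) (s : seq I) (F : I -> H) g :
  dot (\sum_(i <- s) F i) g = \sum_(i <- s) dot (F i) g.
Proof.
elim: s => [|i s IH]; first by rewrite !big_nil linear0l.
by rewrite !big_cons dotDl IH.
Qed.

Lemma dot_sumr (I : Type) (s : seq I) (F : I -> H) g :
  dot g (\sum_(i <- s) F i) = \sum_(i <- s) dot g (F i).
Proof. by rewrite dotC dot_suml rmorph_sum /=; apply: eq_bigr => i _; rewrite -dotC. Qed.

Lemma dotE f : dot f f = realC (rnorm f ^+ 2).
Proof. by rewrite -dot_norm normE realCX. Qed.

Lemma rnormZ (a : C) f : rnorm (a *: f) = rnorm a * rnorm f.
Proof. by apply: realC_inj; rewrite realCM -!normE normrZ. Qed.

Lemma rnorm_sqD f g : rnorm (f + g) ^+ 2 =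
  rnorm f ^+ 2 + rnorm g ^+ 2 + 2 * complex.Re (dot f g).
Proof.
have : realC (rnorm (f + g) ^+ 2) =
    realC (rnorm f ^+ 2) + realC (rnorm g ^+ 2) + (dot f g + (dot f g)^*).
  by rewrite -!dotE dotDl !dotDr (dotC g f); ring.
move: (dot f g) => [x y] /(congr1 (@complex.Re R)) /= ->.
by ring.
Qed.

Lemma cauchy_schwarz f g : rnorm (dot f g) <= rnorm f * rnorm g.
Proof.
have [->|g0] := eqVneq g 0.
  by rewrite dotC linear0l rmorph0 !rnorm0 mulr0.
have n0 : 0 < rnorm g by rewrite rnorm_gt0.
have ng0 : realC (rnorm g ^+ 2) != 0 by rewrite realC_eq0 expf_neq0 // gt_eqF.
pose a : C := dot f g / realC (rnorm g ^+ 2).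
have := sqr_ge0 (rnorm (f + (- a) *: g)); rewrite rnorm_sqD rnormZ rnormN.
have -> : dot f (- a *: g) = - realC (rnorm (dot f g) ^+ 2 / rnorm g ^+ 2).
  rewrite dotZr rmorphN /= /a rmorphM fmorphV /= realCM realCV rnorm_sqE.
  have -> : (realC (rnorm g ^+ 2))^* = realC (rnorm g ^+ 2).
    by apply/eqP; rewrite eq_complex /= oppr0 !eqxx.
  by ring.
rewrite /a rnormM rnormV rnorm_realC ger0_norm ?sqr_ge0 //=.
set X := rnorm (dot f g); rewrite exprMn => h.
have h2 : X ^+ 2 / rnorm g ^+ 2 <= rnorm f ^+ 2.
  have -> : X ^+ 2 / rnorm g ^+ 2 =
      2 * (X ^+ 2 / rnorm g ^+ 2) - (X / rnorm g ^+ 2) ^+ 2 * rnorm g ^+ 2.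
    by field; rewrite gt_eqF.
  lra.
rewrite -(@ler_pXn2r _ 2) ?nnegrE ?rnorm_ge0 ?mulr_ge0 ?rnorm_ge0 // exprMn.
by rewrite -ler_pdivrMr // exprn_gt0.
Qed.

(* Otherwise adding up [p] nearly orthogonal terms of the sequence, with suitable
   phases, gives vectors of norm [O (sqrt p)] whose product with [y] is of order
   [p]. *)
Lemma asymptotically_orthonormal_weak_null (x : nat -> H) :
  (forall n, rnorm (x n) = 1) ->
  (forall m e, 0 < e -> \forall n \near \oo, rnorm (dot (x m) (x n)) < e) ->
  forall y e, 0 < e -> \forall n \near \oo, rnorm (dot y (x n)) < e.
Proof.
move=> x1 xorth y e e0; apply: contrapT => bad.
have freq N : exists2 n, (N <= n)%N & e <= rnorm (dot y (x n)).
  apply: contrapT => nf; apply: bad; exists N => // n /= Nn.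
  by rewrite ltNge; apply/negP => en; apply: nf; exists n.
(* Each new term is chosen so late that its product with [v] is below 1/2, so the squared norm grows
   by at most 1 + 2 * (1/2); the phase [lam] makes its contribution to [dot y v] real and at least
   [e]. *)
have build p : exists v, [/\ rnorm v ^+ 2 <= 2 * p%:R, p%:R * e <= complex.Re (dot y v) &
    forall e', 0 < e' -> \forall n \near \oo, rnorm (dot v (x n)) < e'].
  elim: p => [|p [v [v1 v2 v3]]].
    exists 0; rewrite rnorm0 expr0n !mulr0 mul0r; split => //.
      by rewrite dotC linear0l rmorph0.
    by move=> e' e'0; exists 0%N => // n _ /=; rewrite linear0l rnorm0.
  have h20 : 0 < 2^-1 :> R by rewrite invr_gt0.
  have [N _ HN] := v3 _ h20; have [n Nn en] := freq N.
  have vn : rnorm (dot v (x n)) < 2^-1 := HN n Nn.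
  have d0 : dot y (x n) != 0 by rewrite -rnorm_gt0 (lt_le_trans e0).
  have nd0 : rnorm (dot y (x n)) != 0 by rewrite rnorm_eq0.
  pose lam : C := dot y (x n) / realC (rnorm (dot y (x n))).
  have nlam : rnorm lam = 1 by rewrite rnormM rnormV rnorm_realC ger0_norm ?rnorm_ge0 // divff.
  exists (v + lam *: x n); split.
  - rewrite rnorm_sqD rnormZ x1 nlam dotZr.
    have := Re_le_rnorm (lam^* * dot v (x n)); rewrite rnormM rnorm_conj nlam.
    by rewrite -natr1; lra.
  - rewrite dotDr dotZr ReD -natr1 mulrDl mul1r; apply: lerD => //.
    have -> : lam^* * dot y (x n) = realC (rnorm (dot y (x n))).
      rewrite /lam rmorphM fmorphV /=.
      have -> : (realC (rnorm (dot y (x n))))^* = realC (rnorm (dot y (x n))).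
        by apply/eqP; rewrite eq_complex /= oppr0 !eqxx.
      rewrite mulrAC [_^* * _]mulrC -rnorm_sqE -realCV -realCM; congr realC.
      by rewrite expr2 mulfK.
    exact: en.
  - move=> e' e'0; have e'20 : 0 < e' / 2 by rewrite divr_gt0.
    near=> m; rewrite dotDl dotZl.
    apply: le_lt_trans (rnormD _ _) _; rewrite rnormM nlam mul1r.
    have : rnorm (dot v (x m)) < e' / 2 by near: m; exact: v3.
    have : rnorm (dot (x n) (x m)) < e' / 2 by near: m; exact: xorth.
    lra.
pose Y := rnorm y ^+ 2.
have Y0 : 0 <= 2 * Y / e ^+ 2.
  by apply: divr_ge0; [apply: mulr_ge0 => //; exact: sqr_ge0|exact: sqr_ge0].
(* From [p e <= |y| |v|] and [|v|^2 <= 2 p] follows [p <= 2 Y / e ^+ 2], which this [p] violates. *)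
have [p Hp] : exists p : nat, 2 * Y / e ^+ 2 < p%:R.
  exists (Num.Def.archi_bound (2 * Y / e ^+ 2)); apply: archi_boundP; exact: Y0.
have [v [v1 v2 _]] := build p.
have p0 : 0 < p%:R :> R := le_lt_trans Y0 Hp.
have := le_trans v2 (le_trans (Re_le_rnorm _) (cauchy_schwarz y v)).
rewrite -(@ler_pXn2r _ 2) ?nnegrE ?mulr_ge0 ?rnorm_ge0 ?(ltW p0) ?(ltW e0) //.
rewrite !exprMn -/Y => h.
have h2 : Y * rnorm v ^+ 2 <= Y * (2 * p%:R) by rewrite ler_wpM2l // /Y sqr_ge0.
have : p%:R * (p%:R * e ^+ 2) <= p%:R * (2 * Y).
  by apply: le_trans (le_trans _ (le_trans h h2)) _; lra.
rewrite ler_pM2l // leNgt -ltr_pdivrMr ?Hp // exprn_gt0 //.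
Unshelve. all: by end_near. Qed.

(** [g n] represents [f |-> dot (T f) (x n)], so testing [T - K] on the normalized [g n] gives
    [|g n|] up to the product of [K (gh n)] with [x n]. Compactness brings [K (gh n)] close to a
    fixed [y] for arbitrarily late [n], and [dot y (x n)] tends to 0. *)
Theorem essential_norm_ge (T : H -> H) (x g : nat -> H) (S : R) :
  0 <= S -> (forall n, rnorm (x n) = 1) ->
  (forall y e, 0 < e -> \forall n \near \oo, rnorm (dot y (x n)) < e) ->
  (forall n f, dot (T f) (x n) = dot f (g n)) ->
  (forall e, 0 < e -> \forall n \near \oo, S - e <= rnorm (g n) ^+ 2) ->
  (S%:E <= essential_norm T ^+ 2)%E.
Proof.
move=> S0 x1 xweak adj gS.
suff main (K : {linear H -> H}) : compact_operator K ->
    ((Num.sqrt S)%:E <= op_norm (T \- K)%R)%E.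
  have le1 : ((Num.sqrt S)%:E <= essential_norm T)%E.
    by apply: le_ereal_inf_tmp => _ [K cK <-]; exact: main.
  have s0 : (0 <= (Num.sqrt S)%:E)%E by rewrite lee_fin sqrtr_ge0.
  have -> : S%:E = ((Num.sqrt S)%:E * (Num.sqrt S)%:E)%E.
    by rewrite -EFinM -expr2 sqr_sqrtr.
  exact: (lee_pmul s0 s0 le1 le1).
move=> cK.
have ub f : `|f| <= 1 -> ((rnorm ((T \- K)%R f))%:E <= op_norm (T \- K)%R)%E.
  by move=> f1; apply: ereal_sup_ubound; exists f.
case: (op_norm (T \- K)) ub => [r| |] ub; last 2 first.
- by rewrite leey.
- have := ub 0; rewrite normr0 ler01 => /(_ isT).
  by rewrite leeNy_eq.
have {}ub f : rnorm f <= 1 -> rnorm (T f - K f) <= r.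
  by move=> f1; rewrite -lee_fin; apply: ub; rewrite normE -realC1 realC_le.
have r0 : 0 <= r.
  by apply: le_trans (rnorm_ge0 _) (ub 0 _); rewrite rnorm0.
(* If [g n = 0] the inverse is 0 and so is [gh n]; the two properties below still hold. *)
pose gh n := realC (rnorm (g n))^-1 *: g n.
have gh1 n : rnorm (gh n) <= 1.
  rewrite rnormZ rnorm_realC ger0_norm ?invr_ge0 ?rnorm_ge0 //.
  by have [->|n0] := eqVneq (rnorm (g n)) 0; rewrite ?mulr0 ?ler01 // mulVf.
have ghg n : dot (gh n) (g n) = realC (rnorm (g n)).
  rewrite dotZl dotE -realCM; congr realC.
  by have [->|n0] := eqVneq (rnorm (g n)) 0; rewrite ?expr0n ?mulr0 // expr2 mulKf.
have bound n : rnorm (g n) <= r + rnorm (dot (K (gh n)) (x n)).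
  have -> : rnorm (g n) = rnorm (dot (T (gh n) - K (gh n)) (x n) + dot (K (gh n)) (x n)).
    rewrite -dotDl subrK adj ghg rnorm_realC ger0_norm //; exact: rnorm_ge0.
  apply: le_trans (rnormD _ _) _; rewrite lerD2r.
  by apply: le_trans (cauchy_schwarz _ _) _; rewrite x1 mulr1; exact: ub.
have [y [_ cly]] : closure (K @` [set f : H | `|f| <= 1]) `&`
    cluster ((fun n => K (gh n)) @ \oo) !=set0.
  apply: cK; exists 0%N => // n _ /=; apply: subset_closure; exists (gh n) => //=.
  by rewrite normE -realC1 realC_le.
have key e : 0 < e -> S - e <= (r + 2 * e) ^+ 2.
  move=> e0; have [N1 _ H1] := xweak y e e0; have [N2 _ H2] := gS e e0.
  have [_ [/= [n Nn <-] yn]] : ((fun n => K (gh n)) @` [set n | (N1 + N2 <= n)%N]) `&`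
      [set z | rnorm (z - y) < e] !=set0.
    apply: cly; first by exists (N1 + N2)%N => // n Nn; exists n.
    by apply/nbhs_rnormP; exists e.
  have h1 := H1 n (leq_trans (leq_addr _ _) Nn); have h2 := H2 n (leq_trans (leq_addl _ _) Nn).
  rewrite /= in h1 h2; apply: le_trans h2 _.
  rewrite lerXn2r ?nnegrE ?rnorm_ge0 //; first by rewrite addr_ge0 // mulr_ge0 // ltW.
  apply: le_trans (bound n) _; rewrite lerD2l.
  have -> : dot (K (gh n)) (x n) = dot (K (gh n) - y) (x n) + dot y (x n).
    by rewrite -dotDl subrK.
  apply: le_trans (rnormD _ _) _.
  have := cauchy_schwarz (K (gh n) - y) (x n); rewrite x1 mulr1; lra.
rewrite lee_fin -(@ler_pXn2r _ 2) ?nnegrE ?sqrtr_ge0 // sqr_sqrtr //.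
apply/ler_addgt0Pr => e e0.
(* With [d <= 1], the excess of [(r + 2 d) ^+ 2 + d] over [r ^+ 2] is at most [d * (4 r + 5)]. *)
pose d := Num.min 1 (e / (4 * r + 5)).
have p0 : 0 < 4 * r + 5 by lra.
have d0 : 0 < d by rewrite lt_min ltr01 divr_gt0.
have d1 : d <= 1 by rewrite ge_min lexx.
have d2 : d * (4 * r + 5) <= e by rewrite -ler_pdivlMr // ge_min lexx orbT.
have := key d d0; have : d ^+ 2 <= d by rewrite expr2 ler_piMl // ltW.
by nra.
Qed.

End Hilbert.

(** * Powers and Gram matrices *)

Section ComplexPower.
Variable R : realType.
Local Notation C := (cplx R).
Implicit Types (u : C) (s : R).

Lemma rnorm_cpowr u s : rnorm (cpowr u s) = rnorm u `^ s.
Proof.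
by rewrite /cpowr -/(realC _) rnormM rnorm_expi mulr1 rnorm_realC ger0_norm ?powR_ge0.
Qed.

Lemma cpowr_realC (x s : R) : 0 < x -> cpowr (realC x) s = realC (x `^ s).
Proof.
move=> x0; rewrite /cpowr -/(realC _) rnorm_realC gtr0_norm //= mul0r atan0 mulr0.
by rewrite /expi cos0 sin0 -[Complex 1 0]/(1 : C) mulr1.
Qed.

(** A positive factor leaves the quotient of imaginary by real part, hence the argument, unchanged;
    for real part 0 both quotients are 0 by convention. *)
Lemma cpowr_scale (r : R) u s : 0 < r ->
  cpowr (realC r * u) s = realC (r `^ s) * cpowr u s.
Proof.
move=> r0; rewrite /cpowr -!/(realC _) rnormM rnorm_realC gtr0_norm //.
rewrite powRM ?rnorm_ge0 ?(ltW r0) // realCM -mulrA; congr (_ * (_ * expi (_ * atan _))).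
case: u => a b /=; rewrite !mul0r subr0 addr0.
have [->|a0] := eqVneq a 0; first by rewrite mulr0 invr0 !mulr0.
by field; rewrite a0 gt_eqF.
Qed.

Lemma powR_small (s e : R) : 0 < s -> 0 < e -> exists2 d, 0 < d &
  forall y, 0 <= y -> y < d -> y `^ s < e.
Proof.
move=> s0 e0; have /cvgrPdist_lt/(_ _ e0) := powR_cvg0 s0.
move=> /nbhs_normP[d /= d0 Hd]; exists d => // y; rewrite le_eqVlt => /predU1P[<-|y0] yd.
  by rewrite powR0 ?gt_eqF.
have := Hd y; rewrite /= !sub0r !normrN gtr0_norm // => /(_ yd y0).
by rewrite ger0_norm // powR_ge0.
Qed.

(** Modulus and argument are treated apart: the real power is locally Lipschitz at [b], and near the
    positive axis the argument of [atan] is small. *)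
Lemma cpowr_continuous (b s e : R) : 0 < b -> 0 < e -> exists2 d, 0 < d &
  forall u, rnorm (u - realC b) < d -> rnorm (cpowr u s - realC (b `^ s)) < e.
Proof.
move=> b0 e0.
have [d1 d10 H1] := (is_derive_affineP _ _ _).1 (is_derive1_powR s b0) 1 ltr01.
set l := s * b `^ (s - 1) in H1.
pose N := `|l| + 1; have N0 : 0 < N by rewrite ltr_wpDl.
pose P := b `^ s + N * d1 + 1.
have P0 : 0 < P by rewrite ltr_wpDl // addr_ge0 ?powR_ge0 // mulr_ge0 // ltW.
have e2P : 0 < e / (2 * P) by rewrite divr_gt0 // mulr_gt0.
have [d2 d20 H2] := expi_continuous 0 e2P.
pose s' := `|s| + 1; have s'0 : 0 < s' by rewrite ltr_wpDl.
have /cvgrPdist_lt/(_ _ (divr_gt0 d20 s'0))/nbhs_normP[d3 /= d30 H3] := @continuous_atan R 0.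
have e2N : 0 < e / (2 * N) by rewrite divr_gt0 // mulr_gt0.
exists (Num.min (Num.min d1 (b / 2)) (Num.min (e / (2 * N)) (d3 * b / 2))).
  by rewrite !lt_min d10 e2N !divr_gt0 // mulr_gt0.
move=> u; rewrite !lt_min => /andP[/andP[u1 ub] /andP[uN u3]].
have nu : `|rnorm u - b| <= rnorm (u - realC b).
  have nb : rnorm (realC b) = b by rewrite rnorm_realC gtr0_norm.
  have := rnorm_lerB u (realC b); have := rnorm_lerB (realC b) u.
  by rewrite (rnorm_distC (realC b)) nb ler_norml; lra.
have h1 : `|rnorm u `^ s - b `^ s| <= N * `|rnorm u - b|.
  have := H1 (rnorm u - b) (le_lt_trans nu u1).
  rewrite [b + (_ - _)]addrC subrK mul1r.
  have := ler_normD (rnorm u `^ s - b `^ s - l * (rnorm u - b)) (l * (rnorm u - b)).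
  by rewrite subrK normrM /N; lra.
have Re_u : b / 2 < complex.Re u.
  have := normRe_le (u - realC b); rewrite ReB /= ler_norml; lra.
have Im_u : `|complex.Im u| <= rnorm (u - realC b).
  by have := normIm_le (u - realC b); rewrite ImB /= subr0.
have h2 : rnorm (expi (s * atan (complex.Im u / complex.Re u)) - 1) < e / (2 * P).
  have e1 : expi 0 = 1 :> C by rewrite /expi cos0 sin0.
  rewrite -e1; apply: H2; rewrite subr0 normrM.
  have : `|atan (complex.Im u / complex.Re u)| < d2 / s'.
    have := H3 (complex.Im u / complex.Re u); rewrite /= atan0 !sub0r !normrN; apply.
    have Re0 : 0 < complex.Re u by lra.
    rewrite normrM normfV (gtr0_norm Re0) ltr_pdivrMr //.
    apply: le_lt_trans Im_u (lt_le_trans u3 _).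
    by rewrite -mulrA ler_wpM2l // ltW.
  rewrite ltr_pdivlMr // => h; apply: le_lt_trans h.
  by rewrite mulrC ler_wpM2l // /s' lerDl.
have -> : cpowr u s - realC (b `^ s) =
   realC (rnorm u `^ s) * (expi (s * atan (complex.Im u / complex.Re u)) - 1)
   + realC (rnorm u `^ s - b `^ s).
  by rewrite /cpowr -/(realC _) realCB; ring.
apply: le_lt_trans (rnormD _ _) _; rewrite rnormM !rnorm_realC.
have h3 : `|rnorm u `^ s| <= P.
  have := ler_normD (rnorm u `^ s - b `^ s) (b `^ s); rewrite subrK (ger0_norm (powR_ge0 b s)).
  have : N * `|rnorm u - b| <= N * d1.
    by rewrite ler_wpM2l ?(ltW N0) // (le_trans nu) // ltW.
  by rewrite /P; lra.
have h4 : `|rnorm u `^ s| * rnorm (expi (s * atan (complex.Im u / complex.Re u)) - 1) <= e / 2.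
  apply: (@le_trans _ _ (P * (e / (2 * P)))).
    by apply: ler_pM; rewrite ?rnorm_ge0 // ltW.
  by rewrite le_eqVlt; apply/orP; left; apply/eqP; field; rewrite gt_eqF.
have h5 : N * `|rnorm u - b| < e / 2.
  apply: (@le_lt_trans _ _ (N * rnorm (u - realC b))); first by rewrite ler_wpM2l // ltW.
  by move: uN; rewrite ltr_pdivlMr ?mulr_gt0 //; lra.
lra.
Qed.

End ComplexPower.

(** * Limits of Gram entries, and sums over classes *)

Section Gram.
Variables (R : realType) (beta : R).
Local Notation C := (cplx R).
Hypothesis beta0 : 0 < beta.

(** By homogeneity the entry is the power of [z n / L n], which tends to the positive real [B]. *)
Lemma gram_same (L : nat -> R) (z : nat -> C) (B : R) : 0 < B ->
  (forall n, 0 < L n) ->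
  (forall e, 0 < e -> \forall n \near \oo, rnorm (z n - realC (B * L n)) <= e * L n) ->
  forall e, 0 < e -> \forall n \near \oo,
    rnorm (cpowr (z n) (- beta) * realC (L n `^ beta) - realC (B `^ (- beta))) < e.
Proof.
move=> B0 L0 H e e0; have [d d0 Hd] := cpowr_continuous (- beta) B0 e0.
have d20 : 0 < d / 2 by rewrite divr_gt0.
have := H _ d20; apply: filterS => n Hn.
have cL : realC (L n) != 0 by rewrite realC_eq0 gt_eqF.
pose q := z n / realC (L n).
have zE : z n = realC (L n) * q by rewrite /q mulrC divfK.
rewrite zE cpowr_scale // mulrAC -realCM powRN mulVf ?gt_eqF ?powR_gt0 // realC1 mul1r.
apply: Hd; have -> : q - realC B = (z n - realC (B * L n)) / realC (L n).
  by rewrite /q realCM; field.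
rewrite rnormM rnormV rnorm_realC gtr0_norm // ltr_pdivrMr //.
by apply: le_lt_trans Hn _; rewrite ltr_pM2r // ltr_pdivrMr // ltr_pMr // ltr1n.
Qed.

(** The modulus is [(L n / |z n|) ^ beta], and the base tends to 0. *)
Lemma gram_distinct (L : nat -> R) (z : nat -> C) : (forall n, 0 < L n) ->
  (forall e, 0 < e -> \forall n \near \oo, L n <= e * rnorm (z n)) ->
  forall e, 0 < e -> \forall n \near \oo,
    rnorm (cpowr (z n) (- beta) * realC (L n `^ beta)) < e.
Proof.
move=> L0 H e e0; have [d d0 Hd] := powR_small beta0 e0.
have d20 : 0 < d / 2 by rewrite divr_gt0.
have := H _ d20; apply: filterS => n Hn.
rewrite rnormM rnorm_cpowr rnorm_realC (ger0_norm (powR_ge0 _ _)).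
have z0 : 0 < rnorm (z n).
  rewrite lt0r rnorm_ge0 andbT; apply/eqP => z0.
  by move: Hn; rewrite z0 mulr0 leNgt L0.
apply: le_lt_trans (Hd (d / 2) (ltW d20) _); last by rewrite ltr_pdivrMr // ltr_pMr // ltr1n.
rewrite powRN mulrC ler_pdivrMr ?powR_gt0 // -powRM ?rnorm_ge0 ?(ltW d20) //.
apply: (ge0_ler_powR (ltW beta0)); rewrite ?nnegrE; [exact: ltW| |exact: Hn].
by apply: mulr_ge0; [exact: ltW|exact: rnorm_ge0].
Qed.

End Gram.

Lemma fsbig_finType (V : nmodType) (I : finType) (A : set I) (F : I -> V) :
  \sum_(i \in A) F i = \sum_(i | `[< A i >]) F i.
Proof.
rewrite (@fsbigE _ _ _ _ _ [seq i <- enum I | i \in A]).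
- rewrite big_filter_cond big_enum_cond /=; apply: eq_bigl => i.
  by rewrite andbb; apply/idP/asboolP => [/set_mem|/mem_set].
- by rewrite filter_uniq // enum_uniq.
- by move=> i /=; rewrite mem_filter => /andP[/set_mem].
- by move=> i Ai; rewrite mem_filter mem_enum andbT (mem_set Ai).
Qed.

(* Both sides run over the pairs [(i, j)] in a common class. *)
Lemma class_sum_gram (R : realType) (n : nat) (T : choiceType) (D : set T)
    (P : 'I_n -> Prop) (cl : 'I_n -> T) (c : 'I_n -> cplx R) (r : T -> R) :
  finite_set D -> (forall i, P i -> D (cl i)) ->
  realC (\sum_(d \in D)
    rnorm (\sum_(j \in [set j | P j /\ cl j = d]) c j) ^+ 2 * r d) =
  \sum_i \sum_j (c i)^* * c j *
    (if `[< P i /\ P j /\ cl i = cl j >] then realC (r (cl i)) else 0).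
Proof.
move=> fD PD; rewrite fsbig_finite //=.
have -> : forall s : seq T, realC (\sum_(d <- s)
    rnorm (\sum_(j \in [set j | P j /\ cl j = d]) c j) ^+ 2 * r d) =
    \sum_(d <- s) \sum_i \sum_j (c i)^* * c j *
      (if `[< P i /\ cl i = d >] && `[< P j /\ cl j = d >] then realC (r d) else 0).
  elim=> [|d s IH]; first by rewrite !big_nil realC0.
  rewrite !big_cons realCD IH; congr (_ + _).
  rewrite realCM rnorm_sqE fsbig_finType big_mkcond /= [X in X * _ = _]mulrC.
  rewrite rmorph_sum big_distrl big_distrl /=; apply: eq_bigr => i _.
  rewrite big_distrr big_distrl /=; apply: eq_bigr => j _.
  by case: ifP => _; case: ifP => _; rewrite ?(conjC0, mulr0, mul0r).
rewrite exchange_big /=; apply: eq_bigr => i _.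
rewrite exchange_big /=; apply: eq_bigr => j _.
rewrite -big_distrr /=; congr (_ * _).
case: asboolP => [[Pi [Pj ij]]|nP]; last first.
  rewrite big1 // => d _; case: asboolP => // -[Pi id]; case: asboolP => // -[Pj jd].
  by exfalso; apply: nP; rewrite id jd.
rewrite (bigD1_seq (cl i)) ?finmap.fset_uniq //=; last first.
  by rewrite in_fset_set // mem_set //; exact: PD.
rewrite big1 ?addr0.
  by case: asboolP => [_|[]//]; case: asboolP => [_|[]//].
by move=> d di; case: asboolP => // -[_ id]; rewrite id eqxx in di.
Qed.

(** * Kernels and the lower bound *)

Section Kernels.
Variables (R : realType) (beta : R).
Local Notation C := (cplx R).
Hypothesis beta0 : 0 < beta.
Variable H : Dspace beta.
Local Notation dot := (rkhs_dot H).

Lemma kernel_vectors : exists kv : C -> H, forall w, rnorm w < 1 ->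
  (forall z, rnorm z < 1 -> Defs.eval (kv w) z = cpowr (1 - w^* * z) (- beta)) /\
  (forall f : H, dot f (kv w) = Defs.eval f w).
Proof.
have /choice[kv Hkv] : forall w, exists kw : H, rnorm w < 1 ->
    (forall z, rnorm z < 1 -> Defs.eval kw z = cpowr (1 - w^* * z) (- beta)) /\
    (forall f : H, dot f kw = Defs.eval f w).
  move=> w; have [w1|nw] := pselect (rnorm w < 1); last by exists 0.
  have [kw h1 h2] := rkhs_kernel H ((diskE w).2 w1).
  by exists kw => _; split => // z /diskE; exact: h1.
by exists kv.
Qed.

Section Sequence.
Variables (kv : C -> H) (w : nat -> C) (zeta : C).
Hypothesis kvE : forall w, rnorm w < 1 ->
  (forall z, rnorm z < 1 -> Defs.eval (kv w) z = cpowr (1 - w^* * z) (- beta)) /\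
  (forall f : H, dot f (kv w) = Defs.eval f w).
Hypothesis w1 : forall n, rnorm (w n) < 1.
Hypothesis zeta1 : rnorm zeta = 1.
Hypothesis wz : forall e, 0 < e -> \forall n \near \oo, rnorm (w n - zeta) < e.

Lemma dot_kv a b : rnorm a < 1 -> rnorm b < 1 ->
  dot (kv a) (kv b) = cpowr (1 - a^* * b) (- beta).
Proof.
by move=> a1 b1; have [_ ->] := kvE b1; have [+ _] := kvE a1; apply.
Qed.

Let L n := 1 - rnorm (w n) ^+ 2.
Let L0 n : 0 < L n. Proof. exact: one_sub_sqr_gt0. Qed.

Lemma one_sub_sqr_cvg0 e : 0 < e -> \forall n \near \oo, L n < e.
Proof.
move=> e0; have e20 : 0 < e / 2 by rewrite divr_gt0.
have := wz e20; apply: filterS => n wn.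
have := rnorm_lerB zeta (w n); rewrite zeta1 rnorm_distC /L.
by have := w1 n; have := rnorm_ge0 (w n); nra.
Qed.

(** The squared norm of the kernel at [w] is [(1 - |w|^2) ^ (- beta)], so the factor is the
    reciprocal of the norm. *)
Definition normalized_kernel n : H := realC (L n `^ (beta / 2)) *: kv (w n).

Lemma half_power (x : R) : 0 < x -> x `^ (beta / 2) * x `^ (beta / 2) = x `^ beta.
Proof.
move=> x0; rewrite -powRD; last by apply/implyP => _; rewrite gt_eqF.
by congr (_ `^ _); field.
Qed.

Lemma normalized_kernel1 n : rnorm (normalized_kernel n) = 1.
Proof.
have dE := dotE (@rkhs_normE _ _ H).
suff : rnorm (normalized_kernel n) ^+ 2 = 1.
  move=> h; apply/eqP; rewrite -(@eqrXn2 _ 2) ?rnorm_ge0 // h expr1n //.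
have cE : cpowr (1 - (w n)^* * w n) (- beta) = realC (L n `^ (- beta)).
  by rewrite mulrC -rnorm_sqE -realC1 -realCB cpowr_realC //; exact: L0.
have := dE (kv (w n)); rewrite dot_kv // cE => /realC_inj kE.
rewrite /normalized_kernel rnormZ rnorm_realC (ger0_norm (powR_ge0 _ _)) exprMn -kE expr2.
by rewrite half_power // powRN divff // gt_eqF // powR_gt0.
Qed.

(** For fixed [m] the kernel at [w m] is bounded on the disk, as [|1 - conj (w m) z| >= 1 - |w m|],
    while the factor [L n ^ (beta / 2)] tends to 0. *)
Lemma normalized_kernel_orthogonal m e : 0 < e ->
  \forall n \near \oo, rnorm (dot (normalized_kernel m) (normalized_kernel n)) < e.
Proof.
move=> e0; pose a := 1 - rnorm (w m); have a0 : 0 < a by rewrite subr_gt0.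
pose Q := L m `^ (beta / 2) * a `^ (- beta).
have Q0 : 0 < Q by rewrite mulr_gt0 // powR_gt0.
have [d d0 Hd] := powR_small (divr_gt0 beta0 (ltr0n R 2)) (divr_gt0 e0 Q0).
have := one_sub_sqr_cvg0 d0; apply: filterS => n Ln.
have {}Ln := Hd _ (ltW (L0 n)) Ln.
rewrite /normalized_kernel dotZl dotZr dot_kv // 2!rnormM rnorm_conj !rnorm_realC.
rewrite !(ger0_norm (powR_ge0 _ _)) rnorm_cpowr.
have h1 : rnorm (1 - (w m)^* * w n) `^ (- beta) <= a `^ (- beta).
  have le1 : a <= rnorm (1 - (w m)^* * w n).
    have := rnorm_lerB 1 ((w m)^* * w n); rewrite rnorm1 rnormM rnorm_conj /a.
    have : rnorm (w m) * rnorm (w n) <= rnorm (w m) by rewrite ler_piMr ?rnorm_ge0 // ltW.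
    lra.
  have p0 : 0 < rnorm (1 - (w m)^* * w n) by apply: lt_le_trans le1.
  rewrite !powRN lef_pV2 ?posrE ?powR_gt0 //.
  by apply: (ge0_ler_powR (ltW beta0)); rewrite ?nnegrE // ltW.
move: Ln; rewrite ltr_pdivlMr // => Ln; apply: le_lt_trans Ln.
rewrite mulrCA ler_wpM2l ?powR_ge0 // ler_wpM2l ?powR_ge0 //.
Qed.

Lemma normalized_kernel_weak_null y e : 0 < e ->
  \forall n \near \oo, rnorm (dot y (normalized_kernel n)) < e.
Proof.
apply: (asymptotically_orthonormal_weak_null (@rkhs_normE _ _ H)).
- exact: normalized_kernel1.
- by move=> m e'; exact: normalized_kernel_orthogonal.
Qed.

End Sequence.
End Kernels.

(** * Convergence of the Gram matrix and the lower bound *)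

Theorem theorem5p7 (R : realType) (beta : R) (hbeta : 1 <= beta)
    (H : Dspace beta)
    (n : nat) (phi : 'I_n -> cplx R -> cplx R)
    (hphi : forall j, analytic_selfmap (phi j))
    (zeta : cplx R) (hzeta : (\bigcup_j angular_set (phi j)) zeta)
    (hdata : forall j, angular_set (phi j) zeta ->
       sufficient_data (phi j) zeta)
    (Cphi : 'I_n -> H -> H)
    (hCphi : forall j, composition_operator (phi j) (Cphi j))
    (c : 'I_n -> cplx R) (k : nat) (hk : (3 <= k)%N) :
  ((\sum_(d \in data_set phi zeta k.-1)
      rnorm (\sum_(j \in [set j | contact_index phi zeta k j /\
                                 data_vector k.-1 (phi j) zeta = d]) c j) ^+ 2
      / rnorm d`_1 `^ beta)%:E
   <= essential_norm (fun f : H => (\sum_(j < n) c j *: Cphi j f)%R) ^+ 2)%E.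
Proof.
have beta0 : 0 < beta by apply: lt_le_trans hbeta.
case: k hk => // p; rewrite ltnS => hp; rewrite -[p.+1.-1]/p.
have p1 : (1 <= p)%N by apply: leq_trans hp.
have [j0 _ ang0] := hzeta.
have zeta1 : rnorm zeta = 1 by apply/norm1E; case: ang0.
have [b [bE asym]] := approach_asymptotics zeta1 p1 hphi hdata (ex_intro _ j0 ang0).
have /choice[w Hw] := fun m : nat => asym m.+1%:R^-1 (ltac:(by rewrite invr_gt0 ltr0n)).
have w1 m : rnorm (w m) < 1 by case: (Hw m).
have small e : 0 < e -> \forall m \near \oo, m.+1%:R^-1 < e :> R.
  by move=> e0; have := near_infty_natSinv_lt (PosNum e0).
have wz e : 0 < e -> \forall m \near \oo, rnorm (w m - zeta) < e.
  move=> /small; apply: filterS => m me; case: (Hw m) => _ h _ _ _; exact: lt_trans h me.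
have [kv kvE] := kernel_vectors H.
pose L m := 1 - rnorm (w m) ^+ 2.
have L0 m : 0 < L m by exact: one_sub_sqr_gt0.
pose cont j := contact_index phi zeta p.+1 j.
pose dv j := data_vector p (phi j) zeta.
pose ell i j : cplx R := if `[< cont i /\ cont j /\ dv i = dv j >]
  then realC (rnorm (dv i)`_1 `^ (- beta)) else 0.
pose gram m i j : cplx R :=
  cpowr (1 - (phi i (w m))^* * phi j (w m)) (- beta) * realC (L m `^ beta).
have dv1 j : cont j -> (dv j)`_1 = b j 1%N.
  move=> cj; have [_ dE] := bE j cj; have p2 : (1 < p.+1)%N by [].
  by have := dE (Ordinal p2); rewrite (tnth_nth 0) /= => ->; rewrite mul1r.
have gram_cvg i j e : 0 < e -> \forall m \near \oo, rnorm (gram m i j - ell i j) < e.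
  move=> e0; rewrite /ell; case: asboolP => [[ci [cj dd]]|nc].
    rewrite dv1 //; apply: gram_same => //.
      by rewrite rnorm_gt0; case: (bE i ci).
    move=> e' /small; apply: filterS => m me.
    case: (Hw m) => _ _ /(_ i j ci cj dd) h _ _; apply: le_trans h _.
    by apply: ler_wpM2r; [exact: ltW (L0 m)|exact: ltW].
  (* For every remaining pair it suffices that [1 - |w|^2] is negligible against
     [|1 - conj (phi_i w) phi_j w|]: either both maps are in contact with different data, or one is
     out of contact. *)
  have ndist : forall e', 0 < e' -> \forall m \near \oo,
      L m <= e' * rnorm (1 - (phi i (w m))^* * phi j (w m)).
    move=> e' e'0.
    have [[ci cj]|ncc] := pselect (cont i /\ cont j).
      have dd : dv i <> dv j by move=> dd; apply: nc.
      have := small _ e'0; apply: filterS => m me.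
      case: (Hw m) => _ _ _ /(_ i j ci cj dd) h _; apply: le_trans h _.
      by rewrite ler_wpM2r ?rnorm_ge0 // ltW.
    (* If only one map is out of contact, the other still has this bound; the two combine through
       [|1 - conj x y|^2 >= (1 - |x|^2) (1 - |y|^2)], which is why [main] compares squares. *)
    have low l : exists2 a, 0 < a & forall m, a * L m <= 1 - rnorm (phi l (w m)) ^+ 2.
      have [a a0 Ha] := selfmap_one_sub_ge (hphi l); exists (a / 2); first by rewrite divr_gt0.
      move=> m; have := Ha _ (w1 m); have := selfmap_disk (hphi l) (w1 m).
      have := rnorm_ge0 (phi l (w m)); have := rnorm_ge0 (w m); have := w1 m.
      rewrite /L; move: (rnorm (w m)) (rnorm (phi l (w m))) => x y x1 x0 y0 y1 h.
      have : a / 2 * (1 - x ^+ 2) <= a * (1 - x) by have := mulr_ge0 (ltW a0) (sqr_ge0 (1 - x)); lra.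
      have : y ^+ 2 <= y by nra.
      lra.
    have main l l' : ~ cont l -> \forall m \near \oo,
        L m ^+ 2 <= e' ^+ 2 * ((1 - rnorm (phi l (w m)) ^+ 2) * (1 - rnorm (phi l' (w m)) ^+ 2)).
      move=> ncl; have [a a0 Ha] := low l'.
      have := small (e' ^+ 2 * a); rewrite mulr_gt0 ?exprn_gt0 // => /(_ isT).
      apply: filterS => m me; case: (Hw m) => _ _ _ _ /(_ l ncl); rewrite -/(L m) => h.
      have pl := one_sub_sqr_gt0 (selfmap_disk (hphi l) (w1 m)).
      have h1 : L m <= e' ^+ 2 * a * (1 - rnorm (phi l (w m)) ^+ 2).
        by apply: le_trans h _; rewrite ler_wpM2r // ltW.
      have h2 := Ha m.
      rewrite expr2; apply: (le_trans (ler_wpM2r (ltW (L0 m)) h1)).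
      have -> : e' ^+ 2 * a * (1 - rnorm (phi l (w m)) ^+ 2) * L m =
        e' ^+ 2 * ((1 - rnorm (phi l (w m)) ^+ 2) * (a * L m)) by ring.
      by apply: ler_wpM2l; [exact: sqr_ge0|apply: ler_wpM2l; [exact: ltW|]].
    have : \forall m \near \oo, L m ^+ 2 <=
        e' ^+ 2 * ((1 - rnorm (phi j (w m)) ^+ 2) * (1 - rnorm (phi i (w m)) ^+ 2)).
      have [ci|nci] := pselect (cont i); last first.
        by have := main i j nci; apply: filterS => m; rewrite [X in _ <= _ * X]mulrC.
      by apply: main => cj; apply: ncc.
    apply: filterS => m h; rewrite -(@ler_pXn2r _ 2) ?nnegrE ?(ltW (L0 m)) //; last first.
      by rewrite mulr_ge0 ?rnorm_ge0 // ltW.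
    rewrite exprMn rnorm_1subconj; apply: le_trans h _.
    by rewrite ler_wpM2l ?sqr_ge0 // lerDr sqr_ge0.
  by have := gram_distinct beta0 L0 ndist e0; apply: filterS => m; rewrite subr0.
pose g m : H := realC (L m `^ (beta / 2)) *: \sum_j (c j)^* *: kv (phi j (w m)).
set S := \sum_(d \in _) _.
have SE : realC S = \sum_i \sum_j (c i)^* * c j * ell i j.
  rewrite /ell -(@class_sum_gram _ _ _ (data_set phi zeta p) cont dv c
     (fun d => rnorm d`_1 `^ (- beta))).
  - congr realC; apply: eq_fsbigr => d _; by rewrite powRN.
  - by apply: finite_image; exact: finite_finset.
  (* [data_set] at order [p] runs over contact at least [p], hence contains all classes of contact
     at least [p.+1]; its other vectors have an empty inner sum. *)
  - move=> i [ai [a ha hc]]; exists i => //; split => //; exists a => //.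
    by apply: le_trans ha; rewrite ler_nat.
have phi1 j m : rnorm (phi j (w m)) < 1 by exact: selfmap_disk.
have gE m : realC (rnorm (g m) ^+ 2) = \sum_i \sum_j (c i)^* * c j * gram m i j.
  rewrite -(dotE (@rkhs_normE _ _ H)) /g dotZl dotZr dot_suml.
  have -> : (realC (L m `^ (beta / 2)))^* = realC (L m `^ (beta / 2)).
    by apply/eqP; rewrite eq_complex /= oppr0 !eqxx.
  rewrite mulrA -realCM half_power // big_distrr /=; apply: eq_bigr => i _.
  rewrite dotZl dot_sumr big_distrr big_distrr /=; apply: eq_bigr => j _.
  by rewrite dotZr conjCK (dot_kv kvE) // /gram; ring.
apply: (@essential_norm_ge _ _ _ (@rkhs_normE _ _ H) _ (normalized_kernel kv w) g).
- rewrite /S fsbig_finite /=; last by apply: finite_image; exact: finite_finset.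
  by apply: sumr_ge0 => d _; rewrite divr_ge0 ?sqr_ge0 ?powR_ge0.
- exact: normalized_kernel1.
- by move=> y e; exact: (normalized_kernel_weak_null beta0 kvE w1 zeta1 wz).
- move=> m f; rewrite /normalized_kernel /g !dotZr; congr (_ * _).
  rewrite dot_suml dot_sumr; apply: eq_bigr => j _.
  rewrite dotZl dotZr conjCK; congr (_ * _).
  have [_ ->] := kvE _ (w1 m); have [_ ->] := kvE _ (phi1 j m).
  by apply: hCphi; exact/diskE.
(* [Q] is the total weight of the coefficients, plus 1 to keep it positive; entries within [e / Q]
   of their limits put the quadratic form within [e] of [S]. *)
- move=> e e0; pose Q := \sum_i \sum_j rnorm (c i) * rnorm (c j) + 1.
  have Q0 : 0 < Q.
    rewrite ltr_wpDl // sumr_ge0 // => i _; rewrite sumr_ge0 // => j _.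
    by rewrite mulr_ge0 ?rnorm_ge0.
  have eQ : 0 < e / Q by rewrite divr_gt0.
  have near_all : \forall m \near \oo, forall i j, rnorm (gram m i j - ell i j) < e / Q.
    by apply: filter_forall => i; apply: filter_forall => j; exact: gram_cvg.
  move: near_all; apply: filterS => m hm.
  have : rnorm (realC (rnorm (g m) ^+ 2 - S)) <= e.
    rewrite realCB gE SE -sumrB; apply: le_trans (rnorm_sum _ _ _) _.
    apply: (@le_trans _ _ ((\sum_i \sum_j rnorm (c i) * rnorm (c j)) * (e / Q))); last first.
      rewrite mulrA ler_pdivrMr // mulrC ler_wpM2l ?(ltW e0) // /Q lerDl //.
    rewrite big_distrl /=; apply: ler_sum => i _.
    rewrite -sumrB big_distrl /=; apply: le_trans (rnorm_sum _ _ _) _.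
    apply: ler_sum => j _; rewrite -mulrBr !rnormM rnorm_conj.
    by rewrite ler_wpM2l ?mulr_ge0 ?rnorm_ge0 // ltW.
  by rewrite rnorm_realC ler_norml; lra.
Qed.
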